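(* Let $0<R_1<R_2$. As $\epsilon\to\frac\pi2$ with $\epsilon<\frac\pi2$, $$\lambda_1^{NND}(\widehat{\mathfrak D}(2,\epsilon))=\frac{j_{0,1}^2}{R_2^2}+\frac{4}{R_2^2}\left(\frac{J_0(j_{0,1}R_1/R_2)}{J_0'(j_{0,1})}\right)^2\frac{1}{|\log(\pi/2-\epsilon)|}+o\left(\frac{1}{|\log(\pi/2-\epsilon)|}\right).$$
   Context: Let $(r,\theta)$ be polar coordinates in $\mathbb R^2$. For $\epsilon\in[0,\frac\pi2]$, $$\widehat{\mathfrak D}(2,\epsilon)=\{0<r<R_2,\ 0<\theta<\tfrac\pi2\}\setminus\{r=R_1,\ \epsilon\le\theta<\tfrac\pi2\},$$ i.e. the open quarter disc of radius $R_2$ from which a circular-arc crack on the circle of radius $R_1$ has been removed. $\lambda_1^{NND}(\widehat{\mathfrak D}(2,\epsilon))$ is the lowest eigenvalue of $-\Delta$ in $\widehat{\mathfrak D}(2,\epsilon)$ with homogeneous Neumann condition on both radii $\theta=0$ and $\theta=\frac\pi2$, and homogeneous Dirichlet condition on the rest of the boundary (the exterior arc $r=R_2$ and the crack). $j_{\ell,k}$ is the $k$-th positive zero of the Bessel function $J_\ell$. *)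

(* Defs.v *)
From mathcomp Require Import all_boot all_order all_algebra.
From mathcomp Require Import all_classical all_reals all_analysis.

Set Implicit Arguments.
Unset Strict Implicit.
Unset Printing Implicit Defensive.

Import Order.TTheory GRing.Theory Num.Theory.
Import numFieldNormedType.Exports.

Local Open Scope classical_set_scope.
Local Open Scope ring_scope.

Section Bessel.
Variable R : realType.

Definition besselJ_coeff (l : nat) (x : R) (k : nat) : R :=
  (-1) ^+ k / (k`! * (k + l)`!)%:R * (x / 2) ^+ (k.*2 + l).

(* The Bessel function of the first kind of integer order l, by its
   (everywhere convergent) power series. *)
Definition besselJ (l : nat) (x : R) : R := limn (series (besselJ_coeff l x)).

(* x is a positive zero of J_l and ]0, x] contains exactly k zeros of J_l. *)
Definition is_bessel_zero (l k : nat) (x : R) : Prop :=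
  [/\ 0 < x, besselJ l x = 0 &
      ([set y | (0 < y <= x)%R /\ besselJ l y = 0%R] #= `I_k)%card].

(* j_{l,k}, with k counted from 1; the default value 0 is never taken for
   k >= 1, J_l having infinitely many positive zeros, all isolated. *)
Definition bessel_zero (l k : nat) : R := xget 0 (is_bessel_zero l k).

End Bessel.

Section CrackedQuarterDisc.
Variable R : realType.

Definition polar (r t : R) : R * R := (r * cos t, r * sin t).

Definition cracked_quarter_disc (R1 R2 eps : R) : set (R * R) :=
  [set polar r t | r in [set r | 0 < r < R2] & t in [set t | 0 < t < pi / 2]]
  `\` [set polar R1 t | t in [set t | eps <= t < pi / 2]].

(* The Dirichlet part of the boundary, made closed by adding the end points of
   the two arcs, so that the condition can be imposed by approximation with
   functions vanishing near it. *)
Definition dirichlet_part (R1 R2 eps : R) : set (R * R) :=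
  [set polar R2 t | t in [set t | 0 <= t <= pi / 2]]
  `|` [set polar R1 t | t in [set t | eps <= t <= pi / 2]].

End CrackedQuarterDisc.

Section MixedLaplacian.
Variable R : realType.

(* The plane with the measurable structure on which Lebesgue measure lives; as
   a type it is convertible to R * R. *)
Local Notation plane := (measurableTypeR R * measurableTypeR R)%type.
Local Notation leb2 := (@lebesgue_measure R \x @lebesgue_measure R)%E.

Definition dx (f : R * R -> R) : R * R -> R := 'D_((1, 0) : R * R) f.
Definition dy (f : R * R -> R) : R * R -> R := 'D_((0, 1) : R * R) f.

Definition C1 (f : R * R -> R) : Prop :=
  [/\ forall p, differentiable f p, continuous (dx f) & continuous (dy f)].

Definition L2 (D : set (R * R)) (f : R * R -> R) : Prop :=
  measurable_fun (D : set plane) f /\ leb2.-integrable D (EFin \o (fun p => f p ^+ 2)).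

(* D is a bounded open set and G the closed part of its boundary that carries
   the Dirichlet condition; the rest of the boundary carries the Neumann
   condition.  Functions are defined on the whole plane but only their values
   on D matter. *)
Variables D G : set (R * R).

(* No condition is put on the Neumann part of the boundary. *)
Definition test_function (f : R * R -> R) : Prop :=
  C1 f /\ forall p, G p -> \forall q \near p, f q = 0.

(* u belongs to the form domain of the mixed Laplacian, with (weak) gradient
   (ux, uy): the form domain is the closure in H^1(D) of the restrictions to D
   of the test functions.  The gradient of the limit is the L^2 limit of the
   gradients; as it is also the distributional gradient, it is determined by u
   almost everywhere in D. *)
Definition form_domain (u ux uy : R * R -> R) : Prop :=
  [/\ L2 D u, L2 D ux, L2 D uy &
    forall e : R, 0 < e -> exists2 f, test_function f &
      (\int[leb2]_(p in D)
         ((u p - f p) ^+ 2 + (ux p - dx f p) ^+ 2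
          + (uy p - dy f p) ^+ 2)%:E < e%:E)%E].

(* lam is an eigenvalue of the self-adjoint operator on L^2(D) attached to the
   Dirichlet form on this form domain.  The Neumann condition is the natural
   boundary condition of the variational equation. *)
Definition laplacian_eigenvalue (lam : R) : Prop :=
  exists u ux uy : R * R -> R,
    [/\ form_domain u ux uy,
        ~ {ae leb2, forall p, D p -> u p = 0} &
        forall v vx vy, form_domain v vx vy ->
          \int[leb2]_(p in D) (ux p * vx p + uy p * vy p)
          = lam * \int[leb2]_(p in D) (u p * v p)].

Definition is_lowest_eigenvalue (lam : R) : Prop :=
  laplacian_eigenvalue lam /\
  forall mu, laplacian_eigenvalue mu -> lam <= mu.

(* The default value 0 would only be taken if there were no lowest
   eigenvalue. *)
Definition lowest_eigenvalue : R := xget 0 is_lowest_eigenvalue.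

End MixedLaplacian.

Definition lambda1_NND (R : realType) (R1 R2 eps : R) : R :=
  lowest_eigenvalue (cracked_quarter_disc R1 R2 eps)
                    (dirichlet_part R1 R2 eps).

(* Main.v *)
Require Import Defs.
From HB Require Import structures.
From mathcomp Require Import all_boot all_order all_algebra.
From mathcomp Require Import all_classical all_reals all_analysis.
From mathcomp Require Import measurable_realfun.
From mathcomp Require Import ring lra.
Import Order.TTheory GRing.Theory Num.Theory.
Import numFieldNormedType.Exports.
Local Open Scope classical_set_scope.
Local Open Scope ring_scope.

(** Let [u0 = J_0 (j01 * r / R2)] be the ground state of the quarter disc without
    crack, [l0 = j01 ^ 2 / R2 ^ 2] its eigenvalue and [p] the point [(0, R1)] at
    which the crack of angular length [d = pi / 2 - eps] shrinks.  On each ray, an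
    integration by parts against [u0] gives, for every test function [f],
      [\int |grad f| ^ 2 = l0 * \int f ^ 2 + \int defect f],
    where [defect f = |u0 * grad (f / u0)| ^ 2] ([energy_identity]).  Hence
    [lambda - l0] is the infimum of [\int defect f / \int f ^ 2], and the theorem
    says that this infimum is [shift_coef / |ln d|] up to smaller terms, with
    [shift_coef = pi * u0 p ^ 2 / \int u0 ^ 2].

    That the lowest eigenvalue exists and is the infimum of the Rayleigh quotient is
    obtained without a compact embedding.  A weighted Poincare inequality ([gap])
    bounds the distance from [f] to the line spanned by [u0] by the defect,
    uniformly in the crack; so the Dirichlet form has, below [l0] plus a constant,
    room for one dimension only, and normalised minimising sequences converge
    ([ground_state], [lowest_eigenvalue_rayleigh]).

    Lower bound.  In polar coordinates around [p], [f / u0] vanishes at one point of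
    each half circle that meets the crack.  It is therefore small on some half
    circle of radius comparable to [d], whereas it is close to a constant [T] on some
    half circle of fixed radius.  By the Cauchy-Schwarz inequality on the segments
    between the two, this costs at least about [pi * u0 p ^ 2 * T ^ 2 / |ln d|]
    ([capacity_bound]), while [\int f ^ 2] is about [T ^ 2 * \int u0 ^ 2]
    ([defect_lower_bound]).

    Upper bound.  The optimal profile is reached by multiplying [u0] by a smoothed
    logarithm of the distance to [p], zero near the crack.  A second factor vanishes
    near the outer arc; as [u0] is itself zero there, its cost is negligible
    ([chi_energy], [psi_energy], [trial_norm], [defect_upper_bound]).

    The constant is made explicit by an antiderivative of [r * u0 ^ 2], which gives
    [\int u0 ^ 2 = pi / 4 * R2 ^ 2 * J_0' (j01) ^ 2] ([integral_gs2]). *)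

(** * Polar coordinates in the plane *)
Section PlaneMeasure.
Local Set Implicit Arguments.
Local Unset Strict Implicit.
Context {R : realType}.
Local Notation mR := (measurableTypeR R).
Local Notation plane := (mR * mR)%type.
Local Notation leb := (@lebesgue_measure R).
Local Notation leb2 := (leb \x leb)%E.

(** An open set is the countable union of the boxes with rational corners that it
    contains. *)
Lemma measurable_open2 (U : set (R * R)) : open U -> measurable (U : set plane).
Proof.
move=> oU.
pose box (q : rat * rat * (rat * rat)) : set plane :=
  `]ratr q.1.1, ratr q.1.2[%classic `*` `]ratr q.2.1, ratr q.2.2[%classic.
pose F n : set plane := if unpickle n is Some q then
  (if pselect (box q `<=` U) then box q else set0) else set0.
suff -> : (U : set plane) = \bigcup_n F n.
  apply: bigcupT_measurable => n; rewrite /F.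
  case: (unpickle n) => [q|//]; case: pselect => /= [?|?] //.
  by apply: measurableX; exact: measurable_itv.
apply/seteqP; split => [[x y] Uxy|p [n _]]; last first.
  by rewrite /F; case: (unpickle n) => [q|//]; case: pselect => /= [bU|?] //; exact: bU.
have /nbhs_ballP[e /= e0 eU] : nbhs (x, y) U by exact: open_nbhs_nbhs.
have lt1 z : z - e < z by rewrite ltrBlDr ltrDl.
have lt2 z : z < z + e by rewrite ltrDl.
have [a1] := rat_in_itvoo (lt1 x); have [a2] := rat_in_itvoo (lt2 x).
have [b1] := rat_in_itvoo (lt1 y); have [b2] := rat_in_itvoo (lt2 y).
rewrite !in_itv/= => /andP[b2y b2e] /andP[b1e b1y] /andP[a2x a2e] /andP[a1e a1x].
have := pickleK ((a1, a2), (b1, b2)); move: (pickle _) => n nE.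
exists n => //; rewrite /F nE.
case: pselect => /= [?|[]]; first by split => /=; rewrite in_itv/= ?a1x ?b1y.
move=> [s t] [/=]; rewrite !in_itv/= => /andP[? ?] /andP[? ?]; apply: eU.
by split => /=; rewrite /ball/= ltr_norml; apply/andP; split; lra.
Qed.

Lemma measurable_continuous2 (f : R * R -> R) : continuous f ->
  measurable_fun (setT : set plane) f.
Proof.
move=> /continuousP cf; apply: (measurability _ (RGenOpens.measurableE R)).
move=> _ [_ [a [b ->] <-]]; rewrite setTI; apply: measurable_open2.
exact/cf/interval_open.
Qed.

(** The measure with density [h] on [I], pushed forward by [phi], is the
    Lebesgue measure as soon as it is on half-open intervals; it is the image
    of the planar Lebesgue measure of the region under the graph of [h]. *)
Lemma ge0_integral_change_of_variables (I : set R) (phi h : R -> R)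
    (G : R -> \bar R) : measurable I ->
  measurable_fun setT phi -> measurable_fun setT h -> (forall t, 0 <= h t) ->
  (forall a b : R, a <= b ->
    (\int[leb]_(t in I) (h t * \1_(`]a, b]%classic) (phi t))%R%:E = (b - a)%R%:E)%E) ->
  measurable_fun setT G -> (forall x, 0 <= G x)%E ->
  (\int[leb]_x G x = \int[leb]_(t in I) (G (phi t) * (h t)%:E))%E.
Proof.
move=> mI mphi mh h0 hphi mG G0.
pose S : set plane := [set p | I p.1 /\ 0 <= p.2 < h p.1].
have mS : measurable S.
  have -> : S = (I `*` `[0, +oo[%classic) `&`
     ((fun p : plane => (h p.1 - p.2 : mR)) @^-1` `]0, +oo[%classic).
    apply/seteqP; split => [[x y]|[x y]]; rewrite /S/= !in_itv/= !andbT.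
      by move=> [? /andP[-> ?]]; rewrite subr_gt0.
    by move=> [[? ->]]; rewrite subr_gt0.
  apply: measurableI; first by apply: measurableX => //; exact: measurable_itv.
  rewrite -[X in measurable X]setTI.
  have mf : measurable_fun (setT : set plane) (fun p : plane => (h p.1 - p.2 : mR)).
    apply: measurable_funB; last exact: measurable_snd.
    by apply: measurableT_comp => //; exact: measurable_fst.
  by apply: mf => //; exact: measurable_itv.
have mp : measurable_fun (setT : set plane) (fun p : plane => (phi p.1 : mR)).
  by apply: measurableT_comp => //; exact: measurable_fst.
pose nu := pushforward (mrestr leb2 mS) (fun p : plane => phi p.1 : mR).
have intS (H : R -> \bar R) : measurable_fun setT H -> (forall x, 0 <= H x)%E ->
   (\int[mrestr leb2 mS]_p H (phi p.1) = \int[leb]_(t in I) (H (phi t) * (h t)%:E))%E.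
  move=> mH H0.
  have mHp : measurable_fun (setT : set plane) (fun p : plane => H (phi p.1)).
    exact: (measurableT_comp mH mp).
  rewrite -(setUv S) ge0_integral_setU//; [|exact: measurableC|
    by rewrite setUv|exact/disj_setPCl].
  rewrite [X in (_ + X)%E](_ : _ = 0%E) ?adde0; last first.
    apply: null_set_integral; first exact: measurableC.
      by apply: measurable_funTS; exact: mHp.
    have : mrestr leb2 mS (~` S) = 0%E by rewrite /mrestr setIC setICr measure0.
    by [].
  have -> : (\int[mrestr leb2 mS]_(p in S) H (phi p.1) =
             \int[leb2]_(p in S) H (phi p.1))%E.
    apply: eq_measure_integral => A mA AS.
    by have : mrestr leb2 mS A = leb2 A by rewrite /mrestr setIidl.
  rewrite integral_mkcond fubini_tonelli1.
  - rewrite [RHS]integral_mkcond; apply: eq_integral => t _; rewrite /fubini_F patchE.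
    case: ifPn => tI; last first.
      rewrite (eq_integral (cst 0%E)) ?integral0// => y _.
      rewrite patchE; case: ifPn => //; rewrite inE => -[/= It _].
      by move: tI; rewrite notin_setE.
    pose J : set mR := [set` `[0%R, h t[%R].
    transitivity (\int[leb]_(y in J) (cst (H (phi t)) y))%E; last first.
      rewrite integral_cst /J; last exact: measurable_itv.
      congr (_ * _)%E; apply: (etrans (lebesgue_measure_itv `[0%R, h t[)) => /=; rewrite lte_fin.
      case: ltP => [_|h0t]; first by rewrite sube0.
      by rewrite (le_anti (_ : h t <= 0 <= h t)) ?h0t ?h0.
    rewrite [RHS]integral_mkcond.
    apply: eq_integral => y _; rewrite !patchE /S /J; congr (if _ then _ else _).
    apply/idP/idP; rewrite !inE/= in_itv/=; first by case.
    by move=> ->; split => //; exact/set_mem.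
  - by apply/(measurable_restrict _ mS) => //; apply: measurable_funTS; exact: mHp.
  - by move=> p; rewrite patchE; case: ifP.
pose f : {mfun plane >-> mR} := HB.pack (fun p : plane => phi p.1 : mR)
  (isMeasurableFun.Build _ _ _ _ _ mp).
(* A measure that agrees with the Lebesgue measure on half-open intervals is equal to it. *)
have nuE A : measurable A -> leb A = pushforward (mrestr leb2 mS) f A.
  apply: (@lebesgue_measure_unique R (pushforward (mrestr leb2 mS) f)) => X.
  move=> [[a b]] /= ab <-.
  rewrite -[X in leb X]/(`]a, b]%classic : set mR) (lebesgue_measure_itv `]a, b])/= lte_fin.
  have -> : pushforward (mrestr leb2 mS) f `]a, b]%classic =
     (\int[mrestr leb2 mS]_p (\1_(`]a, b]%classic : set R) (phi p.1))%:E)%E.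
    rewrite -[RHS]/(\int[mrestr leb2 mS]_p (\1_(f @^-1` (`]a, b]%classic : set mR)) p)%:E)%E.
    by rewrite integral_indic// ?setIT//; apply: measurable_funPTI.
  rewrite (intS (EFin \o \1_(`]a, b]%classic : set R)))//=; last first.
    by apply/measurable_EFinP; apply: measurable_indic; exact: measurable_itv.
  under eq_integral do rewrite -EFinM mulrC.
  case: ltP => [lab|ba]; first by rewrite hphi// ltW.
  rewrite set_itv_ge ?bnd_simp -?leNgt//.
  by under eq_integral do rewrite indicE in_set0 mulr0; rewrite integral0.
rewrite -(intS _ mG G0).
have := @ge0_integral_pushforward _ _ _ _ R f mp (mrestr leb2 mS) setT G measurableT mG.
rewrite /= preimage_setT => <- //.
by apply: eq_measure_integral => A mA _; exact: nuE.
Qed.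

Lemma integral_scale (c : R) (G : R -> \bar R) : 0 < c ->
  measurable_fun setT G -> (forall x, 0 <= G x)%E ->
  (\int[leb]_x G x = \int[leb]_t (G (t * c)%R * c%:E))%E.
Proof.
move=> c0 mG G0; apply: ge0_integral_change_of_variables => //.
- exact: mulrr_measurable.
- by move=> _; exact: ltW.
- move=> a b ab.
  transitivity (\int[leb]_t (c%:E * (\1_(`](a / c), (b / c)]%classic : set R) t)%:E))%E.
    apply: eq_integral => t _; rewrite EFinM; congr (_ * _%:E)%E.
    rewrite !indicE; congr ((nat_of_bool _)%:R); apply/idP/idP; rewrite !inE/= !in_itv/=.
      by rewrite ltr_pdivrMr// ler_pdivlMr.
    by rewrite ltr_pdivrMr// ler_pdivlMr.
  rewrite ge0_integralZl//; [|by apply/measurable_EFinP; apply: measurable_indic; exact: measurable_itv|by rewrite lee_fin ltW].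
  rewrite integral_indic ?setIT//.
  transitivity (c%:E * (b / c - a / c)%:E)%E; last first.
    by rewrite -EFinM; congr EFin; field; rewrite gt_eqF.
  congr (_ * _)%E; apply: (etrans (lebesgue_measure_itv `](a / c), (b / c)])) => /=.
  rewrite lte_fin.
  case: ltP => // ba; suff -> : b / c = a / c by rewrite subrr.
  by apply: le_anti; rewrite ba/= ler_pM2r ?invr_gt0.
Qed.

Lemma measurable_invr : measurable_fun setT (@GRing.inv R).
Proof.
rewrite -(setUv [set 0 : R]); apply/measurable_funU => //; first exact: measurableC.
split; first exact: measurable_fun_set1.
apply: open_continuous_measurable_fun => [|x]; first by apply: closed_openC; apply: accessible_closed_set1; exact/hausdorff_accessible/Rhausdorff.
by rewrite inE/= => /eqP x0; apply: inv_continuous.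
Qed.

Lemma integral_derivative (F f : R -> R) (a b : R) : a <= b ->
  (forall x, a <= x <= b -> is_derive x 1 F (f x)) ->
  (forall x, a <= x <= b -> {for x, continuous f}) ->
  (\int[leb]_(x in `[a, b]) (f x)%:E = (F b - F a)%:E)%E.
Proof.
rewrite le_eqVlt => /predU1P[<-|ab] dF cf.
  by rewrite set_itv1 integral_set1 subrr.
have cF x : a <= x <= b -> {for x, continuous F}.
  by move=> /dF dFx; apply: differentiable_continuous; apply/derivable1_diffP.
apply: continuous_FTC2 => //.
- by apply: continuous_in_subspaceT => x /[!inE]; exact: cf.
- split.
  + by move=> x; rewrite in_itv/= => /andP[ax xb]; have [] := dF x; rewrite ?ltW.
  + by apply: cvg_at_right_filter; apply: cF; rewrite lexx ltW.
  + by apply: cvg_at_left_filter; apply: cF; rewrite lexx ltW.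
- move=> x; rewrite in_itv/= => /andP[ax xb]; rewrite derive1E.
  have dFx : is_derive x 1 F (f x) by apply: dF; rewrite !ltW.
  exact: derive_val.
Qed.

Lemma cos_neq0 (t : R) : - (pi / 2) < t < pi / 2 -> cos t != 0.
Proof. by move=> /cos_gt0_pihalf/gt_eqF->. Qed.

Lemma measurable_sin : measurable_fun setT (@sin R).
Proof. by apply: continuous_measurable_fun => x; exact: continuous_sin. Qed.

Lemma measurable_cos : measurable_fun setT (@cos R).
Proof. by apply: continuous_measurable_fun => x; exact: continuous_cos. Qed.

Lemma measurable_tan : measurable_fun setT (@tan R).
Proof.
apply: measurable_funM; first exact: measurable_sin.
apply: (measurableT_comp measurable_invr).
exact: measurable_cos.
Qed.

Lemma integral_tan (G : R -> \bar R) :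
  measurable_fun setT G -> (forall x, 0 <= G x)%E ->
  (\int[leb]_x G x =
   \int[leb]_(t in `](- (pi / 2))%R, (pi / 2)%R[) (G (tan t) * ((cos t) ^- 2)%:E))%E.
Proof.
move=> mG G0; apply: ge0_integral_change_of_variables => //.
- exact: measurable_tan.
- apply: (measurableT_comp measurable_invr); apply: measurable_funX.
  exact: measurable_cos.
- by move=> t; rewrite invr_ge0 sqr_ge0.
- move=> a b ab.
  have atanI (x : R) : atan x \in `](- (pi / 2)), (pi / 2)[ by rewrite in_itv/= atan_gtNpi2 atan_ltpi2.
  have tan_ab (x : R) : - (pi / 2) < x < pi / 2 ->
      (a < tan x <= b) = (atan a < x <= atan b).
    move=> xI; have xI' : x \in `](- (pi / 2)), (pi / 2)[ by rewrite in_itv.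
    rewrite -[in LHS](atanK a) -[in LHS](atanK b) !leNgt.
    by rewrite (ltr_tan (atanI a) xI') (ltr_tan (atanI b) xI').
  transitivity (\int[leb]_(t in `](atan a), (atan b)]) ((cos t) ^- 2)%:E)%E.
    rewrite [LHS]integral_mkcond [RHS]integral_mkcond; apply: eq_integral => t _.
    rewrite !patchE; case: ifPn => tI; case: ifPn => tJ => //.
    + move: tJ tI; rewrite !inE/= !in_itv/= => /andP[tJ1 tJ2] tI.
      by rewrite indicE mem_set ?mulr1//= in_itv/= tan_ab// tJ1 tJ2.
    + move: tJ tI; rewrite notin_setE/= !in_itv/= inE/= in_itv/= => tJ tI.
      by rewrite indicE memNset ?mulr0//= in_itv/= tan_ab//.
    + move: tI tJ; rewrite notin_setE inE/= !in_itv/= => tI /andP[at1 tb].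
      exfalso; apply: tI; rewrite (lt_trans _ at1) ?atan_gtNpi2//.
      by rewrite (le_lt_trans tb) ?atan_ltpi2.
  rewrite integral_itv_obnd_cbnd; last first.
    apply: measurable_funTS; apply/measurable_EFinP.
    apply: (measurableT_comp measurable_invr); apply: measurable_funX.
    exact: measurable_cos.
  have cn0 x : atan a <= x <= atan b -> cos x != 0.
    move=> /andP[ax xb]; apply: cos_neq0; rewrite (lt_le_trans _ ax) ?atan_gtNpi2//.
    by rewrite (le_lt_trans xb) ?atan_ltpi2.
  have := @integral_derivative (@tan R) (fun t => (cos t) ^- 2) (atan a) (atan b).
  rewrite !atanK; apply; first exact: le_atan.
    by move=> x /cn0; exact: is_derive_tan.
  move=> x /cn0 c0; apply: continuousV; first by rewrite expf_neq0.
  by apply: continuousM; exact: continuous_cos.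
Qed.

(** Successively [y = x * v], [x = r / sqrt (1 + v ^ 2)] and [v = tan t]. *)
Lemma integral_polar (F : R * R -> \bar R) :
  measurable_fun (setT : set plane) F -> (forall p, 0 <= F p)%E ->
  (\int[leb2]_(p in [set p | (0 < p.1)%R]) F p =
   \int[leb]_(t in `](- (pi / 2))%R, (pi / 2)%R[)
     \int[leb]_(r in `]0%R, +oo[) (F (r * cos t, r * sin t)%R * r%:E))%E.
Proof.
move=> mF F0.
pose pos : set mR := `]0%R, +oo[%classic.
have mpos : measurable pos by exact: measurable_itv.
have mcomp (d : measure_display) (T : measurableType d) (f g : T -> R) :
    measurable_fun setT f -> measurable_fun setT g ->
    measurable_fun setT (fun z => F (f z, g z)).
  move=> mf mg; apply: (measurableT_comp mF).
  exact: (@measurable_fun_pair _ _ _ T mR mR f g).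
pose F1 (x v : R) := ((F (x, v * x)%R * x%:E) * (\1_pos x)%:E)%E.
have mfst2 : measurable_fun (setT : set plane) (fun z : plane => z.1 : R) by exact: measurable_fst.
have msnd2 : measurable_fun (setT : set plane) (fun z : plane => z.2 : R) by exact: measurable_snd.
have mF1 : measurable_fun (setT : set plane) (fun z : plane => F1 z.1 z.2).
  apply: emeasurable_funM; last first.
    apply/measurable_EFinP; apply: (measurableT_comp _ mfst2); exact: measurable_indic.
  apply: emeasurable_funM; last exact/measurable_EFinP.
  apply: mcomp => //; exact: measurable_funM.
have F10 x v : (0 <= F1 x v)%E.
  rewrite /F1 indicE; case: (boolP (x \in pos)); last by rewrite mule0.
  by rewrite inE /pos/= in_itv/= andbT mule1 => x0; rewrite mule_ge0// lee_fin ltW.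
have -> : (\int[leb2]_(p in [set p | (0 < p.1)%R]) F p =
           \int[leb]_x \int[leb]_v F1 x v)%E.
  have mH : measurable ([set p | 0 < p.1] : set plane).
    rewrite (_ : [set p | _] = pos `*` setT); first exact: measurableX.
    by apply/seteqP; split => [p|p]; rewrite /pos/= in_itv/= ?andbT//; case.
  rewrite integral_mkcond fubini_tonelli1; last 2 first.
  - by apply/(measurable_restrict _ mH) => //; exact: measurable_funTS.
  - by move=> p; rewrite patchE; case: ifP.
  apply: eq_integral => x _; rewrite /fubini_F.
  have [x0|x0] := ltP 0 x; last first.
    rewrite !integral0_eq// => y _; rewrite /F1 ?indicE ?patchE memNset ?mule0//.
      by rewrite /pos/= in_itv/= andbT ltNge x0.
    by rewrite /= ltNge x0.
  transitivity (\int[leb]_y F (x, y))%E.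
    by apply: eq_integral => y _; rewrite patchE mem_set.
  rewrite (@integral_scale x (fun y => F (x, y)))//; last exact: mcomp.
  apply: eq_integral => y _; rewrite /F1 indicE mem_set ?mule1//.
  by rewrite /pos/= in_itv/= x0.
have -> : (\int[leb]_x \int[leb]_v F1 x v = \int[leb]_v \int[leb]_x F1 x v)%E.
  exact: (@fubini_tonelli _ _ _ _ _ leb leb (fun z => F1 z.1 z.2)).
rewrite integral_tan; last 2 first.
- exact: (@measurable_fun_fubini_tonelli_G _ _ _ _ _ leb (fun z => F1 z.1 z.2)).
- by move=> v; apply: integral_ge0.
apply: eq_integral => t; rewrite inE/= in_itv/= => tI.
have c0 := cos_gt0_pihalf tI.
rewrite (@integral_scale (cos t) (F1^~ (tan t)))//; last first.
  exact: (measurable_fun_pair1 (f := fun z : plane => F1 z.1 z.2) (tan t)).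
rewrite -ge0_integralZr//; last 3 first.
- apply: emeasurable_funM => //; apply: (measurableT_comp (f := F1^~ (tan t))).
    exact: (measurable_fun_pair1 (f := fun z : plane => F1 z.1 z.2) (tan t)).
  exact: mulrr_measurable.
- by move=> x _; rewrite mule_ge0// lee_fin ltW.
- by rewrite lee_fin invr_ge0 sqr_ge0.
rewrite [RHS]integral_mkcond; apply: eq_integral => r _; rewrite patchE /F1 indicE.
have -> : (r * cos t \in pos) = (r \in `]0, +oo[%classic).
  by apply/idP/idP; rewrite !inE /pos/= !in_itv/= !andbT pmulr_lgt0.
case: ifPn => r0; last by rewrite mule0 !mul0e.
rewrite mule1 -!muleA -!EFinM; congr (F _ * _%:E)%E.
  by rewrite /tan; congr (_, _); field; rewrite gt_eqF.
by field; rewrite gt_eqF.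
Qed.
End PlaneMeasure.

(** * The Bessel function of order zero *)
Section BesselSeries.
Local Set Implicit Arguments.
Local Unset Strict Implicit.
Context {R : realType}.

(** [J_0 x = bes (x ^ 2 / 4)] ([besselJ0E]).  In the variable [z = x ^ 2 / 4] the
    function is smooth on the whole line, so that [bes (a * |p| ^ 2)] is smooth at
    the origin of the plane, and its derivatives are again power series. *)
Definition bcoef (k : nat) : R := (-1) ^+ k / (k`!%:R) ^+ 2.
Definition bes (z : R) : R := limn (pseries bcoef z).
Definition bes' (z : R) : R := limn (pseries (pseries_diffs bcoef) z).
Definition bes'' (z : R) : R :=
  limn (pseries (pseries_diffs (pseries_diffs bcoef)) z).

Lemma cvg_pseries_invfact (c : nat -> R) (z : R) :
  (forall k, `|c k| <= (k`!%:R)^-1) -> cvgn (pseries c z).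
Proof.
move=> cb; apply: normed_cvg.
apply: (series_le_cvg _ _ _ (is_cvg_series_exp_coeff `|z|)) => k.
- exact: normr_ge0.
- by rewrite exp_coeffE mulr_ge0 ?exprn_ge0// invr_ge0.
- by rewrite exp_coeffE/= normrM normrX ler_wpM2r ?exprn_ge0.
Qed.

Lemma invfact_le1 k : (k`!%:R : R)^-1 <= 1.
Proof. by rewrite invf_le1 ?ltr0n ?fact_gt0// ler1n fact_gt0. Qed.

Let fact_neq0 k : (k`!%:R : R) != 0.
Proof. by rewrite pnatr_eq0 -lt0n fact_gt0. Qed.

Let addn_neq0 a k : 0 < a -> a + (k%:R : R) != 0.
Proof. by move=> a0; rewrite gt_eqF// ltr_pwDl. Qed.

Lemma bcoefS k : bcoef k.+1 = - bcoef k / (k.+1%:R) ^+ 2.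
Proof.
rewrite /bcoef factS natrM exprS; field.
by rewrite ?fact_neq0 ?addn_neq0.
Qed.

Lemma bcoef_diff1 k :
  pseries_diffs bcoef k = - (-1) ^+ k / (k`!%:R * k.+1`!%:R).
Proof.
rewrite /pseries_diffs bcoefS /bcoef factS natrM; field.
by rewrite ?fact_neq0 ?addn_neq0.
Qed.

Lemma bcoef_diff2 k : pseries_diffs (pseries_diffs bcoef) k =
  (-1) ^+ k / (k`!%:R * k.+2`!%:R).
Proof.
rewrite {1}/pseries_diffs bcoef_diff1 exprS !factS !natrM; field.
by rewrite ?fact_neq0 ?addn_neq0.
Qed.

Lemma bcoef_diff3 k : pseries_diffs (pseries_diffs (pseries_diffs bcoef)) k =
  - (-1) ^+ k / (k`!%:R * k.+3`!%:R).
Proof.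
rewrite {1}/pseries_diffs bcoef_diff2 exprS !factS !natrM; field.
by rewrite ?fact_neq0 ?addn_neq0.
Qed.

Let le_invfact (a b : nat) (s : R) : `|s| = 1 ->
  `|s / (a`!%:R * b`!%:R)| <= (a`!%:R)^-1.
Proof.
move=> s1; rewrite normrM s1 mul1r normfV ger0_norm ?mulr_ge0// invfM.
by rewrite ler_piMr ?invr_ge0// invfact_le1.
Qed.

Lemma cvg_bes z : cvgn (pseries bcoef z).
Proof.
apply: cvg_pseries_invfact => k; rewrite /bcoef expr2.
by apply: le_invfact => //; rewrite normrX normrN1 expr1n.
Qed.

Lemma cvg_bes' z : cvgn (pseries (pseries_diffs bcoef) z).
Proof.
apply: cvg_pseries_invfact => k; rewrite bcoef_diff1.
by apply: le_invfact => //; rewrite normrN normrX normrN1 expr1n.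
Qed.

Lemma cvg_bes'' z : cvgn (pseries (pseries_diffs (pseries_diffs bcoef)) z).
Proof.
apply: cvg_pseries_invfact => k; rewrite bcoef_diff2.
by apply: le_invfact => //; rewrite normrX normrN1 expr1n.
Qed.

Let lt_norm1 (z : R) : `|z| < `| `|z| + 1 |.
Proof. by rewrite (@ger0_norm _ (`|z| + 1)) ?ltrDl// addr_ge0. Qed.

Global Instance is_derive_bes (z : R) : is_derive z (1 : R) bes (bes' z).
Proof.
apply: (@pseries_snd_diffs _ _ (`|z| + 1)); last exact: lt_norm1.
- exact: cvg_bes.
- exact: cvg_bes'.
- exact: cvg_bes''.
Qed.

Global Instance is_derive_bes' (z : R) : is_derive z (1 : R) bes' (bes'' z).
Proof.
apply: (@pseries_snd_diffs _ _ (`|z| + 1)); last exact: lt_norm1.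
- exact: cvg_bes'.
- exact: cvg_bes''.
- apply: cvg_pseries_invfact => k; rewrite bcoef_diff3.
  by apply: le_invfact => //; rewrite normrN normrX normrN1 expr1n.
Qed.

Lemma continuous_bes : continuous bes.
Proof.
move=> z; apply: differentiable_continuous; apply/derivable1_diffP.
exact: ex_derive.
Qed.

Lemma continuous_bes' : continuous bes'.
Proof.
move=> z; apply: differentiable_continuous; apply/derivable1_diffP.
exact: ex_derive.
Qed.

(** Bessel's equation of order [0], in the variable [z = x ^ 2 / 4]. *)
Lemma bes_ode z : z * bes'' z + bes' z = - bes z.
Proof.
have H n : z * pseries (pseries_diffs (pseries_diffs bcoef)) z n +
    pseries (pseries_diffs bcoef) z n.+1 = - pseries bcoef z n.+1.
  elim: n => [|n IH].
    rewrite /pseries /series/= big_geq// !big_nat1 mulr0 add0r !expr0 !mulr1.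
    by rewrite /pseries_diffs bcoefS expr1n divr1 mul1r.
  have E (u : nat -> R) m : pseries u z m.+1 = pseries u z m + u m * z ^+ m.
    by rewrite /pseries seriesSr.
  rewrite E (E _ n.+1) (E bcoef n.+1) opprD -IH mulrDr.
  have -> : pseries_diffs (pseries_diffs bcoef) n = n.+1%:R * pseries_diffs bcoef n.+1 by [].
  have -> : bcoef n.+1 = - (n.+2%:R * pseries_diffs bcoef n.+1).
    by rewrite /pseries_diffs (bcoefS n.+1); field; rewrite addn_neq0.
  by rewrite exprS; ring.
have c2 := @cvg_bes'' z; have c1 := @cvg_bes' z; have c0 := @cvg_bes z.
have l1 : (fun n => z * pseries (pseries_diffs (pseries_diffs bcoef)) z n +
    pseries (pseries_diffs bcoef) z n.+1) @ \oo --> z * bes'' z + bes' z.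
  by apply: cvgD; [exact: cvgMr|rewrite cvg_shiftS].
have l2 : (fun n => - pseries bcoef z n.+1) @ \oo --> - bes z.
  by apply: cvgN; rewrite (cvg_shiftS (pseries bcoef z)).
by apply: (cvg_unique _ l1); rewrite // (_ : (fun n => _) = fun n => - pseries bcoef z n.+1) //; apply/funext.
Qed.

Lemma bes0 : bes 0 = 1.
Proof.
apply/cvg_lim => //; apply: cvg_near_cst; near=> n.
rewrite /pseries /series/=; have -> : n = n.-1.+1 by rewrite prednK//; near: n; exists 1%N.
rewrite big_nat_recl//= big1 ?addr0 => [|i _]; last by rewrite expr0n mulr0.
by rewrite expr0 mulr1 /bcoef fact0 expr0 expr1n divr1.
Unshelve. all: by end_near. Qed.

(** The partial sum of five terms is negative, and so is each pair of consecutive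
    terms of the alternating remainder; this is why [bes] has a zero. *)
Lemma bes2_lt0 : bes 2 < 0.
Proof.
rewrite -oppr_gt0 /bes -limN; last exact: cvg_bes.
have -> : - pseries bcoef 2 = series (fun k => - (bcoef k * 2 ^+ k)).
  by rewrite /pseries -seriesN.
apply: (@le_lt_trans _ _ (\sum_(0 <= k < 5) - (bcoef k * 2 ^+ k))).
  rewrite !big_nat_recr//= big_nil /bcoef !factS fact0 !exprS !expr0.
  lra.
apply: lt_sum_lim_series.
  rewrite (_ : series _ = - pseries bcoef 2); first by apply: is_cvgN; exact: cvg_bes.
  by rewrite /pseries -seriesN.
move=> d; rewrite !addnS -/(5 + d.*2)%N; set k := (5 + d.*2)%N.
have -> : - (bcoef k * 2 ^+ k) + - (bcoef k.+1 * 2 ^+ k.+1) =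
    2 ^+ k * - bcoef k * (1 - 2 / (k.+1%:R) ^+ 2).
  by rewrite (bcoefS k) (exprS _ k); field; rewrite addn_neq0.
have kodd : odd k by rewrite /k oddD odd_double.
apply: mulr_gt0; first apply: mulr_gt0; first exact: exprn_gt0.
  by rewrite /bcoef -signr_odd kodd expr1 mulN1r opprK ?invr_gt0 ?exprn_gt0 ?ltr0n ?fact_gt0.
rewrite subr_gt0 ltr_pdivrMr ?exprn_gt0// mul1r.
apply: (@lt_le_trans _ _ (2 ^+ 2)); first by rewrite expr2; lra.
by rewrite lerXn2r ?nnegrE// ler_nat.
Qed.

(** The smallest zero of [bes]: a continuous function that is positive at [0] vanishes
    at the infimum of the points where it is not positive. *)
Definition bes_zero : R := inf [set z | 0 <= z /\ bes z <= 0].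

Lemma bes_gt0 z : 0 <= z < bes_zero -> 0 < bes z.
Proof.
move=> /andP[z0 zz]; rewrite ltNge; apply/negP => bz.
move: zz; rewrite ltNge => /negP; apply; apply: ge_inf => //.
by exists 0 => y [].
Qed.

Lemma bes_zeroP : bes bes_zero = 0.
Proof.
set Z := [set z | 0 <= z /\ bes z <= 0].
have hZ : has_inf Z.
  by split; [exists 2; split => //; exact/ltW/bes2_lt0 | exists 0 => y []].
have z0 : 0 <= bes_zero by apply: lb_le_inf => [|y []//]; case: hZ.
apply/eqP; rewrite eq_le !leNgt; apply/andP; split; apply/negP => bz.
- have /nbhs_ballP[e /= e0 be] : \forall y \near bes_zero, 0 < bes y.
    by apply: (cvgr_gt _ (@continuous_bes bes_zero)).
  have [y [y0 by0] ye] := inf_adherent e0 hZ.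
  have : 0 < bes y.
    apply: be; rewrite /ball/= distrC ger0_norm ?subr_ge0; last by apply: ge_inf => //; case: hZ.
    by rewrite ltrBlDl.
  by rewrite ltNge by0.
- have /nbhs_ballP[e /= e0 be] : \forall y \near bes_zero, bes y < 0.
    by apply: (cvgr_lt _ (@continuous_bes bes_zero)).
  have zp : 0 < bes_zero.
    rewrite lt_neqAle z0 andbT; apply/eqP => zE.
    by move: bz; rewrite -zE bes0 ltr10.
  pose y := Num.max 0 (bes_zero - e / 2).
  have y1 : 0 <= y < bes_zero.
    by rewrite /y le_max lexx/= gt_max zp ltrBlDr ltrDl divr_gt0.
  have := bes_gt0 y1; rewrite ltNge => /negP; apply; apply/ltW/be.
  rewrite /ball/= ger0_norm ?subr_ge0; last by case/andP: y1 => _ /ltW.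
  rewrite ltrBlDr -ltrBlDl lt_max; apply/orP; right.
  by rewrite ltrD2l ltrN2 gtr_pMr// invf_lt1// ltr1n.
Qed.

Lemma bes_zero_gt0 : 0 < bes_zero.
Proof.
have : 0 <= bes_zero.
  apply: lb_le_inf => [|y []//].
  by exists 2; split => //; exact/ltW/bes2_lt0.
rewrite le_eqVlt => /predU1P[z0|//].
by have := bes_zeroP; rewrite -z0 bes0 => /eqP; rewrite oner_eq0.
Qed.

Let is_derive_zbes' (z : R) : is_derive z (1 : R) (fun z => z * bes' z) (- bes z).
Proof.
have -> : - bes z = z *: bes'' z + bes' z *: 1.
  by rewrite -bes_ode /GRing.scale/= mulr1.
exact: is_deriveM.
Qed.

Let MVT_bes' (z : R) : 0 < z -> exists2 c, c \in `]0, z[%R & bes' z = - bes c.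
Proof.
move=> z0; have [] := @MVT R (fun z => z * bes' z) (fun z => - bes z) 0 z z0.
  by move=> x _; exact: is_derive_zbes'.
  apply: continuous_subspaceT => x; apply: cvgM => //; exact: continuous_bes'.
move=> c cz; rewrite mul0r !subr0 => E; exists c => //.
by apply: (mulfI (lt0r_neq0 z0)); rewrite E mulrC.
Qed.

(** By Bessel's equation [(z * bes' z)' = - bes z], which is negative before the first
    zero. *)
Lemma bes'_lt0 z : 0 < z <= bes_zero -> bes' z < 0.
Proof.
move=> /andP[z0 zz]; have [c] := MVT_bes' z0; rewrite in_itv/= => /andP[c0 cz] ->.
by rewrite oppr_lt0 bes_gt0// ltW//= (lt_le_trans cz).
Qed.

Lemma bes_decr x y : 0 <= x -> x < y -> y <= bes_zero -> bes y < bes x.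
Proof.
move=> x0 xy yz; have [] := @MVT R bes bes' x y xy.
  by apply: continuous_subspaceT => t; exact: continuous_bes.
move=> c; rewrite in_itv/= => /andP[xc cy] E.
rewrite -subr_lt0 E nmulr_rlt0 ?subr_gt0// bes'_lt0//.
by rewrite (le_lt_trans x0)//= (le_trans (ltW cy)).
Qed.

Lemma bes_le1 z : 0 <= z <= bes_zero -> bes z <= 1.
Proof.
move=> /andP[]; rewrite le_eqVlt => /predU1P[<- _|z0 zz]; first by rewrite bes0.
by rewrite -bes0 ltW// bes_decr.
Qed.

(** [- bes'] is the value of [bes] at some earlier point, hence at most [1].  The
    ground state thus vanishes linearly at the outer arc. *)
Lemma bes_le_dist z : 0 <= z <= bes_zero -> bes z <= bes_zero - z.
Proof.
move=> /andP[z0]; rewrite le_eqVlt => /predU1P[->|zz].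
  by rewrite bes_zeroP subrr.
have [] := @MVT R bes bes' z bes_zero zz.
  by apply: continuous_subspaceT => t; exact: continuous_bes.
move=> c; rewrite in_itv/= => /andP[zc cz] /eqP; rewrite bes_zeroP sub0r eqr_oppLR => /eqP->.
rewrite -mulNr ler_piMl ?subr_ge0 ?(ltW zz)//.
have [d] := MVT_bes' (le_lt_trans z0 zc); rewrite in_itv/= => /andP[d0 dc] ->.
by rewrite opprK bes_le1// ltW//= (le_trans (ltW dc))// ltW.
Qed.

(** The antiderivative from which the norm of the ground state is computed. *)
Lemma is_derive_bes2 (z : R) :
  is_derive z (1 : R) (fun z => z * bes z ^+ 2 + (z * bes' z) ^+ 2) (bes z ^+ 2).
Proof.
have := is_derive_zbes' z => d1.
apply: is_derive_eq; rewrite /GRing.scale/=.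
by ring.
Qed.

Lemma besselJ0E (x : R) : besselJ 0 x = bes (x ^+ 2 / 4).
Proof.
rewrite /besselJ /bes; congr (limn _); rewrite /pseries; congr series.
apply/funext => k; rewrite /besselJ_coeff /bcoef !addn0 natrM -expr2.
congr (_ * _); rewrite -muln2 mulnC exprM; congr (_ ^+ k).
by field.
Qed.

Lemma derive_besselJ0 (x : R) :
  derive1 (besselJ 0) x = x / 2 * bes' (x ^+ 2 / 4).
Proof.
have -> : besselJ 0 = bes \o (fun x : R => x ^+ 2 / 4) by apply/funext => y; exact: besselJ0E.
have d1 : is_derive x (1 : R) (fun x : R => x ^+ 2 / 4) (x / 2).
  apply: is_derive_eq; rewrite /GRing.scale/=; by field.
rewrite derive1E; have d2 := @is_derive_bes (x ^+ 2 / 4).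
rewrite mulrC; have := @is_derive1_comp _ bes (fun x : R => x ^+ 2 / 4) x _ _ d2 d1.
by move=> d3; exact: derive_val.
Qed.

Definition j01 : R := 2 * Num.sqrt bes_zero.

Lemma j01_sqr : j01 ^+ 2 = 4 * bes_zero.
Proof. by rewrite /j01 exprMn sqr_sqrtr ?(ltW bes_zero_gt0)//; congr (_ * _); ring. Qed.

Lemma j01_gt0 : 0 < j01.
Proof. by rewrite mulr_gt0 // sqrtr_gt0 bes_zero_gt0. Qed.

Lemma j01_first y : 0 < y <= j01 -> besselJ 0 y = 0 -> y = j01.
Proof.
move=> /andP[y0 yj] Jy; apply/eqP; rewrite eq_le yj/= leNgt; apply/negP => yj'.
have : 0 < bes (y ^+ 2 / 4).
  apply: bes_gt0; rewrite divr_ge0 ?sqr_ge0//= ltr_pdivrMr// mulrC -j01_sqr.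
  by rewrite ltrXn2r ?nnegrE// ltW// j01_gt0.
by rewrite -besselJ0E Jy ltxx.
Qed.

Lemma besselJ0_j01 : besselJ 0 j01 = 0.
Proof. by rewrite besselJ0E j01_sqr mulrAC divff// mul1r bes_zeroP. Qed.

Lemma bessel_zero01 : bessel_zero R 0 1 = j01.
Proof.
have j0 := j01_gt0.
apply: xget_unique.
  split => //; first exact: besselJ0_j01.
  rewrite (_ : [set y | _] = [set j01]); first exact: card_set1.
  apply/seteqP; split => y /=; first by move=> [/j01_first].
  by move=> ->; rewrite j0 lexx besselJ0_j01.
move=> x [x0 Jx /eq_cardSP[a _]]; rewrite II0 card_eq0 => /eqP aE.
have jx : j01 <= x.
  by rewrite leNgt; apply/negP => xj; move: (xj); rewrite (j01_first _ Jx) ?ltxx// x0 ltW.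
have A y : 0 < y <= x -> besselJ 0 y = 0 -> y = a.
  move=> yx Jy; apply: contrapT => ya.
  by have : set0 y by rewrite -aE.
by rewrite (A x) ?x0 ?lexx// (A j01) ?j0// besselJ0_j01.
Qed.
End BesselSeries.

(** * Gradients of functions on the plane *)
Section PlaneCalculus.
Local Set Implicit Arguments.
Local Unset Strict Implicit.
Context {R : realType}.
Implicit Types (f g fx fy gx gy : R * R -> R).

Lemma continuous_fst2 : continuous (fun p : R * R => p.1).
Proof. by move=> p; exact: cvg_fst. Qed.

Lemma continuous_snd2 : continuous (fun p : R * R => p.2).
Proof. by move=> p; exact: cvg_snd. Qed.

(** [C1] with the partial derivatives named, so that the rules of calculus below
    produce explicit gradients. *)
Definition has_gradient f fx fy : Prop :=
  [/\ forall p, differentiable f p, dx f = fx, dy f = fy, continuous fx & continuous fy].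

Lemma has_gradientP f fx fy : has_gradient f fx fy -> C1 f.
Proof. by move=> [df <- <- cx cy]; split. Qed.

Lemma C1_gradient f : C1 f -> has_gradient f (dx f) (dy f).
Proof. by move=> [? ? ?]; split. Qed.

Lemma has_gradient_continuous f fx fy : has_gradient f fx fy -> continuous f.
Proof. by move=> [df _ _ _ _] p; exact: differentiable_continuous. Qed.

Lemma has_gradient_diff f (gx gy : R * R -> R) :
  (forall p, exists2 l : R * R -> R, is_diff p f l & l (1, 0) = gx p /\ l (0, 1) = gy p) ->
  continuous gx -> continuous gy -> has_gradient f gx gy.
Proof.
move=> H cx cy; split => //.
- by move=> p; have [l dl _] := H p; exact: ex_diff.
- apply/funext => p; have [l dl [<- _]] := H p.
  by rewrite /dx deriveE; [rewrite diff_val|exact: ex_diff].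
- apply/funext => p; have [l dl [_ <-]] := H p.
  by rewrite /dy deriveE; [rewrite diff_val|exact: ex_diff].
Qed.

Lemma is_diff_gradient f fx fy p : has_gradient f fx fy ->
  exists2 l : R * R -> R, is_diff p f l & l = (fun v => v.1 * fx p + v.2 * fy p).
Proof.
move=> [df <- <- _ _]; exists ('d f p : R * R -> R); first by apply: DiffDef; [exact: df|].
apply/funext => -[a b] /=; rewrite /dx /dy !deriveE//.
have -> : (a, b) = a *: ((1, 0) : R * R) + b *: ((0, 1) : R * R).
  by transitivity (a * 1 + b * 0, a * 0 + b * 1); rewrite // !mulr1 !mulr0 addr0 add0r.
by rewrite linearD !linearZ.
Qed.

Lemma has_gradient_fst : has_gradient (fun p => p.1) (fun=> 1) (fun=> 0).
Proof.
apply: has_gradient_diff; try exact: cst_continuous.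
by move=> p; exists fst; [apply: DiffDef; [apply: (@linear_differentiable _ _ _ fst); exact: continuous_fst2|apply: (@diff_lin _ _ _ fst); exact: continuous_fst2]|].
Qed.

Lemma has_gradient_snd : has_gradient (fun p => p.2) (fun=> 0) (fun=> 1).
Proof.
apply: has_gradient_diff; try exact: cst_continuous.
by move=> p; exists snd; [apply: DiffDef; [apply: (@linear_differentiable _ _ _ snd); exact: continuous_snd2|apply: (@diff_lin _ _ _ snd); exact: continuous_snd2]|].
Qed.

Lemma has_gradient_cst c : has_gradient (fun=> c) (fun=> 0) (fun=> 0).
Proof.
apply: has_gradient_diff; try exact: cst_continuous.
by move=> p; exists (0 : R * R -> R); [exact: is_diff_cst|].
Qed.

Lemma has_gradientD f fx fy g gx gy :
  has_gradient f fx fy -> has_gradient g gx gy ->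
  has_gradient (fun p => f p + g p) (fun p => fx p + gx p) (fun p => fy p + gy p).
Proof.
move=> hf hg; have [_ _ _ cfx cfy] := hf; have [_ _ _ cgx cgy] := hg.
apply: has_gradient_diff.
- move=> p; have [l dl lE] := is_diff_gradient p hf; have [m dm mE] := is_diff_gradient p hg.
  exists (l + m); first exact: is_diffD.
  have LM v : (l + m) v = l v + m v by [].
  by rewrite !LM lE mE /= !mul1r !mul0r !addr0 !add0r.
- by move=> p; apply: cvgD; [exact: cfx|exact: cgx].
- by move=> p; apply: cvgD; [exact: cfy|exact: cgy].
Qed.

Lemma has_gradientM f fx fy g gx gy :
  has_gradient f fx fy -> has_gradient g gx gy ->
  has_gradient (fun p => f p * g p)
    (fun p => f p * gx p + g p * fx p) (fun p => f p * gy p + g p * fy p).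
Proof.
move=> hf hg; have [_ _ _ cfx cfy] := hf; have [_ _ _ cgx cgy] := hg.
have cf := has_gradient_continuous hf; have cg := has_gradient_continuous hg.
apply: has_gradient_diff.
- move=> p; have [l dl lE] := is_diff_gradient p hf; have [m dm mE] := is_diff_gradient p hg.
  exists (f p *: m + g p *: l); first exact: is_diffM.
  have LM v : (f p *: m + g p *: l) v = f p * m v + g p * l v by [].
  by rewrite !LM lE mE /= !mul1r !mul0r !addr0 !add0r.
- by move=> p; apply: cvgD; apply: cvgM; [exact: cf|exact: cgx|exact: cg|exact: cfx].
- by move=> p; apply: cvgD; apply: cvgM; [exact: cf|exact: cgy|exact: cg|exact: cfy].
Qed.

Lemma has_gradientZ c f fx fy : has_gradient f fx fy ->
  has_gradient (fun p => c * f p) (fun p => c * fx p) (fun p => c * fy p).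
Proof.
move=> hf; have := has_gradientM (has_gradient_cst c) hf.
congr has_gradient; apply/funext => p; by rewrite mulr0 addr0.
Qed.

Lemma has_gradient_comp (h h' : R -> R) f fx fy :
  (forall x, is_derive x (1 : R) h (h' x)) -> continuous h' ->
  has_gradient f fx fy ->
  has_gradient (fun p => h (f p)) (fun p => h' (f p) * fx p) (fun p => h' (f p) * fy p).
Proof.
move=> dh ch hf; have [_ _ _ cfx cfy] := hf; have cf := has_gradient_continuous hf.
have cc : continuous (fun p => h' (f p)) by move=> p; apply: continuous_comp; [exact: cf|exact: ch].
apply: has_gradient_diff.
- move=> p; have [l dl lE] := is_diff_gradient p hf.
  have dhp : is_diff (f p) h (fun v => h' (f p) * v).
    have [dh1 dh2] := dh (f p).
    have dfp : differentiable h (f p) by apply/derivable1_diffP.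
    apply: DiffDef => //; apply/funext => v.
    have -> : v = v *: 1 by rewrite /GRing.scale/= mulr1.
    by rewrite linearZ/= -deriveE// dh2 /GRing.scale/= mulr1 mulrC.
  exists ((fun v => h' (f p) * v) \o l); first exact: is_diff_comp.
  by rewrite lE /= !mul1r !mul0r !addr0 !add0r.
- by move=> p; apply: cvgM; [exact: cc|exact: cfx].
- by move=> p; apply: cvgM; [exact: cc|exact: cfy].
Qed.

Lemma is_derive_curve f fx fy (a b : R -> R) (a' b' t : R) :
  has_gradient f fx fy -> is_derive t (1 : R) a a' -> is_derive t (1 : R) b b' ->
  is_derive t (1 : R) (fun t => f (a t, b t)) (fx (a t, b t) * a' + fy (a t, b t) * b').
Proof.
move=> hf [da a'E] [db b'E]; have [l [dl dlE] lE] := is_diff_gradient (a t, b t) hf.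
have dat : differentiable a t by apply/derivable1_diffP.
have dbt : differentiable b t by apply/derivable1_diffP.
have dab : differentiable (fun t => (a t, b t)) t by exact: differentiable_pair.
have dfab : differentiable (f \o (fun t => (a t, b t))) t by exact: differentiable_comp.
apply: DeriveDef; first by apply/derivable1_diffP.
rewrite deriveE// diff_comp//= dlE lE diff_pair//= -!deriveE// a'E b'E.
by rewrite !(mulrC _ (fx _)) !(mulrC _ (fy _)).
Qed.

Lemma has_gradient_near0 f fx fy p : has_gradient f fx fy ->
  (\forall q \near p, f q = 0) -> fx p = 0 /\ fy p = 0.
Proof.
move=> [df <- <- _ _] f0.
have E v : 'D_v f p = 0.
  by rewrite (@near_eq_derive _ _ _ f (cst 0) p v f0) derive_cst.
by split; exact: E.
Qed.

(** Cauchy-Schwarz for the increment of [g], in the form given by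
    [2 * c * g' <= g' ^ 2 / w + c ^ 2 * w] for the best constant [c]. *)
Lemma sqr_increment_le (g g' W w : R -> R) (a b : R) : a <= b -> W a < W b ->
  (forall x, a <= x <= b -> is_derive x (1 : R) g (g' x)) ->
  (forall x, a <= x <= b -> is_derive x (1 : R) W (w x)) ->
  (forall x, a <= x <= b -> {for x, continuous g'}) ->
  (forall x, a <= x <= b -> {for x, continuous w}) ->
  (forall x, a <= x <= b -> 0 < w x) ->
  (((g b - g a) ^+ 2)%:E <=
   (W b - W a)%:E * \int[lebesgue_measure]_(x in `[a, b]) ((g' x) ^+ 2 / w x)%:E)%E.
Proof.
move=> ab Wab dg dW cg cw w0.
have DW : 0 < W b - W a by rewrite subr_gt0.
pose c := (g b - g a) / (W b - W a).
pose k x := 2 * c * g' x - c ^+ 2 * w x.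
have ck x : a <= x <= b -> {for x, continuous k}.
  move=> xab; apply: cvgB; apply: cvgM; try exact: cvg_cst.
    exact: cg.
  exact: cw.
have cI x : a <= x <= b -> {for x, continuous (fun x => g' x ^+ 2 / w x)}.
  move=> xab; apply: cvgM; last first.
    by apply: cvgV; [rewrite gt_eqF// w0|exact: cw].
  by apply: cvgM; exact: cg.
have Ik : (\int[lebesgue_measure]_(x in `[a, b]) (k x)%:E =
    ((2 * c * g b - c ^+ 2 * W b) - (2 * c * g a - c ^+ 2 * W a))%:E)%E.
  apply: (@integral_derivative R (fun x => 2 * c * g x - c ^+ 2 * W x) k a b ab _ ck) => x xab.
  have dgx := dg _ xab; have dWx := dW _ xab.
  by apply: is_derive_eq; rewrite /GRing.scale/= /k; ring.
have int (h : R -> R) : (forall x, a <= x <= b -> {for x, continuous h}) ->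
    lebesgue_measure.-integrable `[a, b] (EFin \o h).
  move=> ch; apply: continuous_compact_integrable; first exact: segment_compact.
  by apply: continuous_in_subspaceT => x; rewrite inE/= in_itv/=; exact: ch.
have : (\int[lebesgue_measure]_(x in `[a, b]) (k x)%:E <=
   \int[lebesgue_measure]_(x in `[a, b]) ((g' x) ^+ 2 / w x)%:E)%E.
  apply: le_integral => //; [exact: int|exact: int|].
  move=> x; rewrite inE/= in_itv/= => /w0 wx; rewrite lee_fin /k.
  rewrite -subr_ge0 (_ : _ - _ = (g' x - c * w x) ^+ 2 / w x).
    by rewrite divr_ge0 ?sqr_ge0// ltW.
  by field; rewrite gt_eqF.
rewrite Ik => H.
have -> : ((g b - g a) ^+ 2)%:E = ((W b - W a)%:E *
    ((2 * c * g b - c ^+ 2 * W b) - (2 * c * g a - c ^+ 2 * W a))%:E)%E.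
  by rewrite -EFinM /c; congr EFin; field; rewrite gt_eqF.
by rewrite lee_wpmul2l// lee_fin ltW.
Qed.
End PlaneCalculus.

(** * Completeness of the space of square integrable functions *)
Section SquareIntegrable.
Local Set Implicit Arguments.
Local Unset Strict Implicit.
Context d (T : measurableType d) (R : realType).
Variables (mu : {measure set T -> \bar R}) (D : set T) (mD : measurable D).

Definition sq_integrable (f : T -> R) : Prop :=
  measurable_fun D f /\ mu.-integrable D (EFin \o (fun x => f x ^+ 2)).

Definition ip (f g : T -> R) : R := \int[mu]_(x in D) (f x * g x).

Lemma sq_integrableM f g : sq_integrable f -> sq_integrable g ->
  mu.-integrable D (EFin \o (fun x => f x * g x)).
Proof.
move=> [mf If] [mg Ig].
apply: (le_integrable mD _ _ (integrableD mD If Ig)).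
  by apply/measurable_EFinP; exact: measurable_funM.
move=> x _ /=; rewrite lee_fin normrM [leRHS]ger0_norm ?addr_ge0 ?sqr_ge0//.
rewrite -(real_normK (num_real (f x))) -(real_normK (num_real (g x))).
have := sqr_ge0 (`|f x| - `|g x|); have := normr_ge0 (f x); have := normr_ge0 (g x).
by nra.
Qed.

Lemma sq_integrableZ c f : sq_integrable f -> sq_integrable (fun x => c * f x).
Proof.
move=> [mf If]; split; first exact: measurable_funM.
rewrite (_ : _ \o _ = (fun x => (c ^+ 2)%:E * (f x ^+ 2)%:E)%E); first exact: integrableZl.
by apply/funext => x /=; rewrite exprMn.
Qed.

Lemma sq_integrableD f g : sq_integrable f -> sq_integrable g ->
  sq_integrable (fun x => f x + g x).
Proof.
move=> sf sg; have [mf If] := sf; have [mg Ig] := sg.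
split; first exact: measurable_funD.
have Ifg := sq_integrableM sf sg.
rewrite (_ : _ \o _ = (fun x => ((f x ^+ 2)%:E + (f x * g x)%:E) + ((f x * g x)%:E + (g x ^+ 2)%:E))%E).
  by apply: integrableD => //; apply: integrableD.
by apply/funext => x /=; rewrite -!EFinD; congr EFin; ring.
Qed.

Lemma sq_integrableB f g : sq_integrable f -> sq_integrable g ->
  sq_integrable (fun x => f x - g x).
Proof.
move=> sf sg; have := sq_integrableD sf (sq_integrableZ (-1) sg).
by under [X in sq_integrable X -> _]eq_fun do rewrite mulN1r.
Qed.

Lemma ipC f g : ip f g = ip g f.
Proof. by apply: eq_Rintegral => x _; rewrite mulrC. Qed.

Lemma ipDl f g h : sq_integrable f -> sq_integrable g -> sq_integrable h ->
  ip (fun x => f x + g x) h = ip f h + ip g h.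
Proof.
move=> sf sg sh; rewrite /ip -RintegralD//; [|exact: sq_integrableM..].
by apply: eq_Rintegral => x _; rewrite mulrDl.
Qed.

Lemma ipZl c f h : sq_integrable f -> sq_integrable h ->
  ip (fun x => c * f x) h = c * ip f h.
Proof.
move=> sf sh; rewrite /ip -RintegralZl//; last exact: sq_integrableM.
by apply: eq_Rintegral => x _; rewrite mulrA.
Qed.

Lemma ip_ge0 f : 0 <= ip f f.
Proof. by apply: Rintegral_ge0 => x _; rewrite -expr2 sqr_ge0. Qed.

Lemma ipE f : sq_integrable f ->
  (\int[mu]_(x in D) (f x ^+ 2)%:E)%E = (ip f f)%:E.
Proof.
move=> sf; have [_ If] := sf; rewrite /ip /Rintegral fineK; last exact: integrable_fin_num.
by apply: eq_integral => x _; rewrite expr2.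
Qed.

Lemma ip_lin2 (a b : R) f g : sq_integrable f -> sq_integrable g ->
  ip (fun x => a * f x + b * g x) (fun x => a * f x + b * g x) =
  a ^+ 2 * ip f f + 2 * a * b * ip f g + b ^+ 2 * ip g g.
Proof.
move=> sf sg.
have sZ c h : sq_integrable h -> sq_integrable (fun x => c * h x) by exact: sq_integrableZ.
have sfg := sq_integrableD (sZ a _ sf) (sZ b _ sg).
rewrite ipDl ?ipZl//; try exact: sZ.
rewrite (ipC f) (ipC g) !ipDl ?ipZl//; try exact: sZ.
by rewrite (ipC g f); ring.
Qed.

Lemma ip_eq0_ae f : sq_integrable f -> ip f f = 0 ->
  {ae mu, forall x, D x -> f x = 0}.
Proof.
move=> sf; have [mf If] := sf => f0.
have : (\int[mu]_(x in D) `|(f x ^+ 2)%:E| = 0)%E.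
  by under eq_integral do rewrite gee0_abs ?lee_fin ?sqr_ge0//; rewrite ipE// f0.
move=> f00; have := (ae_eq_integral_abs mu mD (measurable_int _ If)).1 f00.
by apply: filterS => x fx Dx; have /= [/eqP] := fx Dx; rewrite sqrf_eq0 => /eqP.
Qed.

Lemma ae_eq0_ip f g : sq_integrable f -> sq_integrable g ->
  {ae mu, forall x, D x -> f x = 0} -> ip f g = 0.
Proof.
move=> sf sg f0; rewrite /ip /Rintegral.
have -> : (\int[mu]_(x in D) (f x * g x)%:E = \int[mu]_(x in D) cst 0%E x)%E.
  apply: ae_eq_integral => //; first by have /measurable_int := sq_integrableM sf sg.
  by apply: filterS f0 => x fx Dx /=; rewrite fx// mul0r.
by rewrite integral0.
Qed.

(** Riesz-Fischer: where [S := \sum_k 4 ^ k * (f k.+1 - f k) ^ 2] is finite,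
    that is almost everywhere, [f] converges geometrically. *)
Lemma sq_integrable_complete (f : nat -> T -> R) :
  (forall k, sq_integrable (f k)) ->
  (forall k, ip (fun x => f k.+1 x - f k x) (fun x => f k.+1 x - f k x)
     <= (8 ^+ k.+1)^-1) ->
  exists2 u, sq_integrable u &
    (fun k => ip (fun x => u x - f k x) (fun x => u x - f k x)) @ \oo --> (0 : R).
Proof.
move=> sf fC.
pose dd k x := f k.+1 x - f k x.
have sd k : sq_integrable (dd k) by exact: sq_integrableB.
pose s k x : \bar R := (4 ^+ k * (dd k x) ^+ 2)%:E.
have s0 k x : (0 <= s k x)%E by rewrite lee_fin mulr_ge0 ?sqr_ge0// exprn_ge0.
have ms k : measurable_fun D (s k).
  apply/measurable_EFinP; apply: measurable_funM => //.
  by apply: measurable_funX; case: (sd k).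
pose S x := (\sum_(0 <= k <oo) s k x)%E.
have S0 x : (0 <= S x)%E by apply: nneseries_ge0.
have mS : measurable_fun D S by apply: ge0_emeasurable_sum => //.
(* [4 ^ k * 8 ^- k.+1] is at most [2 ^- k.+1], and these sum to [1]. *)
have IS : (\int[mu]_(x in D) S x <= 1)%E.
  rewrite integral_nneseries//.
  apply: (@le_trans _ _ (\sum_(0 <= k <oo) (0 + (1 / (2 ^ k.+1)%:R)%:E)))%E; last first.
    apply: le_trans (@epsilon_trick R (cst 0%E) 1 xpredT _ _) _ => //.
    by rewrite eseries0 ?add0e.
  apply: lee_nneseries => [k *|k *]; first by apply: integral_ge0 => x _; exact: s0.
  rewrite add0e /s; under eq_integral do rewrite EFinM.
  rewrite ge0_integralZl//; last 2 first.
  - by apply/measurable_EFinP; apply: measurable_funX; case: (sd k).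
  - by move=> x _; rewrite lee_fin sqr_ge0.
  rewrite ipE// -EFinM; apply: (@le_trans _ _ (4 ^+ k * (8 ^+ k.+1)^-1)%:E).
    by rewrite lee_fin ler_wpM2l ?exprn_ge0//; exact: fC.
  rewrite lee_fin natrX div1r ler_pdivrMr ?exprn_gt0// ler_pdivlMl ?exprn_gt0//.
  rewrite (_ : 8 = 2 * 4); last by rewrite -natrM.
  by rewrite exprMn ler_pM2l ?exprn_gt0// ler_weXn2l// ler1n.
pose A := D `&` [set x | (S x < +oo)%E].
have mA : measurable A by apply: emeasurable_fun_infty_o.
have aeA : {ae mu, forall x, D x -> A x}.
  have IntS : mu.-integrable D S.
    apply/integrableP; split => //; under eq_integral do rewrite gee0_abs//.
    exact: le_lt_trans IS (ltry _).
  apply: filterS (integrable_ae mD IntS) => x Sx Dx; split => //=.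
  by rewrite -ge0_fin_numE// Sx.
pose sg x := fine (S x).
have E4 k : ((2^-1 : R) ^+ k) ^+ 2 = (4 ^+ k)^-1.
  rewrite -exprM mulnC exprM (_ : (2^-1 : R) ^+ 2 = 4^-1) ?exprVn//; by field.
have ddle x k : A x -> `|dd k x| <= (2^-1) ^+ k * Num.sqrt (sg x).
  move=> [Dx Sx]; have SE : S x = (sg x)%:E by rewrite /sg fineK// ge0_fin_numE.
  have sg0 : 0 <= sg x by rewrite -lee_fin -SE.
  have h : 4 ^+ k * dd k x ^+ 2 <= sg x.
    rewrite -lee_fin -SE; apply: le_trans (@nneseries_lim_ge R (s^~ x) xpredT 0%N k.+1 _).
      by rewrite big_nat_recr//= leeDr// sume_ge0.
    by move=> n _ _; exact: s0.
  rewrite -sqrtr_sqr -[X in _ <= X * _]ger0_norm ?exprn_ge0 ?invr_ge0//.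
  rewrite -sqrtr_sqr -sqrtrM ?sqr_ge0// ler_wsqrtr//.
  by rewrite E4 ler_pdivlMl// exprn_gt0.
have geo x n m : A x -> `|f (n + m)%N x - f n x| <=
    2 * Num.sqrt (sg x) * (2^-1) ^+ n * (1 - (2^-1) ^+ m).
  move=> Ax; elim: m => [|m IH]; first by rewrite addn0 subrr normr0 expr0 subrr mulr0.
  have -> : f (n + m.+1)%N x - f n x = dd (n + m)%N x + (f (n + m)%N x - f n x).
    by rewrite /dd addnS addrA subrK.
  apply: (le_trans (ler_normD _ _)); apply: (le_trans (lerD (ddle x _ Ax) IH)).
  rewrite exprD exprS; have : 0 <= (2^-1 : R) ^+ n by rewrite exprn_ge0 ?invr_ge0.
  have : 0 <= (2^-1 : R) ^+ m by rewrite exprn_ge0 ?invr_ge0.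
  have := sqrtr_ge0 (sg x); move: (Num.sqrt _) (_ ^+ n) (_ ^+ m) => a b c a0 c0 b0.
  by rewrite le_eqVlt; apply/orP; left; apply/eqP; field.
have geo' x n m : A x -> (n <= m)%N ->
    `|f m x - f n x| <= 2 * Num.sqrt (sg x) * (2^-1) ^+ n.
  move=> Ax nm; have := geo x n (m - n)%N Ax; rewrite subnKC// => /le_trans; apply.
  by rewrite ler_piMr ?mulr_ge0 ?sqrtr_ge0 ?exprn_ge0 ?invr_ge0//.
have cf x : A x -> cvgn (f^~ x).
  move=> Ax; have -> : f^~ x = (fun n => f 0%N x + series (dd^~ x) n).
    apply/funext => n; rewrite /series/= /dd telescope_sumr//; ring.
  apply: is_cvgD; first exact: is_cvg_cst.
  apply: normed_cvg.
  apply: (series_le_cvg _ _ _ (@is_cvg_geometric_series R (Num.sqrt (sg x)) 2^-1 _)).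
  - by move=> n /=.
  - by move=> n; rewrite /geometric/= mulr_ge0 ?sqrtr_ge0 ?exprn_ge0 ?invr_ge0.
  - by move=> n; rewrite /geometric/= mulrC; exact: ddle.
  - by rewrite ger0_norm ?invr_ge0// invf_lt1// ltr1n.
(* The indicator makes the sequence converge everywhere, so that the limit is measurable. *)
pose h k x := f k x * \1_A x.
pose u x := limn (h^~ x).
have hA x : A x -> h^~ x = f^~ x.
  by move=> Ax; apply/funext => k; rewrite /h indicE mem_set// mulr1.
have hu x : h^~ x @ \oo --> u x.
  have [Ax|Ax] := pselect (A x); first by rewrite /u hA//; exact: cf.
  rewrite /u (_ : h^~ x = cst 0); first exact: is_cvg_cst.
  by apply/funext => k; rewrite /h indicE memNset// mulr0.
have mu_ : measurable_fun D u.
  apply: (measurable_fun_cvg (h := h)) => [m|x _]; last exact: hu.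
  apply: measurable_funM; first by case: (sf m).
  exact: measurable_indic.
have uf x n : A x -> `|u x - f n x| <= 2 * Num.sqrt (sg x) * (2^-1) ^+ n.
  move=> Ax; have cu : (fun m => `|f m x - f n x|) @ \oo --> `|u x - f n x|.
    apply: cvg_norm; apply: cvgB; last exact: cvg_cst.
    by have := hu x; rewrite hA.
  rewrite -(cvg_lim _ cu)//; apply: limr_le; first by apply/cvg_ex; eexists; exact: cu.
  by exists n => // m /= nm; exact: geo'.
have uf2 n : {ae mu, forall x, D x ->
    (((u x - f n x) ^+ 2)%:E <= ((4 * (4 ^+ n)^-1)%:E * S x))%E}.
  apply: filterS aeA => x DA Dx; have [_ Sx] := DA Dx.
  have SE : S x = (sg x)%:E by rewrite /sg fineK// ge0_fin_numE.
  have sg0 : 0 <= sg x by rewrite -lee_fin -SE.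
  rewrite SE -EFinM lee_fin -(real_normK (num_real (u x - f n x))).
  rewrite (@le_trans _ _ ((2 * Num.sqrt (sg x) * (2^-1) ^+ n) ^+ 2))//.
    by rewrite lerXn2r ?nnegrE ?mulr_ge0 ?sqrtr_ge0 ?exprn_ge0 ?invr_ge0// uf//; exact: DA.
  rewrite !exprMn sqr_sqrtr// E4 (_ : 2 ^+ 2 = 4 :> R); last by rewrite expr2 -natrM.
  by rewrite mulrAC.
have ms2 n : measurable_fun D (fun x => ((u x - f n x) ^+ 2)%:E).
  apply/measurable_EFinP; apply: measurable_funX; apply: measurable_funB => //.
  by case: (sf n).
have le4 n : (\int[mu]_(x in D) ((u x - f n x) ^+ 2)%:E <= (4 * (4 ^+ n)^-1)%:E)%E.
  have c0 : (0 <= (4 * (4 ^+ n)^-1)%:E :> \bar R)%E by rewrite lee_fin mulr_ge0 ?invr_ge0 ?exprn_ge0.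
  apply: (@le_trans _ _ (\int[mu]_(x in D) ((4 * (4 ^+ n)^-1)%:E * S x))%E).
    apply: ae_ge0_le_integral => //.
    - by move=> x _; rewrite lee_fin sqr_ge0.
    - by move=> x _; rewrite mule_ge0.
    - exact: measurable_funeM.
  by rewrite ge0_integralZl// -[leRHS]mule1 lee_wpmul2l.
have su0 n : sq_integrable (fun x => u x - f n x).
  split; first by apply: measurable_funB => //; case: (sf n).
  apply/integrableP; split; first exact: ms2.
  under eq_integral do rewrite /= ger0_norm ?sqr_ge0//.
  exact: le_lt_trans (le4 n) (ltry _).
exists u.
  have := sq_integrableD (su0 0%N) (sf 0%N).
  by under eq_fun do rewrite subrK.
apply: (@squeeze_cvgr _ _ _ _ (cst 0) (fun n => 4 * (4^-1) ^+ n)).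
- apply: nearW => n; rewrite ip_ge0/= -lee_fin -ipE//.
  by rewrite (le_trans (le4 n))// lee_fin exprVn.
- exact: cvg_cst.
- rewrite -[X in _ --> X](mulr0 4); apply: cvgMr.
  by apply: cvg_expr; rewrite ger0_norm ?invr_ge0// invf_lt1// ltr1n.
Qed.
End SquareIntegrable.

(** * Ground states of quadratic forms with a gap *)
Section AbstractGroundState.
Local Set Implicit Arguments.
Local Unset Strict Implicit.
Context d (T : measurableType d) (R : realType) (mu : {measure set T -> \bar R}).
Variables (D : set T) (mD : measurable D).
Local Notation sqi := (sq_integrable mu D).
Local Notation ip := (ip mu D).

Definition energy (ux uy : T -> R) : R := ip ux ux + ip uy uy.

Lemma ip_CS f g : sqi f -> sqi g -> ip f g ^+ 2 <= ip f f * ip g g.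
Proof.
move=> sf sg.
have h (a b : R) : 0 <= a ^+ 2 * ip f f + 2 * a * b * ip f g + b ^+ 2 * ip g g.
  by rewrite -(ip_lin2 mD a b sf sg) ip_ge0.
have := ip_ge0 mu D g; rewrite le_eqVlt => /predU1P[g0|g0].
  rewrite -g0 mulr0; have := h (ip f g) (- (ip f f + 1) / 2); rewrite -g0 mulr0 addr0.
  have := ip_ge0 mu D f; have := sqr_ge0 (ip f g); nra.
have := h (ip g g) (- ip f g).
rewrite [X in 0 <= X](_ : _ = ip g g * (ip f f * ip g g - ip f g ^+ 2)); last by ring.
by rewrite pmulr_rge0// subr_ge0.
Qed.

Lemma ip_cvg0 (e : nat -> T -> R) u : (forall k, sqi (e k)) -> sqi u ->
  (fun k => ip (e k) (e k)) @ \oo --> (0 : R) ->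
  (fun k => ip u (e k)) @ \oo --> (0 : R).
Proof.
move=> se su c0.
apply/cvgr0Pnorm_le => t t0.
have t20 : 0 < t ^+ 2 / (ip u u + 1) by rewrite divr_gt0 ?exprn_gt0// ltr_wpDl ?ip_ge0.
move/cvgr0Pnorm_le: c0 => /(_ _ t20); apply: filterS => k ek.
rewrite -(ler_pXn2r (_ : 0 < 2)%N) ?nnegrE ?(ltW t0)//.
rewrite real_normK ?num_real//; apply: (le_trans (ip_CS su (se k))).
have := ip_ge0 mu D (e k); have := ip_ge0 mu D u => u0 e0.
move: ek; rewrite ger0_norm// => ek.
apply: (@le_trans _ _ ((ip u u + 1) * (t ^+ 2 / (ip u u + 1)))).
  by apply: ler_pM => //; rewrite lerDl.
by rewrite mulrC divfK// gt_eqF// ltr_wpDl.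
Qed.

Lemma cvg_ip_sq (f : nat -> T -> R) u : (forall k, sqi (f k)) -> sqi u ->
  (fun k => ip (fun x => u x - f k x) (fun x => u x - f k x)) @ \oo --> (0 : R) ->
  (fun k => ip (f k) (f k)) @ \oo --> ip u u.
Proof.
move=> sf su c0.
pose e k x := u x - f k x.
have se k : sqi (e k) by exact: sq_integrableB.
have E k : ip (f k) (f k) = ip u u - 2 * ip u (e k) + ip (e k) (e k).
  have -> : f k = (fun x => 1 * u x + (-1) * e k x).
    by apply/funext => x; rewrite /e; ring.
  by rewrite ip_lin2//; ring.
have c1 := ip_cvg0 se su c0.
have -> : (fun k => ip (f k) (f k)) = (fun k => ip u u - 2 * ip u (e k) + ip (e k) (e k)).
  by apply/funext.
rewrite -[X in _ --> X]addr0; apply: cvgD => //.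
rewrite -[X in _ --> X]subr0; apply: cvgB; first exact: cvg_cst.
by rewrite -[X in _ --> X](mulr0 2); apply: cvgMr.
Qed.

Lemma energy_lin ux uy vx vy (a b : R) : sqi ux -> sqi uy -> sqi vx -> sqi vy ->
  energy (fun p => a * ux p + b * vx p) (fun p => a * uy p + b * vy p) =
  a ^+ 2 * energy ux uy + 2 * a * b * (ip ux vx + ip uy vy) + b ^+ 2 * energy vx vy.
Proof. by move=> sux suy svx svy; rewrite /energy !ip_lin2//; ring. Qed.

Lemma sqi_lin u v a b : sqi u -> sqi v -> sqi (fun p => a * u p + b * v p).
Proof. by move=> su sv; apply: sq_integrableD => //; exact: sq_integrableZ. Qed.

Lemma ip_linl u v w a b : sqi u -> sqi v -> sqi w ->
  ip (fun p => a * u p + b * v p) w = a * ip u w + b * ip v w.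
Proof.
by move=> su sv sw; rewrite ipDl ?ipZl//; exact: sq_integrableZ.
Qed.

(** [tst f fx fy] stands for a test function [f] with gradient [(fx, fy)]. *)
Variable tst : (T -> R) -> (T -> R) -> (T -> R) -> Prop.
Hypothesis tst_sqi : forall f fx fy, tst f fx fy -> [/\ sqi f, sqi fx & sqi fy].
Hypothesis tst_lin : forall f fx fy g gx gy (a b : R), tst f fx fy -> tst g gx gy ->
  tst (fun p => a * f p + b * g p) (fun p => a * fx p + b * gx p)
      (fun p => a * fy p + b * gy p).

Definition dist u ux uy f fx fy : R :=
  ip (fun p => u p - f p) (fun p => u p - f p) +
  energy (fun p => ux p - fx p) (fun p => uy p - fy p).

(** The closure of the test functions for the norm of [H ^ 1]. *)
Definition form_closure u ux uy : Prop :=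
  [/\ sqi u, sqi ux, sqi uy &
    forall e : R, 0 < e -> exists f fx fy, tst f fx fy /\ dist u ux uy f fx fy < e].

Lemma energy_ge0 ux uy : 0 <= energy ux uy.
Proof. by rewrite addr_ge0 ?ip_ge0. Qed.

Lemma dist_ge u ux uy f fx fy :
  [/\ ip (fun p => u p - f p) (fun p => u p - f p) <= dist u ux uy f fx fy,
      ip (fun p => ux p - fx p) (fun p => ux p - fx p) <= dist u ux uy f fx fy &
      ip (fun p => uy p - fy p) (fun p => uy p - fy p) <= dist u ux uy f fx fy].
Proof.
rewrite /dist /energy.
have := ip_ge0 mu D (fun p => u p - f p); have := ip_ge0 mu D (fun p => ux p - fx p).
by have := ip_ge0 mu D (fun p => uy p - fy p); split; lra.
Qed.

Lemma form_closure_ge (l : R) :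
  (forall f fx fy, tst f fx fy -> l * ip f f <= energy fx fy) ->
  forall u ux uy, form_closure u ux uy -> l * ip u u <= energy ux uy.
Proof.
move=> h u ux uy [su sux suy happ].
have /choice[F FP] : forall k : nat, exists F : (T -> R) * (T -> R) * (T -> R),
    tst F.1.1 F.1.2 F.2 /\ dist u ux uy F.1.1 F.1.2 F.2 < (k.+1%:R)^-1.
  move=> k; have k0 : 0 < (k.+1%:R : R)^-1 by rewrite invr_gt0.
  by have [f [fx [fy ff]]] := happ _ k0; exists (f, fx, fy).
have sF k := tst_sqi (FP k).1.
have c (w : nat -> R) : (forall k, 0 <= w k) ->
    (forall k, w k <= dist u ux uy (F k).1.1 (F k).1.2 (F k).2) -> w @ \oo --> (0 : R).
  move=> w0 w1; apply: (@squeeze_cvgr _ _ _ _ (cst 0) (@harmonic R));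
    [|exact: cvg_cst|exact: cvg_harmonic].
  apply: nearW => k; rewrite w0/= /harmonic/=.
  by apply: (le_trans (w1 k)); have [_ /ltW] := FP k.
have c1 : (fun k => ip (F k).1.1 (F k).1.1) @ \oo --> ip u u.
  apply: cvg_ip_sq => //; first by move=> k; case: (sF k).
  by apply: c => k; [exact: ip_ge0|have [] := dist_ge u ux uy (F k).1.1 (F k).1.2 (F k).2].
have c2 : (fun k => ip (F k).1.2 (F k).1.2) @ \oo --> ip ux ux.
  apply: cvg_ip_sq => //; first by move=> k; case: (sF k).
  by apply: c => k; [exact: ip_ge0|have [] := dist_ge u ux uy (F k).1.1 (F k).1.2 (F k).2].
have c3 : (fun k => ip (F k).2 (F k).2) @ \oo --> ip uy uy.
  apply: cvg_ip_sq => //; first by move=> k; case: (sF k).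
  by apply: c => k; [exact: ip_ge0|have [] := dist_ge u ux uy (F k).1.1 (F k).1.2 (F k).2].
have a1 : (fun k => l * ip (F k).1.1 (F k).1.1) @ \oo --> l * ip u u by exact: cvgMr.
have a2 : (fun k => energy (F k).1.2 (F k).2) @ \oo --> energy ux uy by exact: cvgD.
by apply: (ler_cvg_to a1 a2); apply: nearW => k; apply: h; case: (FP k).
Qed.

Lemma form_closure_lin u ux uy v vx vy a b :
  form_closure u ux uy -> form_closure v vx vy ->
  form_closure (fun p => a * u p + b * v p) (fun p => a * ux p + b * vx p)
    (fun p => a * uy p + b * vy p).
Proof.
move=> [su sux suy hu] [sv svx svy hv]; split; try exact: sqi_lin.
move=> e e0; pose M := 2 * (a ^+ 2 + b ^+ 2 + 1).
have M0 : 0 < M by rewrite mulr_gt0// ltr_wpDl// addr_ge0 ?sqr_ge0.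
have e1 : 0 < e / M by rewrite divr_gt0.
have [f [fx [fy [tf df]]]] := hu _ e1; have [g [gx [gy [tg dg]]]] := hv _ e1.
do 3 eexists; split; first exact: (tst_lin a b tf tg).
have [sf sfx sfy] := tst_sqi tf; have [sg sgx sgy] := tst_sqi tg.
have key (w z F H : T -> R) : sqi w -> sqi z -> sqi F -> sqi H ->
    ip (fun p => (a * w p + b * z p) - (a * F p + b * H p))
       (fun p => (a * w p + b * z p) - (a * F p + b * H p)) <=
    2 * a ^+ 2 * ip (fun p => w p - F p) (fun p => w p - F p) +
    2 * b ^+ 2 * ip (fun p => z p - H p) (fun p => z p - H p).
  move=> sw sz sF sH.
  have s1 := sq_integrableB mD sw sF; have s2 := sq_integrableB mD sz sH.
  have -> : (fun p => (a * w p + b * z p) - (a * F p + b * H p)) =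
      (fun p => a * (w p - F p) + b * (z p - H p)).
    by apply/funext => p; ring.
  have := ip_ge0 mu D (fun p => a * (w p - F p) + (- b) * (z p - H p)).
  by rewrite !ip_lin2//; lra.
apply: (@le_lt_trans _ _ (2 * a ^+ 2 * dist u ux uy f fx fy + 2 * b ^+ 2 * dist v vx vy g gx gy)).
  rewrite /dist /energy; have := key _ _ _ _ su sv sf sg.
  have := key _ _ _ _ sux svx sfx sgx; have := key _ _ _ _ suy svy sfy sgy.
  by lra.
have := sqr_ge0 a; have := sqr_ge0 b => b0 a0.
apply: (@le_lt_trans _ _ ((2 * a ^+ 2 + 2 * b ^+ 2) * (e / M))).
  have := ler_wpM2l a0 (ltW df); have := ler_wpM2l b0 (ltW dg); lra.
rewrite mulrA ltr_pdivrMr// mulrC ltr_pM2l// /M; lra.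
Qed.

(** The form [energy - l * ip] is nonnegative and zero at [u]; hence its polarisation
    with [u] vanishes: a minimiser of the Rayleigh quotient is an eigenfunction. *)
Lemma form_closure_stationary (l : R) u ux uy :
  (forall f fx fy, tst f fx fy -> l * ip f f <= energy fx fy) ->
  form_closure u ux uy -> energy ux uy = l * ip u u ->
  forall v vx vy, form_closure v vx vy -> ip ux vx + ip uy vy = l * ip u v.
Proof.
move=> h hu E v vx vy hv.
have [su sux suy _] := hu; have [sv svx svy _] := hv.
pose q := energy vx vy - l * ip v v.
pose b := ip ux vx + ip uy vy - l * ip u v.
have H (t : R) : 0 <= 2 * t * b + t ^+ 2 * q.
  have := form_closure_ge h (form_closure_lin 1 t hu hv).
  rewrite ip_lin2// energy_lin// E -subr_ge0; congr (0 <= _).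
  by rewrite /b /q; ring.
suff : b = 0 by move/eqP; rewrite subr_eq0 => /eqP.
have q0 : 0 <= q by rewrite subr_ge0; exact: form_closure_ge.
(* The minimum of [H] is at [- b / q]; the shift by [1] keeps the denominator positive. *)
have := H (- b / (q + 1)).
have q1 : 0 < q + 1 by rewrite ltr_wpDl.
rewrite [X in 0 <= X](_ : _ = - (b ^+ 2 * (q + 2) / (q + 1) ^+ 2)); last first.
  by field; rewrite gt_eqF.
rewrite oppr_ge0 pmulr_lle0 ?invr_gt0 ?exprn_gt0// pmulr_lle0; last by rewrite ltr_wpDl.
by rewrite real_exprn_even_le0 ?num_real//= => /eqP.
Qed.

(** Existence of a ground state without any compactness: below the level [l0 + gam]
    the form is, up to one dimension, at least [(l0 + gam) * ip f f], which forces
    every normalised minimising sequence to be a Cauchy sequence. *)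
Lemma ground_state (l0 gam : R) (u0 : T -> R) f0 f0x f0y :
  0 < gam -> sqi u0 -> 0 < ip u0 u0 ->
  (forall f fx fy, tst f fx fy ->
    (l0 + gam) * ip f f - gam * (ip f u0 ^+ 2 / ip u0 u0) <= energy fx fy) ->
  tst f0 f0x f0y -> energy f0x f0y < (l0 + gam) * ip f0 f0 ->
  exists (l : R) u ux uy,
    [/\ form_closure u ux uy, 0 < ip u u, energy ux uy = l * ip u u,
        forall f fx fy, tst f fx fy -> l * ip f f <= energy fx fy &
        forall c, (forall f fx fy, tst f fx fy -> c * ip f f <= energy fx fy) -> c <= l].
Proof.
move=> gam0 su0 N0 gap tf0 f0l.
pose L := [set c : R | exists f fx fy, [/\ tst f fx fy, 0 < ip f f & c = energy fx fy / ip f f]].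
have nf0 : 0 < ip f0 f0.
  rewrite lt_neqAle ip_ge0 andbT; apply/eqP => Z.
  by move: f0l; rewrite -Z mulr0 ltNge energy_ge0.
have hL : has_inf L.
  split; first by exists (energy f0x f0y / ip f0 f0), f0, f0x, f0y.
  by exists 0 => _ [f [fx [fy [_ n0 ->]]]]; rewrite divr_ge0 ?energy_ge0// ltW.
pose l := inf L.
have lge f fx fy : tst f fx fy -> l * ip f f <= energy fx fy.
  move=> tf; have := ip_ge0 mu D f; rewrite le_eqVlt => /predU1P[<-|n0].
    by rewrite mulr0 energy_ge0.
  rewrite -ler_pdivlMr//; apply: ge_inf; first by case: hL.
  by exists f, fx, fy.
have lglb c : (forall f fx fy, tst f fx fy -> c * ip f f <= energy fx fy) -> c <= l.
  move=> h; apply: lb_le_inf; first by case: hL.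
  by move=> _ [f [fx [fy [tf n0 ->]]]]; rewrite ler_pdivlMr// h.
have l_ge0 : 0 <= l by apply: lglb => *; rewrite mul0r energy_ge0.
pose kap := l0 + gam - l.
have kap0 : 0 < kap.
  rewrite subr_gt0; apply: (@le_lt_trans _ _ (energy f0x f0y / ip f0 f0)).
    by apply: ge_inf; [case: hL|exists f0, f0x, f0y].
  by rewrite ltr_pdivrMr.
(* A near minimiser lies below the gap, so that its component along [u0] is not small and
   can be normalised to [1]. *)
have almost (e : R) : 0 < e -> exists G : (T -> R) * (T -> R) * (T -> R),
    [/\ tst G.1.1 G.1.2 G.2, ip G.1.1 u0 = 1 &
        energy G.1.2 G.2 - l * ip G.1.1 G.1.1 <= e].
  move=> e0; pose e1 := Num.min (kap / 2) (e * (kap * ip u0 u0 / (2 * gam))).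
  have e10 : 0 < e1 by rewrite lt_min divr_gt0//= mulr_gt0// divr_gt0 ?mulr_gt0.
  have [_ [f [fx [fy [tf n0 ->]]]]] := inf_adherent e10 hL.
  rewrite ltr_pdivrMr// -/l => fl.
  pose t := ip f u0.
  have tb : (kap / 2) * ip f f <= gam * (t ^+ 2 / ip u0 u0).
    have := gap _ _ _ tf; rewrite -/t.
    have : e1 * ip f f <= kap / 2 * ip f f by rewrite ler_pM2r// ge_min lexx.
    by move: fl; rewrite /kap; move: (ip f f) (_ / ip u0 u0) => n s; lra.
  have t2 : 0 < t ^+ 2.
    have : 0 < gam * (t ^+ 2 / ip u0 u0) by apply: lt_le_trans tb; rewrite mulr_gt0 ?divr_gt0.
    by rewrite pmulr_rgt0// pmulr_lgt0 ?invr_gt0.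
  have tn0 : t != 0 by apply: contraTneq t2 => ->; rewrite expr0n/= ltxx.
  have [sf sfx sfy] := tst_sqi tf.
  exists ((fun p => t^-1 * f p + 0 * f p), (fun p => t^-1 * fx p + 0 * fx p),
          (fun p => t^-1 * fy p + 0 * fy p)) => /=; split.
  - exact: tst_lin.
  - by rewrite ip_linl// -/t mul0r addr0 mulVf.
  - rewrite ip_lin2// energy_lin//.
    rewrite [leLHS](_ : _ = (energy fx fy - l * ip f f) / t ^+ 2); last by field.
    rewrite ler_pdivrMr//.
    apply: (@le_trans _ _ (e1 * ip f f)); first by move: fl; lra.
    apply: (@le_trans _ _ (e * (kap * ip u0 u0 / (2 * gam)) * ip f f)).
      by rewrite ler_pM2r// ge_min lexx orbT.
    rewrite -mulrA ler_pM2l//.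
    rewrite (_ : kap * ip u0 u0 / (2 * gam) * ip f f = (kap / 2 * ip f f) * (ip u0 u0 / gam)); last first.
      by field; rewrite gt_eqF.
    apply: (@le_trans _ _ (gam * (t ^+ 2 / ip u0 u0) * (ip u0 u0 / gam))).
      by rewrite ler_pM2r// divr_gt0.
    by rewrite le_eqVlt; apply/orP; left; apply/eqP; field; rewrite !gt_eqF.
pose K := 4 * (1 / kap + (1 + l / kap)).
have K0 : 0 < K by rewrite mulr_gt0// ltr_wpDr ?divr_gt0// addr_ge0// divr_ge0// ltW.
pose e_ (k : nat) : R := (8 ^+ k.+1)^-1 / K.
have e_0 k : 0 < e_ k by rewrite divr_gt0// invr_gt0 exprn_gt0.
have e_S k : e_ k.+1 <= e_ k.
  rewrite ler_pM2r ?invr_gt0// lef_pV2 ?posrE ?exprn_gt0//.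
  by rewrite ler_weXn2l// ler1n.
have /choice[G GP] : forall k, exists G : (T -> R) * (T -> R) * (T -> R),
    [/\ tst G.1.1 G.1.2 G.2, ip G.1.1 u0 = 1 &
        energy G.1.2 G.2 - l * ip G.1.1 G.1.1 <= e_ k] by move=> k; exact: almost.
have sG k : [/\ sqi (G k).1.1, sqi (G k).1.2 & sqi (G k).2] by have [/tst_sqi] := GP k.
(* The difference of two normalised near minimisers is orthogonal to [u0], where the gap
   applies; by the parallelogram identity its energy exceeds [l] times its square norm by
   little, and both are small. *)
have dG k : ip (fun x => (G k.+1).1.1 x - (G k).1.1 x) (fun x => (G k.+1).1.1 x - (G k).1.1 x) +
   energy (fun x => (G k.+1).1.2 x - (G k).1.2 x) (fun x => (G k.+1).2 x - (G k).2 x) <= (8 ^+ k.+1)^-1.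
  have [t1 u1 q1] := GP k; have [t2 u2 q2] := GP k.+1.
  have [s1 s1x s1y] := sG k; have [s2 s2x s2y] := sG k.+1.
  have tw := tst_lin 1 (-1) t2 t1; have tz := tst_lin 1 1 t2 t1.
  have -> : (fun x => (G k.+1).1.1 x - (G k).1.1 x) = (fun x => 1 * (G k.+1).1.1 x + (-1) * (G k).1.1 x).
    by apply/funext => x; ring.
  have -> : (fun x => (G k.+1).1.2 x - (G k).1.2 x) = (fun x => 1 * (G k.+1).1.2 x + (-1) * (G k).1.2 x).
    by apply/funext => x; ring.
  have -> : (fun x => (G k.+1).2 x - (G k).2 x) = (fun x => 1 * (G k.+1).2 x + (-1) * (G k).2 x).
    by apply/funext => x; ring.
  have gw := gap _ _ _ tw; have lz := lge _ _ _ tz.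
  move: gw; rewrite (ip_linl _ _ s2 s1 su0) u1 u2 (_ : 1 * 1 + -1 * 1 = 0 :> R); last by ring.
  rewrite expr0n/= mul0r mulr0 subr0.
  set n := ip (fun p => 1 * (G k.+1).1.1 p + -1 * (G k).1.1 p) _.
  set q := energy (fun p => 1 * (G k.+1).1.2 p + -1 * (G k).1.2 p) _.
  move=> gw.
  have qn : q - l * n <= 4 * e_ k.
    move: lz; rewrite /q /n !ip_lin2// !energy_lin//; have := e_S k; clear -q1 q2; lra.
  have n1 : kap * n <= 4 * e_ k by move: gw qn; rewrite /kap; clear -kap0; lra.
  have n2 : n <= 4 * e_ k / kap by rewrite ler_pdivlMr// mulrC.
  have -> : (8 ^+ k.+1)^-1 = K * e_ k by rewrite /e_ mulrC divfK// gt_eqF.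
  have : l * n <= l * (4 * e_ k / kap) by rewrite ler_wpM2l.
  rewrite /K mulrDr mulrDl.
  move: n2 qn; set E := e_ k.
  have -> : 4 * (1 / kap) * E = 4 * E / kap by field; rewrite gt_eqF.
  have -> : 4 * (1 + l / kap) * E = 4 * E + l * (4 * E / kap) by field; rewrite gt_eqF.
  by clear -l_ge0; lra.
have i0 := ip_ge0 mu D.
have [u su cu] : exists2 u, sqi u & (fun k => ip (fun x => u x - (G k).1.1 x) (fun x => u x - (G k).1.1 x)) @ \oo --> (0 : R).
  apply: (sq_integrable_complete mD) => k; first by case: (sG k).
  by apply: le_trans (dG k); rewrite lerDl energy_ge0.
have [ux sux cux] : exists2 u, sqi u & (fun k => ip (fun x => u x - (G k).1.2 x) (fun x => u x - (G k).1.2 x)) @ \oo --> (0 : R).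
  apply: (sq_integrable_complete mD) => k; first by case: (sG k).
  by apply: le_trans (dG k); rewrite /energy addrCA lerDl addr_ge0.
have [uy suy cuy] : exists2 u, sqi u & (fun k => ip (fun x => u x - (G k).2 x) (fun x => u x - (G k).2 x)) @ \oo --> (0 : R).
  apply: (sq_integrable_complete mD) => k; first by case: (sG k).
  by apply: le_trans (dG k); rewrite /energy addrA lerDr addr_ge0.
have cdist : (fun k => dist u ux uy (G k).1.1 (G k).1.2 (G k).2) @ \oo --> (0 : R).
  rewrite -[X in _ --> X]addr0 -[X in _ --> _ + X]addr0.
  by apply: cvgD => //; apply: cvgD.
exists l, u, ux, uy; split => //.
- split => // e e0.
  have /cvgr0Pnorm_lt/(_ _ e0)[k _ /(_ k (leqnn k)) kd] := cdist.
  exists (G k).1.1, (G k).1.2, (G k).2; split; first by case: (GP k).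
  by apply: le_lt_trans kd; exact: ler_norm.
- have c1 := ip_cvg0 (fun k => sq_integrableB mD su (let: And3 a _ _ := sG k in a)) su0 cu.
  have E k : ip u0 (fun x => u x - (G k).1.1 x) = ip u0 u - 1.
    have [_ g1 _] := GP k; have [s1 _ _] := sG k.
    rewrite ipC (_ : (fun x => _) = (fun x => 1 * u x + (-1) * (G k).1.1 x)); last by apply/funext => x; ring.
    by rewrite ip_linl// g1 ipC; ring.
  have u1 : ip u0 u = 1.
    apply/eqP; rewrite -subr_eq0; apply/eqP.
    have c2 : (fun k => ip u0 (fun x => u x - (G k).1.1 x)) @ \oo --> ip u0 u - 1.
      by under eq_fun do rewrite E; exact: cvg_cst.
    exact: (cvg_unique _ c2 c1).
  have := ip_CS su0 su; rewrite u1 expr1n => h.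
  rewrite lt_neqAle i0 andbT; apply/eqP => Z.
  by move: h; rewrite -Z mulr0 ler10.
- have n1 : (fun k => ip (G k).1.1 (G k).1.1) @ \oo --> ip u u.
    by apply: cvg_ip_sq => // k; case: (sG k).
  have q1 : (fun k => energy (G k).1.2 (G k).2) @ \oo --> energy ux uy.
    by apply: cvgD; apply: cvg_ip_sq => // k; case: (sG k).
  have c1 : (fun k => energy (G k).1.2 (G k).2 - l * ip (G k).1.1 (G k).1.1) @ \oo --> energy ux uy - l * ip u u.
    by apply: cvgB => //; apply: cvgMr.
  have c2 : (fun k => energy (G k).1.2 (G k).2 - l * ip (G k).1.1 (G k).1.1) @ \oo --> (0 : R).
    apply: (@squeeze_cvgr _ _ _ _ (cst 0) (fun k => K^-1 * geometric 1 (8^-1) k)).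
    + apply: nearW => k; have [tk _ qk] := GP k; rewrite subr_ge0 lge//=.
      apply: (le_trans qk); rewrite /e_ mulrC ler_pM2l ?invr_gt0// /geometric/= mul1r -exprVn.
      by rewrite exprS ler_piMl ?exprn_ge0 ?invr_ge0// invf_le1// ler1n.
    + exact: cvg_cst.
    + rewrite -[X in _ --> X](mulr0 K^-1); apply: cvgMr.
      by apply: cvg_geometric; rewrite ger0_norm ?invr_ge0// invf_lt1// ltr1n.
  by apply/eqP; rewrite -subr_eq0; apply/eqP; exact: (cvg_unique _ c1 c2).
Qed.

End AbstractGroundState.

Section PlaneGroundState.
Local Set Implicit Arguments.
Local Unset Strict Implicit.
Context {R : realType}.
Local Notation mR := (measurableTypeR R).
Local Notation plane := (mR * mR)%type.
Local Notation leb := (@lebesgue_measure R).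
Local Notation leb2 := (leb \x leb)%E.
Variables (D G : set (R * R)).
Hypothesis mD : measurable (D : set plane).
Hypothesis bD : exists M : R, forall p, D p -> `|p.1| <= M /\ `|p.2| <= M.

Lemma continuous_sq_integrable (f : R * R -> R) : continuous f ->
  sq_integrable leb2 (D : set plane) f.
Proof.
move=> cf; have [M DM] := bD.
have mf := measurable_continuous2 cf.
have mf2 : measurable_fun (D : set plane) (fun p => f p ^+ 2).
  by apply: measurable_funX; exact: measurable_funTS.
split; first exact: measurable_funTS.
have DB : D `<=` (`[-M, M]%classic `*` `[-M, M]%classic).
  move=> p /DM [p1 p2]; split => /=; rewrite in_itv/=; by rewrite -ler_norml.
apply: measurable_bounded_integrable => //.
- apply: (@le_lt_trans _ _ (leb2 (`[-M, M]%classic `*` `[-M, M]%classic))).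
    apply: le_measure; rewrite ?inE//.
    by apply: measurableX; exact: measurable_itv.
  rewrite product_measure1E; [|exact: measurable_itv..].
  pose B : set R := `[-M, M]%classic.
  have l : (leb B < +oo)%E.
    by rewrite /B lebesgue_measure_itv/=; case: ifP => _; rewrite ?ltry// ltry.
  by rewrite lte_mul_pinfty// ge0_fin_numE.
- have cB : compact (`[-M, M]%classic `*` `[-M, M]%classic : set (R * R)).
    by apply: compact_setX; exact: segment_compact.
  have cf2 : continuous (fun p => f p ^+ 2) by move=> p; apply: cvgM; exact: cf.
  have := compact_bounded (continuous_compact (continuous_subspaceT cf2) cB).
  move=> [K [Kr HK]]; exists K; split => // x Kx p Dp /=.
  by apply: (HK x Kx); exists p => //; exact: DB.
Qed.

Lemma C1_sq_integrable (f : R * R -> R) : C1 f ->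
  [/\ sq_integrable leb2 (D : set plane) f, sq_integrable leb2 (D : set plane) (dx f) &
      sq_integrable leb2 (D : set plane) (dy f)].
Proof.
move=> [df cx cy]; split; apply: continuous_sq_integrable => // p.
exact: differentiable_continuous.
Qed.

Definition test_triple (f fx fy : R * R -> R) : Prop :=
  [/\ test_function G f, fx = dx f & fy = dy f].

Lemma test_triple_sqi f fx fy : test_triple f fx fy ->
  [/\ sq_integrable leb2 (D : set plane) f, sq_integrable leb2 (D : set plane) fx &
      sq_integrable leb2 (D : set plane) fy].
Proof. by move=> [[cf _] -> ->]; exact: C1_sq_integrable. Qed.

Lemma test_triple_lin f fx fy g gx gy (a b : R) :
  test_triple f fx fy -> test_triple g gx gy ->
  test_triple (fun p => a * f p + b * g p) (fun p => a * fx p + b * gx p)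
      (fun p => a * fy p + b * gy p).
Proof.
move=> [[cf f0] -> ->] [[cg g0] -> ->].
have h := has_gradientD (has_gradientZ a (C1_gradient cf)) (has_gradientZ b (C1_gradient cg)).
have [_ hx hy _ _] := h; split; [|exact: esym hx|exact: esym hy].
split; first exact: has_gradientP h.
move=> p Gp; apply: filterS2 (f0 p Gp) (g0 p Gp) => q -> ->.
by rewrite !mulr0 addr0.
Qed.

End PlaneGroundState.

Section DistanceIntegral.
Local Set Implicit Arguments.
Local Unset Strict Implicit.
Context d (T : measurableType d) (R : realType) (mu : {measure set T -> \bar R}).
Variables (D : set T) (mD : measurable D).

Lemma dist_integral u ux uy f fx fy :
  sq_integrable mu D u -> sq_integrable mu D ux -> sq_integrable mu D uy ->
  sq_integrable mu D f -> sq_integrable mu D fx -> sq_integrable mu D fy ->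
  (\int[mu]_(p in D)
     ((u p - f p) ^+ 2 + (ux p - fx p) ^+ 2 + (uy p - fy p) ^+ 2)%:E =
   (dist mu D u ux uy f fx fy)%:E)%E.
Proof.
move=> su sux suy sf sfx sfy.
have s1 := sq_integrableB mD su sf; have s2 := sq_integrableB mD sux sfx.
have s3 := sq_integrableB mD suy sfy.
have [m1 _] := s1; have [m2 _] := s2; have [m3 _] := s3.
under eq_integral do rewrite !EFinD.
have mm (h : T -> R) : measurable_fun D h -> measurable_fun D (fun p => (h p ^+ 2)%:E).
  by move=> mh; apply/measurable_EFinP; exact: measurable_funX.
have p0 (h : T -> R) : forall x, D x -> (0 <= (h x ^+ 2)%:E)%E.
  by move=> x _; rewrite lee_fin sqr_ge0.
rewrite ge0_integralD//; [|by move=> x Dx; rewrite adde_ge0// lee_fin sqr_ge0|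
  by apply: emeasurable_funD; exact: mm|by move=> x Dx; rewrite lee_fin sqr_ge0|exact: mm].
rewrite ge0_integralD//; [|by move=> x Dx; rewrite lee_fin sqr_ge0|exact: mm|by move=> x Dx; rewrite lee_fin sqr_ge0|exact: mm].
by rewrite !ipE// /dist /energy -!EFinD addrA.
Qed.

End DistanceIntegral.

(** * The lowest eigenvalue as an infimum of Rayleigh quotients *)
Section LowestEigenvalue.
Local Set Implicit Arguments.
Local Unset Strict Implicit.
Context {R : realType}.
Local Notation mR := (measurableTypeR R).
Local Notation plane := (mR * mR)%type.
Local Notation leb := (@lebesgue_measure R).
Local Notation leb2 := (leb \x leb)%E.
Variables (D G : set (R * R)).
Hypothesis mD : measurable (D : set plane).
Hypothesis bD : exists M : R, forall p, D p -> `|p.1| <= M /\ `|p.2| <= M.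
Local Notation nrm f := (ip leb2 (D : set plane) f f).
Local Notation energy := (energy leb2 (D : set plane)).

Lemma form_domainP u ux uy : form_domain D G u ux uy <->
  form_closure leb2 (D : set plane) (test_triple G) u ux uy.
Proof.
split=> -[su sux suy h]; split => // e e0.
- have [f tf fe] := h e e0; exists f, (dx f), (dy f); split; first by split.
  have [sf sfx sfy] := C1_sq_integrable mD bD (proj1 tf).
  rewrite -lte_fin; apply: le_lt_trans fe.
  by rewrite (dist_integral mD su sux suy sf sfx sfy).
- have [f [_ [_ [[tf -> ->] fe]]]] := h e e0; exists f => //.
  have [sf sfx sfy] := C1_sq_integrable mD bD (proj1 tf).
  apply: (@le_lt_trans _ _ (dist leb2 (D : set plane) u ux uy f (dx f) (dy f))%:E).
    by rewrite -(dist_integral mD su sux suy sf sfx sfy).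
  by rewrite lte_fin.
Qed.

(** By the hypothesis on [f] the form is at least [l0 + gam] on the orthogonal of [u0],
    and [f0] is below that level, so that [ground_state] applies.  Its minimiser is an
    eigenfunction, and the equation of any eigenfunction, tested against itself, gives a
    Rayleigh quotient. *)
Lemma lowest_eigenvalue_rayleigh (l0 gam : R) (u0 f0 : R * R -> R) :
  0 < gam -> sq_integrable leb2 (D : set plane) u0 -> 0 < nrm u0 ->
  (forall f, test_function G f ->
    (l0 + gam) * nrm f - gam * (ip leb2 (D : set plane) f u0 ^+ 2 / nrm u0)
      <= energy (dx f) (dy f)) ->
  test_function G f0 -> energy (dx f0) (dy f0) < (l0 + gam) * nrm f0 ->
  (forall f, test_function G f -> lowest_eigenvalue D G * nrm f <= energy (dx f) (dy f)) /\
  (forall c, (forall f, test_function G f -> c * nrm f <= energy (dx f) (dy f)) ->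
    c <= lowest_eigenvalue D G).
Proof.
move=> gam0 su0 N0 gap tf0 f0l.
have gap' f fx fy : test_triple G f fx fy ->
    (l0 + gam) * nrm f - gam * (ip leb2 (D : set plane) f u0 ^+ 2 / nrm u0) <= energy fx fy.
  by move=> [tf -> ->]; exact: gap.
have t0 : test_triple G f0 (dx f0) (dy f0) by split.
have [l [u [ux [uy [cu u0' E lge lglb]]]]] :=
  ground_state mD (test_triple_sqi mD bD (G := G)) (@test_triple_lin R G) gam0 su0 N0 gap' t0 f0l.
have ge_l v vx vy : form_domain D G v vx vy -> l * nrm v <= energy vx vy.
  by move=> /form_domainP; apply: (form_closure_ge mD (test_triple_sqi mD bD (G := G)) lge).
have low : is_lowest_eigenvalue D G l.
  split.
    exists u, ux, uy; split; first exact/form_domainP.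
      have [su _ _ _] := cu.
      by move=> /(ae_eq0_ip mD su su) n0; rewrite n0 ltxx in u0'.
    move=> v vx vy hv.
    have h := form_closure_stationary mD (test_triple_sqi mD bD (G := G)) (@test_triple_lin R G) lge cu E ((form_domainP v vx vy).1 hv).
    have [su sux suy _] := cu; have [sv svx svy _] := hv.
    rewrite -[RHS]h -RintegralD//; exact: sq_integrableM.
  move=> mu [v [vx [vy [hv v0 ev]]]]; have [sv svx svy _] := hv.
  have n0 : 0 < nrm v.
    rewrite lt_neqAle ip_ge0 andbT; apply/eqP => n0; apply: v0.
    exact: (ip_eq0_ae mD sv (esym n0)).
  rewrite -(ler_pM2r n0); apply: le_trans (ge_l _ _ _ hv) _.
  rewrite -[leRHS](ev v vx vy hv) RintegralD//; exact: sq_integrableM.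
have -> : lowest_eigenvalue D G = l.
  apply: xget_unique => // m [em mlow]; apply/eqP; rewrite eq_le.
  by apply/andP; split; [apply: mlow; exact: (proj1 low)|exact: (proj2 low)].
split; first by move=> f tf; apply: lge.
by move=> c h; apply: lglb => f fx fy [tf -> ->]; exact: h.
Qed.

End LowestEigenvalue.

(** * Integrals over circular regions *)
Section PolarRegions.
Local Set Implicit Arguments.
Local Unset Strict Implicit.
Context {R : realType}.
Local Notation mR := (measurableTypeR R).
Local Notation plane := (mR * mR)%type.
Local Notation leb := (@lebesgue_measure R).
Local Notation leb2 := (leb \x leb)%E.

Lemma integral_shift (c : R) (G : R -> \bar R) :
  measurable_fun setT G -> (forall x, 0 <= G x)%E ->
  (\int[leb]_x G x = \int[leb]_t G (c + t)%R)%E.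
Proof.
move=> mG G0.
rewrite (@ge0_integral_change_of_variables R setT (fun t => c + t) (fun=> 1) G)//.
- by apply: eq_integral => t _; rewrite mule1.
- exact: measurable_funD.
- move=> a b ab.
  transitivity (\int[leb]_t (\1_(`](a - c), (b - c)]%classic : set R) t)%:E)%E.
    apply: eq_integral => t _; rewrite mul1r; congr (_%:E).
    rewrite !indicE; congr ((nat_of_bool _)%:R); apply/idP/idP; rewrite !inE/= !in_itv/=.
      by rewrite ltrBlDl lerBrDl.
    by rewrite ltrBlDl lerBrDl.
  rewrite integral_indic ?setIT//.
  apply: (etrans (lebesgue_measure_itv `](a - c), (b - c)])) => /=; rewrite lte_fin.
  case: ltP => [_|ba]; first by rewrite -EFinB; congr EFin; ring.
  by congr EFin; apply/eqP; rewrite eq_sym subr_eq0 eq_le ab -(lerD2r (- c)) ba.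
Qed.

Lemma measurable_comp2 d (T : measurableType d) (F : R * R -> \bar R) (f g : T -> R) :
  measurable_fun (setT : set plane) F ->
  measurable_fun setT f -> measurable_fun setT g ->
  measurable_fun setT (fun z => F (f z, g z)).
Proof.
move=> mF mf mg; apply: (measurableT_comp mF).
exact: (@measurable_fun_pair _ _ _ T mR mR f g).
Qed.

Lemma integral_polar_at (c : R) (F : R * R -> \bar R) :
  measurable_fun (setT : set plane) F -> (forall p, 0 <= F p)%E ->
  (\int[leb2]_(p in [set p | (0 < p.1)%R]) F p =
   \int[leb]_(t in `](- (pi / 2))%R, (pi / 2)%R[)
     \int[leb]_(r in `]0%R, +oo[) (F (r * cos t, c + r * sin t)%R * r%:E))%E.
Proof.
move=> mF F0.
have mfst2 : measurable_fun (setT : set plane) (fun z : plane => z.1 : R) by exact: measurable_fst.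
have msnd2 : measurable_fun (setT : set plane) (fun z : plane => z.2 : R) by exact: measurable_snd.
have mF' : measurable_fun (setT : set plane) (fun z : plane => F (z.1, c + z.2)).
  by apply: measurable_comp2 => //; exact: measurable_funD.
have mH : measurable ([set p | 0 < p.1] : set plane).
  rewrite (_ : [set p | _] = (`]0, +oo[%classic : set mR) `*` setT); first exact: measurableX.
  by apply/seteqP; split => [p|p]; rewrite /= in_itv/= ?andbT//; case.
rewrite -(integral_polar mF') //.
rewrite [LHS]integral_mkcond [RHS]integral_mkcond.
rewrite fubini_tonelli1; last 2 first.
- by apply/(measurable_restrict _ mH) => //; exact: measurable_funTS.
- by move=> p; rewrite patchE; case: ifP.
rewrite [RHS]fubini_tonelli1; last 2 first.
- by apply/(measurable_restrict _ mH) => //; exact: measurable_funTS.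
- by move=> p; rewrite patchE; case: ifP.
apply: eq_integral => x _; rewrite /fubini_F.
have [x0|x0] := ltP 0 x; last first.
  rewrite !integral0_eq// => y _; rewrite patchE memNset//=; by rewrite ltNge x0.
transitivity (\int[leb]_y F (x, y))%E.
  by apply: eq_integral => y _; rewrite patchE mem_set.
rewrite (@integral_shift c (fun y => F (x, y)))//; last exact: measurable_comp2.
by apply: eq_integral => y _; rewrite patchE mem_set.
Qed.

(** [E] is a region that polar coordinates centred at [(0, c)] turn into a rectangle. *)
Lemma integral_polar_on (E : set (R * R)) (al be rho c : R) (F : R * R -> \bar R) :
  measurable (E : set plane) -> (forall p, E p -> 0 < p.1) ->
  - (pi / 2) <= al -> be <= pi / 2 ->
  (forall t r, - (pi / 2) < t < pi / 2 -> 0 < r ->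
     E (r * cos t, c + r * sin t) <-> al < t < be /\ r < rho) ->
  measurable_fun (setT : set plane) F -> (forall p, 0 <= F p)%E ->
  (\int[leb2]_(p in E) F p =
   \int[leb]_(t in `]al, be[)
     \int[leb]_(r in `]0%R, rho[) (F (r * cos t, c + r * sin t)%R * r%:E))%E.
Proof.
move=> mE E0 al0 be0 EE mF F0.
have -> : (\int[leb2]_(p in E) F p = \int[leb2]_(p in [set p | (0 < p.1)%R]) (F \_ E) p)%E.
  rewrite -integral_mkcondr; congr integral.
  by apply/seteqP; split => p; [move=> Ep; split => //; exact: E0|case].
rewrite (@integral_polar_at c); last 2 first.
- by apply/(measurable_restrict _ mE) => //; exact: measurable_funTS.
- by move=> p; rewrite patchE; case: ifP.
rewrite [LHS]integral_mkcond [RHS]integral_mkcond; apply: eq_integral => t _.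
rewrite !patchE; case: ifPn => [tI|tI]; case: ifPn => tJ.
- move: tI tJ; rewrite !inE/= !in_itv/= => tI tJ.
  rewrite integral_mkcond [RHS]integral_mkcond; apply: eq_integral => r _.
  rewrite !patchE; case: ifPn => [rI|rI].
  + move: rI; rewrite inE/= in_itv/= andbT => r0.
    have -> : ((r * cos t, c + r * sin t) \in E) = (r \in `]0, rho[%classic).
      apply/idP/idP; rewrite !inE/= in_itv/= r0/=; first by move=> /(EE _ _ tI r0)[].
      by move=> rr; exact/EE.
    by case: ifP => _; rewrite ?mul0e.
  + rewrite memNset// /= in_itv/= => /andP[r0 _].
    by move: rI; rewrite notin_setE/= in_itv/= r0.
- move: tI tJ; rewrite notin_setE inE/= !in_itv/= => tI tJ.
  rewrite integral0_eq// => r; rewrite /= in_itv/= andbT => r0.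
  by rewrite patchE memNset ?mul0e// => /(EE _ _ tI r0)[].
- exfalso; move: tI tJ; rewrite notin_setE inE/= !in_itv/= => tI /andP[t1 t2].
  by apply: tI; rewrite (le_lt_trans al0)//= (lt_le_trans t2).
- by [].
Qed.

Lemma ge0_integral_swap (I J : set R) (H : R -> R -> \bar R) :
  measurable I -> measurable J ->
  measurable_fun (setT : set plane) (fun z => H z.1 z.2) ->
  (forall x y, I x -> J y -> 0 <= H x y)%E ->
  (\int[leb]_(x in I) \int[leb]_(y in J) H x y =
   \int[leb]_(y in J) \int[leb]_(x in I) H x y)%E.
Proof.
move=> mI mJ mH H0.
pose K (z : R * R) := ((fun z => H z.1 z.2) \_ (I `*` J)) z.
have mIJ : measurable (I `*` J : set plane) by exact: measurableX.
have mK : measurable_fun (setT : set plane) K.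
  by apply/(measurable_restrict _ mIJ) => //; exact: measurable_funTS.
have K0 z : (0 <= K z)%E.
  by rewrite /K patchE; case: ifPn => // /[!inE] -[/= Ix Jy]; exact: H0.
transitivity (\int[leb]_x \int[leb]_y K (x, y))%E.
  rewrite [LHS]integral_mkcond; apply: eq_integral => x _; rewrite patchE; case: ifPn => xI.
    rewrite integral_mkcond; apply: eq_integral => y _; rewrite /K !patchE.
    by rewrite (_ : (_ \in I `*` J) = (y \in J))//; apply/idP/idP; rewrite !inE/=;
      [case|move=> ?; split => //; exact: set_mem].
  rewrite integral0_eq// => y _; rewrite /K patchE memNset//= => -[Ix _].
  by move: xI; rewrite notin_setE.
transitivity (\int[leb]_y \int[leb]_x K (x, y))%E.
  exact: (@fubini_tonelli _ _ _ _ _ leb leb K mK K0).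
rewrite [RHS]integral_mkcond; apply: eq_integral => y _; rewrite patchE; case: ifPn => yJ.
  rewrite [RHS]integral_mkcond; apply: eq_integral => x _; rewrite /K !patchE.
  by rewrite (_ : (_ \in I `*` J) = (x \in I))//; apply/idP/idP; rewrite !inE/=;
      [case|move=> ?; split => //; exact: set_mem].
rewrite integral0_eq// => x _; rewrite /K patchE memNset//= => -[_ Jy].
by move: yJ; rewrite notin_setE.
Qed.

Lemma measurable_integral_r (I J : set R) (H : R -> R -> \bar R) :
  measurable I -> measurable J ->
  measurable_fun (setT : set plane) (fun z => H z.1 z.2) ->
  (forall x y, I x -> J y -> 0 <= H x y)%E ->
  measurable_fun I (fun x => \int[leb]_(y in J) H x y)%E.
Proof.
move=> mI mJ mH H0.
pose K (z : R * R) := ((fun z => H z.1 z.2) \_ (I `*` J)) z.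
have mIJ : measurable (I `*` J : set plane) by exact: measurableX.
have mK : measurable_fun (setT : set plane) K.
  by apply/(measurable_restrict _ mIJ) => //; exact: measurable_funTS.
have K0 z : (0 <= K z)%E.
  by rewrite /K patchE; case: ifPn => // /[!inE] -[/= Ix Jy]; exact: H0.
have := @measurable_fun_fubini_tonelli_F _ _ _ _ _ leb K mK K0.
move/(measurable_funTS (D := I)); apply: eq_measurable_fun => x xI.
rewrite /fubini_F [RHS]integral_mkcond; apply: eq_integral => y _; rewrite /K !patchE.
rewrite (_ : (_ \in I `*` J) = (y \in J))//; apply/idP/idP; rewrite !inE/=.
  by case.
by move=> ?; split => //; exact: set_mem.
Qed.

End PolarRegions.

(** * The quarter disc, with and without crack *)
Section QuarterDisc.
Local Set Implicit Arguments.
Local Unset Strict Implicit.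
Context {R : realType}.
Local Notation mR := (measurableTypeR R).
Local Notation plane := (mR * mR)%type.
Local Notation leb := (@lebesgue_measure R).
Local Notation leb2 := (leb \x leb)%E.

Definition quarter_disc (R2 : R) : set (R * R) :=
  [set p | [/\ 0 < p.1, 0 < p.2 & p.1 ^+ 2 + p.2 ^+ 2 < R2 ^+ 2]].

Lemma open_gt0 (f : R * R -> R) : continuous f -> open [set p | 0 < f p].
Proof.
move=> cf; rewrite (_ : [set p | _] = f @^-1` `]0, +oo[%classic).
  by move/continuousP: cf; apply; exact: interval_open.
by apply/seteqP; split => p /=; rewrite in_itv/= andbT.
Qed.

Lemma continuous_sqnorm (c : R) : continuous (fun p : R * R => p.1 ^+ 2 + (p.2 - c) ^+ 2).
Proof.
move=> p; apply: cvgD; apply: cvgM; try exact: continuous_fst2.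
  by apply: cvgB; [exact: continuous_snd2|exact: cvg_cst].
by apply: cvgB; [exact: continuous_snd2|exact: cvg_cst].
Qed.

Lemma open_quarter_disc (R2 : R) : open (quarter_disc R2).
Proof.
rewrite (_ : quarter_disc R2 = [set p | 0 < p.1] `&` ([set p | 0 < p.2] `&`
    [set p | 0 < R2 ^+ 2 - (p.1 ^+ 2 + (p.2 - 0) ^+ 2)])).
  apply: openI; first exact/open_gt0/continuous_fst2.
  apply: openI; first exact/open_gt0/continuous_snd2.
  apply: open_gt0 => p; apply: cvgB; [exact: cvg_cst|exact: continuous_sqnorm].
apply/seteqP; split => p /=; first by move=> [? ? ?]; rewrite subr0 subr_gt0.
by move=> [? [?]]; rewrite subr0 subr_gt0.
Qed.

Lemma measurable_quarter_disc (R2 : R) : measurable (quarter_disc R2 : set plane).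
Proof. by apply: measurable_open2; exact: open_quarter_disc. Qed.

Lemma polar_sqnorm (r t : R) : (r * cos t) ^+ 2 + (r * sin t) ^+ 2 = r ^+ 2.
Proof. by rewrite !exprMn -mulrDr cos2Dsin2 mulr1. Qed.

Lemma integral_quarter_disc (R2 : R) (F : R * R -> \bar R) : 0 < R2 ->
  measurable_fun (setT : set plane) F -> (forall p, 0 <= F p)%E ->
  (\int[leb2]_(p in quarter_disc R2) F p =
   \int[leb]_(t in `]0%R, (pi / 2)%R[)
     \int[leb]_(r in `]0%R, R2[) (F (polar r t) * r%:E))%E.
Proof.
move=> R20 mF F0; have pi0 := pi_gt0 R.
transitivity (\int[leb]_(t in `]0%R, (pi / 2)%R[)
     \int[leb]_(r in `]0%R, R2[) (F (r * cos t, 0 + r * sin t)%R * r%:E))%E; last first.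
  by apply: eq_integral => t _; apply: eq_integral => r _; rewrite add0r.
apply: (integral_polar_on _ _ _ _ _ mF F0).
- exact: measurable_quarter_disc.
- by move=> p [].
- by rewrite oppr_le0 divr_ge0// ltW.
- exact: lexx.
- move=> t r tI r0; have c0 := cos_gt0_pihalf tI.
  have pipi : pi / 2 < pi :> R by rewrite ltr_pdivrMr// ltr_pMr// ltr1n.
  rewrite add0r /quarter_disc/= polar_sqnorm; split.
    move=> [_ h rR]; split; last first.
      by move: rR; rewrite ltr_pXn2r ?nnegrE ?ltW.
    case/andP: tI => tI1 tI2; rewrite tI2 andbT ltNge; apply/negP => t0.
    move: h; rewrite ltNge => /negP; apply; rewrite pmulr_rle0//.
    rewrite -oppr_ge0 -sinN sin_ge0_pi// oppr_ge0 t0/=.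
    by rewrite lerNl (le_trans _ (ltW tI1))// lerN2 ltW.
  move=> [/andP[t0 t1] rR]; split; first by rewrite mulr_gt0.
    by rewrite mulr_gt0// sin_gt0_pi// t0 (lt_trans t1).
  by rewrite ltr_pXn2r ?nnegrE// ltW.
Qed.

Definition half_disc (c rho : R) : set (R * R) :=
  [set p | 0 < p.1 /\ p.1 ^+ 2 + (p.2 - c) ^+ 2 < rho ^+ 2].

Lemma measurable_half_disc (c rho : R) : measurable (half_disc c rho : set plane).
Proof.
apply: measurable_open2; rewrite (_ : half_disc c rho = [set p | 0 < p.1] `&`
    [set p | 0 < rho ^+ 2 - (p.1 ^+ 2 + (p.2 - c) ^+ 2)]).
  apply: openI; first exact/open_gt0/continuous_fst2.
  apply: open_gt0 => p; apply: cvgB; [exact: cvg_cst|exact: continuous_sqnorm].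
by apply/seteqP; split => p /= [p0]; rewrite subr_gt0.
Qed.

Lemma integral_half_disc (c rho : R) (F : R * R -> \bar R) : 0 < rho ->
  measurable_fun (setT : set plane) F -> (forall p, 0 <= F p)%E ->
  (\int[leb2]_(p in half_disc c rho) F p =
   \int[leb]_(t in `](- (pi / 2))%R, (pi / 2)%R[)
     \int[leb]_(r in `]0%R, rho[) (F (r * cos t, c + r * sin t)%R * r%:E))%E.
Proof.
move=> rho0 mF F0.
apply: (integral_polar_on _ _ _ _ _ mF F0).
- exact: measurable_half_disc.
- by move=> p [].
- exact: lexx.
- exact: lexx.
- move=> t r tI r0; have c0 := cos_gt0_pihalf tI.
  have -> : half_disc c rho (r * cos t, c + r * sin t) <-> r < rho.
    rewrite /half_disc/= [c + _]addrC addrK polar_sqnorm; split.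
      by move=> [_]; rewrite ltr_pXn2r ?nnegrE ?ltW.
    by move=> rr; split; [rewrite mulr_gt0|rewrite ltr_pXn2r ?nnegrE ?ltW].
  by split => [|[]//]; split.
Qed.

Lemma quarter_disc_polar (R2 r t : R) : 0 < r < R2 -> 0 < t < pi / 2 ->
  quarter_disc R2 (polar r t).
Proof.
move=> /andP[r0 rR] /andP[t0 t1]; have pi0 := pi_gt0 R.
have pipi : pi / 2 < pi :> R by rewrite ltr_pdivrMr// ltr_pMr// ltr1n.
rewrite /quarter_disc/= polar_sqnorm; split.
- by rewrite mulr_gt0// cos_gt0_pihalf// t1 andbT (lt_trans _ t0)// oppr_lt0 divr_gt0.
- by rewrite mulr_gt0// sin_gt0_pi// t0 (lt_trans t1).
- by rewrite ltr_pXn2r ?nnegrE ?ltW// (lt_trans r0).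
Qed.

(** Adding to the crack its end point on the axis, which is outside the quarter disc,
    makes it compact, hence the cracked domain open. *)
Lemma cracked_quarter_discE (R1 R2 eps : R) : 0 < R1 -> R1 < R2 ->
  cracked_quarter_disc R1 R2 eps =
  quarter_disc R2 `\` [set polar R1 t | t in `[eps, pi / 2]].
Proof.
move=> R10 R12; have R20 := lt_trans R10 R12; have pi0 := pi_gt0 R.
have pipi : pi / 2 < pi :> R by rewrite ltr_pdivrMr// ltr_pMr// ltr1n.
have E : [set polar r t | r in [set r | 0 < r < R2] & t in [set t | 0 < t < pi / 2]] =
    quarter_disc R2.
  apply/seteqP; split => [p [r /andP[r0 rR] [t /andP[t0 t1] <-]]|[x y] [/= x0 y0 xyR]].
    by apply: quarter_disc_polar; [rewrite r0|rewrite t0].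
  pose r := Num.sqrt (x ^+ 2 + y ^+ 2).
  have xy0 : 0 < x ^+ 2 + y ^+ 2 by rewrite addr_gt0 ?exprn_gt0.
  have r0 : 0 < r by rewrite sqrtr_gt0.
  have r2 : r ^+ 2 = x ^+ 2 + y ^+ 2 by rewrite sqr_sqrtr// ltW.
  exists r; first by rewrite /= r0/= -(ltr_pXn2r (_ : 0 < 2)%N) ?nnegrE ?ltW// r2.
  pose t := atan (y / x).
  have t0 : 0 < t by rewrite -(atan0 R) lt_atan// divr_gt0.
  have t1 : t < pi / 2 by exact: atan_ltpi2.
  have c0 : 0 < cos t by rewrite cos_gt0_pihalf// t1 andbT (lt_trans _ t0)// oppr_lt0 divr_gt0.
  have st : sin t = y / x * cos t.
    by rewrite -[y / x](atanK (y / x)) -/t /tan divfK// gt_eqF.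
  have cr : r * cos t = x.
    apply: (@pexpIrn _ 2) => //; rewrite ?nnegrE ?mulr_ge0 ?ltW//.
    have := cos2Dsin2 t; rewrite st !exprMn r2 => h.
    have : (cos t ^+ 2 + (y ^+ 2 * x^-1 ^+ 2) * cos t ^+ 2) * x ^+ 2 = 1 * x ^+ 2 by rewrite h.
    by rewrite mul1r => E2; rewrite -[RHS]E2; field; rewrite gt_eqF.
  exists t; first by rewrite /= t0.
  by rewrite /polar cr st mulrCA cr divfK// gt_eqF.
rewrite /cracked_quarter_disc E; apply/seteqP; split => p [Qp np]; split => //.
  move=> [t /= tI pt]; apply: np; exists t => //=; move: tI; rewrite in_itv/= => /andP[t0 t1].
  rewrite t0/= lt_neqAle t1 andbT; apply/eqP => tE.
  by case: Qp; rewrite -pt /polar tE cos_pihalf mulr0/= ltxx.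
by move=> [t /andP[t0 t1] pt]; apply: np; exists t => //=; rewrite in_itv/= t0 ltW.
Qed.

Lemma continuous_polar (r : R) : continuous (polar r).
Proof.
move=> t.
have c1 : (fun s => r * cos s) @ t --> r * cos t by apply: cvgMr; exact: continuous_cos.
have c2 : (fun s => r * sin s) @ t --> r * sin t by apply: cvgMr; exact: continuous_sin.
exact: (cvg_pair c1 c2).
Qed.

Lemma measurable_cracked_quarter_disc (R1 R2 eps : R) : 0 < R1 -> R1 < R2 ->
  measurable (cracked_quarter_disc R1 R2 eps : set plane).
Proof.
move=> R10 R12; rewrite cracked_quarter_discE// setDE; apply: measurable_open2.
apply: openI; first exact: open_quarter_disc.
apply: closed_openC; apply: compact_closed; first exact: norm_hausdorff.
apply: continuous_compact; last exact: segment_compact.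
by apply: continuous_subspaceT => t; exact: continuous_polar.
Qed.

(** Each ray meets the crack in at most one point. *)
Lemma integral_cracked_quarter_disc (R1 R2 eps : R) (F : R * R -> \bar R) :
  0 < R1 -> R1 < R2 -> measurable_fun (setT : set plane) F -> (forall p, 0 <= F p)%E ->
  (\int[leb2]_(p in cracked_quarter_disc R1 R2 eps) F p =
   \int[leb2]_(p in quarter_disc R2) F p)%E.
Proof.
move=> R10 R12 mF F0; have R20 := lt_trans R10 R12.
set D := cracked_quarter_disc _ _ _.
have mD : measurable (D : set plane) by exact: measurable_cracked_quarter_disc.
have mQ := measurable_quarter_disc R2.
have DQ : D `<=` quarter_disc R2.
  by rewrite /D cracked_quarter_discE// => p [].
have DQ' p : quarter_disc R2 p -> ~ D p -> p.1 ^+ 2 + p.2 ^+ 2 = R1 ^+ 2.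
  move=> Qp; rewrite /D cracked_quarter_discE// => /not_andP[//|/contrapT[t _ <-]].
  exact: polar_sqnorm.
transitivity (\int[leb2]_(p in quarter_disc R2) (F \_ D) p)%E.
  rewrite -integral_mkcondr; congr integral.
  by apply/seteqP; split => p; [move=> Dp; split => //; exact: DQ|case].
have mFD : measurable_fun (setT : set plane) (F \_ D).
  by apply/(measurable_restrict _ mD) => //; exact: measurable_funTS.
have FD0 p : (0 <= (F \_ D) p)%E by rewrite patchE; case: ifP.
rewrite (integral_quarter_disc R20 mFD FD0) (integral_quarter_disc R20 mF F0).
apply: eq_integral => t; rewrite inE/= in_itv/= => tI.
have mr (H : R * R -> \bar R) : measurable_fun (setT : set plane) H ->
    measurable_fun ((`]0%R, R2[%classic : set R) `\ R1) (fun r => H (polar r t) * r%:E)%E.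
  move=> mH; apply: measurable_funTS; apply: emeasurable_funM; last exact/measurable_EFinP.
  by apply: measurable_comp2 => //; exact: mulrr_measurable.
have mJ : measurable ((`]0%R, R2[%classic : set R) `\ R1) by exact: measurableD.
rewrite -[LHS](integral_setD1 mJ (mr _ mFD)) -[RHS](integral_setD1 mJ (mr _ mF)).
apply: eq_integral => r; rewrite inE/= in_itv/= => -[rJ rR1].
rewrite patchE mem_set//; apply: contrapT => nD; apply: rR1.
have := DQ' _ (quarter_disc_polar rJ tI) nD; rewrite polar_sqnorm => r2.
apply: (@pexpIrn _ 2) => //; rewrite nnegrE; last exact: ltW.
by case/andP: rJ => /ltW.
Qed.

End QuarterDisc.

(** * The ground state of the quarter disc and the energy identity *)
Section GroundState.
Local Set Implicit Arguments.
Local Unset Strict Implicit.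
Context {R : realType}.
Local Notation mR := (measurableTypeR R).
Local Notation plane := (mR * mR)%type.
Local Notation leb := (@lebesgue_measure R).
Local Notation leb2 := (leb \x leb)%E.
Variables (R2 : R) (R20 : 0 < R2).

(** [gs] is [J_0 (j01 * r / R2)], the ground state of the quarter disc without
    crack; its eigenvalue is [4 * gs_scale]. *)
Definition gs_scale : R := bes_zero / R2 ^+ 2.
Local Notation a := gs_scale.
Definition gs (p : R * R) : R := bes (a * (p.1 * p.1 + p.2 * p.2)).
Definition gsx (p : R * R) : R := bes' (a * (p.1 * p.1 + p.2 * p.2)) * (2 * a * p.1).
Definition gsy (p : R * R) : R := bes' (a * (p.1 * p.1 + p.2 * p.2)) * (2 * a * p.2).
Definition gsr (r : R) : R := bes (a * r ^+ 2).
Definition gsr' (r : R) : R := bes' (a * r ^+ 2) * (2 * a * r).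

Lemma gs_scale_gt0 : 0 < a.
Proof. by rewrite divr_gt0 ?bes_zero_gt0// exprn_gt0. Qed.

Lemma has_gradient_gs : has_gradient gs gsx gsy.
Proof.
have h := has_gradientZ a (has_gradientD (has_gradientM has_gradient_fst has_gradient_fst)
  (has_gradientM has_gradient_snd has_gradient_snd)).
have := has_gradient_comp is_derive_bes (@continuous_bes' R) h.
congr has_gradient; apply/funext => p; rewrite /gsx /gsy; congr (_ * _); ring.
Qed.

Lemma gs_polar r t : gs (polar r t) = gsr r.
Proof. by rewrite /gs /gsr /polar/= -!expr2 polar_sqnorm. Qed.

Lemma gsx_polar r t : gsx (polar r t) = gsr' r * cos t.
Proof. by rewrite /gsx /gsr' /polar/= -!expr2 polar_sqnorm; ring. Qed.

Lemma gsy_polar r t : gsy (polar r t) = gsr' r * sin t.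
Proof. by rewrite /gsy /gsr' /polar/= -!expr2 polar_sqnorm; ring. Qed.

Lemma scale_bound r : 0 <= r <= R2 -> 0 <= a * r ^+ 2 <= bes_zero.
Proof.
move=> /andP[r0 rR]; have a0 := gs_scale_gt0.
rewrite mulr_ge0 ?sqr_ge0 ?(ltW a0)//= /a mulrAC ler_pdivrMr ?exprn_gt0//.
by rewrite ler_pM2l ?bes_zero_gt0// ler_pXn2r ?nnegrE// ltW.
Qed.

Lemma scale_lt r s : 0 <= r -> r < s -> a * r ^+ 2 < a * s ^+ 2.
Proof.
move=> r0 rs; rewrite ltr_pM2l ?gs_scale_gt0// ltr_pXn2r ?nnegrE//.
exact: le_trans r0 (ltW rs).
Qed.

Lemma scale_R2 : a * R2 ^+ 2 = bes_zero.
Proof. by rewrite /a divfK// expf_neq0// gt_eqF. Qed.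

Lemma gsr_gt0 r : 0 <= r < R2 -> 0 < gsr r.
Proof.
move=> /andP[r0 rR]; apply: bes_gt0; rewrite -scale_R2 scale_lt// andbT.
have : 0 <= r <= R2 by rewrite r0 ltW.
by move=> /scale_bound/andP[].
Qed.

Lemma gsr_le1 r : 0 <= r <= R2 -> gsr r <= 1.
Proof. by move=> h; apply: bes_le1; exact: scale_bound. Qed.

Lemma gsr_decr r s : 0 <= r -> r <= s -> s <= R2 -> gsr s <= gsr r.
Proof.
move=> r0; rewrite le_eqVlt => /predU1P[->//|rs] sR; apply: ltW; apply: bes_decr.
- have : 0 <= r <= R2 by rewrite r0 (le_trans (ltW rs)).
  by move=> /scale_bound/andP[].
- exact: scale_lt.
- have : 0 <= s <= R2 by rewrite sR (le_trans r0)// ltW.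
  by move=> /scale_bound/andP[].
Qed.

Let is_derive_scale (r : R) : is_derive r (1 : R) (fun r : R => a * r ^+ 2) (2 * a * r).
Proof. by apply: is_derive_eq; rewrite /GRing.scale/=; ring. Qed.

Lemma is_derive_gsr (r : R) : is_derive r (1 : R) gsr (gsr' r).
Proof. exact: (is_derive1_comp (is_derive_bes _) (is_derive_scale r)). Qed.

(** The radial form [(r * w')' = - 4 * gs_scale * r * w] of the eigenvalue equation. *)
Lemma is_derive_rgsr' (r : R) :
  is_derive r (1 : R) (fun r => r * gsr' r) (- (4 * a * r * gsr r)).
Proof.
have d := is_derive1_comp (is_derive_bes' _) (is_derive_scale r).
have -> : - (4 * a * r * gsr r) =
    r *: (bes' (a * r ^+ 2) *: (2 * a) + (2 * a * r) *: (bes'' (a * r ^+ 2) * (2 * a * r))) +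
    (bes' (a * r ^+ 2) * (2 * a * r)) *: 1.
  rewrite /GRing.scale/= /gsr -[bes _]opprK -bes_ode; ring.
have d1 : is_derive r (1 : R) (fun r : R => 2 * a * r) (2 * a).
  by apply: is_derive_eq; rewrite /GRing.scale/=; ring.
by apply: is_deriveM; apply: is_deriveM.
Qed.

Lemma continuous_gsr : continuous gsr.
Proof.
move=> r; apply: differentiable_continuous; apply/derivable1_diffP.
exact: (@ex_derive _ _ _ _ _ _ _ (is_derive_gsr r)).
Qed.

Lemma continuous_gsr' : continuous gsr'.
Proof.
move=> r; apply: cvgM; last by apply: cvgMr; exact: cvg_id.
apply: (@continuous_comp _ _ _ (fun r : R => a * r ^+ 2) bes').
  by apply: cvgMr; apply: cvgM; exact: cvg_id.
exact: continuous_bes'.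
Qed.

Section Quotient.
Variables (f fx fy : R * R -> R) (hf : has_gradient f fx fy).

(** [(defx, defy)] is [gs] times the gradient of [f / gs]. *)
Definition defx (p : R * R) : R := fx p - f p * gsx p / gs p.
Definition defy (p : R * R) : R := fy p - f p * gsy p / gs p.
Definition defect (p : R * R) : R := defx p ^+ 2 + defy p ^+ 2.

Lemma defect_ge0 p : 0 <= defect p.
Proof. by rewrite addr_ge0 ?sqr_ge0. Qed.

Lemma measurable_defx : measurable_fun (setT : set plane) defx.
Proof.
have [_ _ _ cfx _] := hf; have [_ _ _ cgx _] := has_gradient_gs.
apply: measurable_funB; first exact: measurable_continuous2.
apply: measurable_funM.
  apply: measurable_funM; apply: measurable_continuous2 => //.
  exact: has_gradient_continuous hf.
apply: (measurableT_comp measurable_invr); apply: measurable_continuous2.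
exact: has_gradient_continuous has_gradient_gs.
Qed.

Lemma measurable_defy : measurable_fun (setT : set plane) defy.
Proof.
have [_ _ _ _ cfy] := hf; have [_ _ _ _ cgy] := has_gradient_gs.
apply: measurable_funB; first exact: measurable_continuous2.
apply: measurable_funM.
  apply: measurable_funM; apply: measurable_continuous2 => //.
  exact: has_gradient_continuous hf.
apply: (measurableT_comp measurable_invr); apply: measurable_continuous2.
exact: has_gradient_continuous has_gradient_gs.
Qed.

Lemma measurable_defect : measurable_fun (setT : set plane) (fun p => (defect p)%:E).
Proof.
apply/measurable_EFinP; apply: measurable_funD; apply: measurable_funX.
  exact: measurable_defx.
exact: measurable_defy.
Qed.

Lemma defect_polar r t : defect (polar r t) =
  (fx (polar r t) * cos t + fy (polar r t) * sin t - f (polar r t) * gsr' r / gsr r) ^+ 2 +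
  (fy (polar r t) * cos t - fx (polar r t) * sin t) ^+ 2.
Proof.
rewrite /defect /defx /defy gsx_polar gsy_polar gs_polar.
set A := fx _; set B := fy _; set C := f _.
have E x : C * (gsr' r * x) / gsr r = C * gsr' r / gsr r * x by rewrite mulrA mulrAC.
rewrite !E; have := cos2Dsin2 t; set c := cos t; set s := sin t; set q := _ / _ => h.
apply/eqP; rewrite -subr_eq0.
rewrite (_ : _ - _ = (1 - (c ^+ 2 + s ^+ 2)) * (A ^+ 2 + B ^+ 2 - q ^+ 2)); last by ring.
by rewrite h subrr mul0r.
Qed.

Lemma gradient_polar r t : fx (polar r t) ^+ 2 + fy (polar r t) ^+ 2 =
  (fx (polar r t) * cos t + fy (polar r t) * sin t) ^+ 2 +
  (fy (polar r t) * cos t - fx (polar r t) * sin t) ^+ 2.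
Proof.
set A := fx _; set B := fy _; have := cos2Dsin2 t; set c := cos t; set s := sin t => h.
apply/eqP; rewrite -subr_eq0.
rewrite (_ : _ - _ = (1 - (c ^+ 2 + s ^+ 2)) * (A ^+ 2 + B ^+ 2)); last by ring.
by rewrite h subrr mul0r.
Qed.

Lemma is_derive_ray t r : is_derive r (1 : R) (fun r => f (polar r t))
  (fx (polar r t) * cos t + fy (polar r t) * sin t).
Proof.
have d1 : is_derive r (1 : R) (fun r => r * cos t) (cos t).
  by apply: is_derive_eq; rewrite /GRing.scale/=; ring.
have d2 : is_derive r (1 : R) (fun r => r * sin t) (sin t).
  by apply: is_derive_eq; rewrite /GRing.scale/=; ring.
exact: (is_derive_curve hf d1 d2).
Qed.

Lemma continuous_ray (g : R * R -> R) t : continuous g -> continuous (fun r => g (polar r t)).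
Proof.
move=> cg r; apply: (@continuous_comp _ _ _ (fun r => polar r t) g); last exact: cg.
have c1 : (fun s : R => s * cos t) @ r --> r * cos t by apply: cvgMl; exact: cvg_id.
have c2 : (fun s : R => s * sin t) @ r --> r * sin t by apply: cvgMl; exact: cvg_id.
exact: (cvg_pair c1 c2).
Qed.

(** [gsr] vanishes at [R2], so that quotients by it are handled for [r <= b] only. *)
Lemma zero_near_arc t : (\forall q \near polar R2 t, f q = 0) ->
  exists2 b, 0 < b < R2 & forall r, b <= r <= R2 ->
    [/\ f (polar r t) = 0, fx (polar r t) = 0 & fy (polar r t) = 0].
Proof.
move=> f0; have /nbhs_ballP[e /= e0 fe] := nbhs_interior f0.
exists (Num.max (R2 / 2) (R2 - e / 2)).
  rewrite lt_max divr_gt0//= gt_max ltr_pdivrMr// ltr_pMr// ltr1n/=.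
  by rewrite gtrBl divr_gt0.
move=> r /andP[]; rewrite ge_max => /andP[r1 r2] rR.
have rr : `|R2 - r| < e.
  rewrite ger0_norm ?subr_ge0// ltrBlDr -ltrBlDl (lt_le_trans _ r2)//.
  by rewrite ltrD2l ltrN2 gtr_pMr// invf_lt1// ltr1n.
have := fe (polar r t) _ => /(_ _) h.
have {}h : \forall q \near polar r t, f q = 0.
  apply: h; split; rewrite /ball/= -mulrBl normrM.
    by rewrite (le_lt_trans _ rr)// ler_piMr// ler_norml cos_le1 cos_geN1.
  by rewrite (le_lt_trans _ rr)// ler_piMr// ler_norml sin_le1 sin_geN1.
by have [gx gy] := has_gradient_near0 hf h; split => //; exact: (nbhs_singleton h).
Qed.

Lemma integrable_continuous (h : R -> R) (b c : R) :
  (forall x, b <= x <= c -> {for x, continuous h}) ->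
  leb.-integrable `[b, c] (EFin \o h).
Proof.
move=> ch; apply: continuous_compact_integrable; first exact: segment_compact.
by apply: continuous_in_subspaceT => x; rewrite inE/= in_itv/=; exact: ch.
Qed.

(** On each ray, [r * w' * f ^ 2 / w] is an antiderivative of
    [(|grad f| ^ 2 - 4 * gs_scale * f ^ 2 - defect) * r]. *)
Lemma ray_identity t : (\forall q \near polar R2 t, f q = 0) ->
  (\int[leb]_(r in `]0%R, R2[) ((fx (polar r t) ^+ 2 + fy (polar r t) ^+ 2) * r)%:E =
   \int[leb]_(r in `]0%R, R2[) ((4 * a * f (polar r t) ^+ 2 + defect (polar r t)) * r)%:E)%E.
Proof.
move=> /zero_near_arc[b /andP[b0 bR] fb].
have [_ _ _ cfx cfy] := hf; have cf := has_gradient_continuous hf.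
have cX : continuous (fun r => fx (polar r t)) by exact: continuous_ray.
have cY : continuous (fun r => fy (polar r t)) by exact: continuous_ray.
have cF : continuous (fun r => f (polar r t)) by exact: continuous_ray.
pose A r := (fx (polar r t) ^+ 2 + fy (polar r t) ^+ 2) * r.
pose B r := (4 * a * f (polar r t) ^+ 2 + defect (polar r t)) * r.
have w0 r : 0 <= r <= b -> 0 < gsr r.
  by move=> /andP[r0 rb]; apply: gsr_gt0; rewrite r0 (le_lt_trans rb).
have cA : continuous A.
  by move=> r; apply: cvgM; [apply: cvgD; apply: cvgM; (exact: cX || exact: cY)|exact: cvg_id].
have cB r : 0 <= r <= b -> {for r, continuous B}.
  move=> rb.
  have c1 : {for r, continuous (fun r => fx (polar r t) * cos t + fy (polar r t) * sin t - f (polar r t) * gsr' r / gsr r)}.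
    apply: cvgB; first by apply: cvgD; apply: cvgMl; [exact: cX|exact: cY].
    apply: cvgM; first by apply: cvgM; [exact: cF|exact: continuous_gsr'].
    by apply: cvgV; [rewrite gt_eqF// w0|exact: continuous_gsr].
  have c2 : {for r, continuous (fun r => fy (polar r t) * cos t - fx (polar r t) * sin t)}.
    by apply: cvgB; apply: cvgMl; [exact: cY|exact: cX].
  have cD : {for r, continuous (fun r => defect (polar r t))}.
    rewrite (_ : (fun r => defect (polar r t)) = (fun r =>
      (fx (polar r t) * cos t + fy (polar r t) * sin t - f (polar r t) * gsr' r / gsr r) ^+ 2 +
      (fy (polar r t) * cos t - fx (polar r t) * sin t) ^+ 2)); last first.
      by apply/funext => s; exact: defect_polar.
    by apply: cvgD; apply: cvgM.
  apply: cvgM; last exact: cvg_id.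
  apply: cvgD; last exact: cD.
  by apply: cvgMr; apply: cvgM; exact: cF.
pose h r := r * gsr' r * f (polar r t) ^+ 2 / gsr r.
have dh r : 0 <= r <= b -> is_derive r (1 : R) h (A r - B r).
  move=> rb; have wn0 : gsr r != 0 by rewrite gt_eqF// w0.
  have dw := is_derive_gsr r; have dk := is_derive_rgsr' r; have df := is_derive_ray t r.
  have dwV := @is_deriveV R gsr r (gsr' r) 1 wn0 dw.
  have d2 := is_deriveM df df.
  have d3 := is_deriveM (is_deriveM dk d2) dwV.
  have -> : h = (fun r => r * gsr' r) * ((fun r => f (polar r t)) * (fun r => f (polar r t))) * (fun r => (gsr r)^-1).
    by apply/funext => s.
  have ME (u v : R -> R) s : (u * v) s = u s * v s by [].
  apply: is_derive_eq; rewrite /A /B gradient_polar defect_polar /GRing.scale/= !ME.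
  by field.
have b01 : 0 <= b by exact: ltW.
have IAB : (\int[leb]_(r in `[0%R, b]) (A r - B r)%:E = 0)%E.
  have -> : (0 = (h b - h 0)%:E)%E.
    have bb : b <= b <= R2 by rewrite lexx ltW.
    have [fb0 _ _] := fb b bb.
    rewrite /h fb0; congr (_%:E); rewrite !mul0r expr0n/= mulr0 mul0r subrr.
    by [].
  apply: integral_derivative => // r rb.
  by apply: cvgB; [exact: cA|exact: cB].
have iA : leb.-integrable `[0%R, b] (EFin \o A) by apply: integrable_continuous => r _; exact: cA.
have iB : leb.-integrable `[0%R, b] (EFin \o B) by exact: integrable_continuous.
have iAB : leb.-integrable `[0%R, b] (EFin \o (fun r => A r - B r)).
  by apply: integrable_continuous => r rb; apply: cvgB; [exact: cA|exact: cB].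
have AB1 : (\int[leb]_(r in `[0%R, b]) (A r)%:E = \int[leb]_(r in `[0%R, b]) (B r)%:E)%E.
  transitivity (\int[leb]_(r in `[0%R, b]) ((A r - B r)%:E + (B r)%:E))%E.
    by apply: eq_integral => r _; rewrite -EFinD subrK.
  by rewrite integralD// IAB add0e.
have AB2 : (\int[leb]_(r in `]b, R2[) (A r)%:E = \int[leb]_(r in `]b, R2[) (B r)%:E)%E.
  apply: eq_integral => r; rewrite inE/= in_itv/= => /andP[br rR].
  have br' : b <= r <= R2 by rewrite !ltW.
  have [fr fxr fyr] := fb r br'; rewrite /A /B defect_polar fr ?fxr ?fyr ?ltW//.
  by rewrite !mul0r expr0n/= !subr0 !addr0 mulr0 expr0n/= !addr0.
have mA : measurable_fun setT (fun r => (A r)%:E).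
  by apply/measurable_EFinP; exact: continuous_measurable_fun.
have mB : measurable_fun setT (fun r => (B r)%:E).
  apply/measurable_EFinP; apply: measurable_funM => //; apply: measurable_funD.
    by apply: continuous_measurable_fun => r; apply: cvgMr; apply: cvgM; exact: cF.
  apply/measurable_EFinP; apply: (measurable_comp2 measurable_defect); exact: mulrr_measurable.
have split (H : R -> R) : measurable_fun setT (fun r => (H r)%:E) ->
    (forall r, 0 < r -> 0 <= H r) ->
    (\int[leb]_(r in `]0%R, R2[) (H r)%:E =
     \int[leb]_(r in `[0%R, b]) (H r)%:E + \int[leb]_(r in `]b, R2[) (H r)%:E)%E.
  move=> mH H0; rewrite -(integral_itv_obnd_cbnd (b := BRight b)); last exact: measurable_funTS.
  have E : `]0, b]%classic `|` `]b, R2[%classic = `]0, R2[%classic :> set R.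
    by rewrite -itv_bndbnd_setU// bnd_simp ltW.
  rewrite -E ge0_integral_setU//.
  - exact: measurable_funTS.
  - move=> r; rewrite E/= in_itv/= => /andP[r0 _]; rewrite lee_fin; exact: H0.
  - apply/disj_setPS => r [/=]; rewrite !in_itv/= => /andP[_ rb] /andP[br _].
    by move: br; rewrite ltNge rb.
rewrite (split A mA) ?(split B mB) ?AB1 ?AB2// => r r0.
  by rewrite /B mulr_ge0 ?(ltW r0)// addr_ge0 ?defect_ge0// mulr_ge0 ?sqr_ge0// mulr_ge0// ltW// gs_scale_gt0.
by rewrite /A mulr_ge0 ?(ltW r0)// addr_ge0 ?sqr_ge0.
Qed.

Lemma energy_identity :
  (forall t, 0 < t < pi / 2 -> \forall q \near polar R2 t, f q = 0) ->
  (\int[leb2]_(p in quarter_disc R2) (fx p ^+ 2 + fy p ^+ 2)%:E =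
   (4 * a)%:E * \int[leb2]_(p in quarter_disc R2) (f p ^+ 2)%:E +
   \int[leb2]_(p in quarter_disc R2) (defect p)%:E)%E.
Proof.
move=> f0; have [_ _ _ cfx cfy] := hf; have cf := has_gradient_continuous hf.
have a0 := gs_scale_gt0.
have mQ := measurable_quarter_disc R2.
have mE : measurable_fun (setT : set plane) (fun p => (fx p ^+ 2 + fy p ^+ 2)%:E).
  apply/measurable_EFinP; apply: measurable_continuous2 => p.
  by apply: cvgD; apply: cvgM; (exact: cfx || exact: cfy).
have mf2 : measurable_fun (setT : set plane) (fun p => (f p ^+ 2)%:E).
  by apply/measurable_EFinP; apply: measurable_continuous2 => p; apply: cvgM; exact: cf.
have md := measurable_defect.
have m4 : measurable_fun (setT : set plane) (fun p => (4 * a * f p ^+ 2)%:E).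
  by apply/measurable_EFinP; apply: measurable_continuous2 => p; apply: cvgMr; apply: cvgM; exact: cf.
have mS : measurable_fun (setT : set plane) (fun p => (4 * a * f p ^+ 2 + defect p)%:E).
  by apply/measurable_EFinP; apply: measurable_funD; apply/measurable_EFinP.
have p40 p : 0 <= 4 * a * f p ^+ 2 by rewrite mulr_ge0 ?sqr_ge0// mulr_ge0// ltW.
transitivity (\int[leb2]_(p in quarter_disc R2) (4 * a * f p ^+ 2 + defect p)%:E)%E.
  have E0 p : (0 <= (fx p ^+ 2 + fy p ^+ 2)%:E)%E by rewrite lee_fin addr_ge0 ?sqr_ge0.
  have S0 p : (0 <= (4 * a * f p ^+ 2 + defect p)%:E)%E by rewrite lee_fin addr_ge0 ?defect_ge0.
  rewrite (integral_quarter_disc R20 mE E0) (integral_quarter_disc R20 mS S0).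
  apply: eq_integral => t; rewrite inE/= in_itv/= => tI.
  under eq_integral do rewrite -EFinM.
  under [RHS]eq_integral do rewrite -EFinM.
  by apply: ray_identity; exact: f0.
under eq_integral do rewrite EFinD.
rewrite ge0_integralD//; last 4 first.
- by move=> p _; rewrite lee_fin.
- exact: measurable_funTS.
- by move=> p _; rewrite lee_fin defect_ge0.
- exact: measurable_funTS.
congr (_ + _)%E; under eq_integral do rewrite EFinM.
rewrite ge0_integralZl//; last 3 first.
- exact: measurable_funTS.
- by move=> p _; rewrite lee_fin sqr_ge0.
- by rewrite lee_fin mulr_ge0// ltW.
Qed.

End Quotient.
End GroundState.

(** * A weighted Poincare inequality *)
Section Gap.
Local Set Implicit Arguments.
Local Unset Strict Implicit.
Context {R : realType}.
Local Notation mR := (measurableTypeR R).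
Local Notation plane := (mR * mR)%type.
Local Notation leb := (@lebesgue_measure R).
Local Notation leb2 := (leb \x leb)%E.

Lemma exists_le_average (a b E : R) (h : R -> \bar R) : a < b ->
  measurable_fun (`]a, b[ : set mR) h ->
  (forall x, (a < x < b)%R -> 0 <= h x)%E ->
  (\int[leb]_(x in `]a, b[) h x < E%:E)%E ->
  exists2 x, a < x < b & (h x <= (E / (b - a))%:E)%E.
Proof.
move=> ab mh h0 hE; apply: contrapT => H.
have ba0 : 0 < b - a by rewrite subr_gt0.
have E0 : 0 <= E.
  rewrite -lee_fin; apply/ltW/(le_lt_trans _ hE); apply: integral_ge0 => x /=.
  by rewrite in_itv/=; exact: h0.
have : (\int[leb]_(x in `]a, b[) (E / (b - a))%:E <= \int[leb]_(x in `]a, b[) h x)%E.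
  apply: ge0_le_integral => //.
  - by move=> x _; rewrite lee_fin divr_ge0// ltW.
  - move=> x /=; rewrite in_itv/= => xab; rewrite leNgt; apply/negP => hx; apply: H.
    by exists x => //; exact: ltW.
rewrite integral_cst// => h1.
have h2 := le_lt_trans h1 hE.
have : (((E / (b - a))%:E * leb `]a, b[%classic) = E%:E)%E.
  transitivity ((E / (b - a))%:E * (b - a)%:E)%E; last by rewrite -EFinM divfK// gt_eqF.
  by congr (_ * _)%E; apply: (etrans (lebesgue_measure_itv `]a, b[)); rewrite /= lte_fin ab.
by move=> h3; move: h2; rewrite h3 ltxx.
Qed.

Variables (R2 : R) (R20 : 0 < R2).
Local Notation a := (gs_scale R2).
Local Notation gs := (gs R2).
Local Notation gsr := (gsr R2).

Section Curve.
Variables (f fx fy : R * R -> R) (hf : has_gradient f fx fy).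
Local Notation defx := (defx R2 f fx).
Local Notation defy := (defy R2 f fy).
Local Notation defect := (defect R2 f fx fy).
Local Notation P p := (f p / gs p).

Lemma is_derive_quotient (c1 c2 : R -> R) (c1' c2' t : R) : gs (c1 t, c2 t) != 0 ->
  is_derive t (1 : R) c1 c1' -> is_derive t (1 : R) c2 c2' ->
  is_derive t (1 : R) (fun t => P (c1 t, c2 t))
    ((defx (c1 t, c2 t) * c1' + defy (c1 t, c2 t) * c2') / gs (c1 t, c2 t)).
Proof.
move=> g0 d1 d2; have df := is_derive_curve hf d1 d2.
have dg := is_derive_curve (has_gradient_gs R2) d1 d2.
have dgV := @is_deriveV R (fun t => gs (c1 t, c2 t)) t _ 1 g0 dg.
have ME (u v : R -> R) s : (u * v) s = u s * v s by [].
have -> : (fun t => P (c1 t, c2 t)) =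
    (fun t => f (c1 t, c2 t)) * (fun t => (gs (c1 t, c2 t))^-1) by [].
have := is_deriveM df dgV => dd.
apply: is_derive_eq; rewrite /defx /defy /GRing.scale/=; field.
exact: g0.
Qed.

(** Cauchy-Schwarz along a curve.  The parametrisation weight [w] is free; [k] is the
    density with which the defect is integrated along the curve (a Jacobian, once the
    curve is a circle or a ray), and [K] collects what is left of [gs ^ 2].  The end
    points come in either order. *)
Lemma curve_increment (c1 c2 c1' c2' W w k : R -> R) (I : set R) (K s0 s1 : R) :
  let J := [set s | Num.min s0 s1 <= s <= Num.max s0 s1] in
  measurable (I : set mR) -> J `<=` I -> 0 <= K ->
  measurable_fun setT c1 -> measurable_fun setT c2 -> measurable_fun setT k ->
  (forall s, J s -> 0 < gs (c1 s, c2 s)) ->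
  (forall s, J s -> is_derive s (1 : R) c1 (c1' s)) ->
  (forall s, J s -> is_derive s (1 : R) c2 (c2' s)) ->
  (forall s, J s -> {for s, continuous c1'}) ->
  (forall s, J s -> {for s, continuous c2'}) ->
  (forall s, J s -> is_derive s (1 : R) W (w s)) ->
  (forall s, J s -> {for s, continuous w}) ->
  (forall s, J s -> 0 < w s) ->
  (forall s, I s -> 0 <= k s) ->
  (forall s, J s -> K * (c1' s ^+ 2 + c2' s ^+ 2) <= gs (c1 s, c2 s) ^+ 2 * w s * k s) ->
  ((K * (P (c1 s1, c2 s1) - P (c1 s0, c2 s0)) ^+ 2)%:E <=
   `|W s1 - W s0|%:E * \int[leb]_(s in I) (defect (c1 s, c2 s) * k s)%:E)%E.
Proof.
move=> J mI; rewrite /J => {J}.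
wlog s01 : s0 s1 / s0 <= s1.
  move=> H; case/orP: (le_total s0 s1) => [|h]; first exact: H.
  rewrite minC maxC distrC (_ : (P _ - P _) ^+ 2 = (P (c1 s0, c2 s0) - P (c1 s1, c2 s1)) ^+ 2).
    exact: H.
  by rewrite -sqrrN opprB.
rewrite min_l// max_r//.
set J := [set s | s0 <= s <= s1] => JI K0 mc1 mc2 mk g0 d1 d2 cc1 cc2 dW cw w0 k0 KK.
have RHS0 : (0 <= \int[leb]_(s in I) (defect (c1 s, c2 s) * k s)%:E)%E.
  by apply: integral_ge0 => s Is; rewrite lee_fin mulr_ge0 ?k0// defect_ge0.
move: s01; rewrite le_eqVlt => /predU1P[<-|s01].
  by rewrite subrr expr0n/= mulr0 mule_ge0.
have [_ _ _ cfx cfy] := hf; have cf := has_gradient_continuous hf.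
have hg := has_gradient_gs R2; have [_ _ _ cgx cgy] := hg; have cg := has_gradient_continuous hg.
pose p' s := (defx (c1 s, c2 s) * c1' s + defy (c1 s, c2 s) * c2' s) / gs (c1 s, c2 s).
have dP s : s0 <= s <= s1 -> is_derive s (1 : R) (fun s => P (c1 s, c2 s)) (p' s).
  by move=> Js; apply: is_derive_quotient; [rewrite gt_eqF// g0|exact: d1|exact: d2].
have cF (F : R * R -> R) s : J s -> continuous F -> {for s, continuous (fun s => F (c1 s, c2 s))}.
  move=> Js CF; apply: (@continuous_comp _ _ _ (fun s => (c1 s, c2 s)) F); last exact: CF.
  have e1 : {for s, continuous c1}.
    by apply: differentiable_continuous; apply/derivable1_diffP; have [] := d1 s Js.
  have e2 : {for s, continuous c2}.
    by apply: differentiable_continuous; apply/derivable1_diffP; have [] := d2 s Js.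
  exact: (cvg_pair e1 e2).
have cV s : J s -> {for s, continuous (fun s => (gs (c1 s, c2 s))^-1)}.
  by move=> Js; apply: cvgV; [rewrite gt_eqF// g0|exact: (cF gs)].
have cp' s : s0 <= s <= s1 -> {for s, continuous p'}.
  move=> Js; apply: cvgM; last exact: cV.
  apply: cvgD; (apply: cvgM; last by [exact: cc1|exact: cc2]).
    apply: cvgB; first exact: cF.
    by apply: cvgM; [apply: cvgM; exact: cF|exact: cV].
  apply: cvgB; first exact: cF.
  by apply: cvgM; [apply: cvgM; exact: cF|exact: cV].
have Wlt : W s0 < W s1.
  have dWs s : s \in `]s0, s1[ -> is_derive s (1 : R) W (w s).
    by rewrite in_itv/= => /andP[u1 u2]; apply: dW; rewrite /J/= !ltW.
  have cW : {within `[s0, s1], continuous W}.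
    apply: continuous_in_subspaceT => s; rewrite inE/= in_itv/= => Js.
    by apply: differentiable_continuous; apply/derivable1_diffP; have [] := dW s Js.
  have [s] := MVT s01 dWs cW; rewrite in_itv/= => /andP[u1 u2] h.
  rewrite -subr_gt0 h mulr_gt0 ?subr_gt0//; apply: w0.
  by rewrite /J/= !ltW.
have H := sqr_increment_le (ltW s01) Wlt dP dW cp' cw w0.
have mS : measurable (`[s0, s1]%classic : set mR) by [].
have md : measurable_fun setT (fun s => (defect (c1 s, c2 s) * k s)%:E).
  apply/measurable_EFinP; apply: measurable_funM => //; apply/measurable_EFinP.
  exact: measurable_comp2 (measurable_defect R2 hf) mc1 mc2.
have Ip : leb.-integrable `[s0, s1] (EFin \o (fun s => p' s ^+ 2 / w s)).
  apply: integrable_continuous => s Js; apply: cvgM.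
    by apply: cvgM; exact: cp'.
  by apply: cvgV; [rewrite gt_eqF// w0|exact: cw].
rewrite (ger0_norm (ltW (_ : 0 < W s1 - W s0))) ?subr_gt0//.
rewrite EFinM.
apply: (@le_trans _ _ (K%:E * ((W s1 - W s0)%:E * \int[leb]_(x in `[s0, s1]) (p' x ^+ 2 / w x)%:E))%E).
  by apply: lee_wpmul2l; rewrite ?lee_fin.
rewrite muleCA; apply: lee_wpmul2l; first by rewrite lee_fin subr_ge0 ltW.
rewrite -ge0_integralZl//; last 2 first.
- exact: measurable_int Ip.
- by move=> s /=; rewrite in_itv/= => Js; rewrite lee_fin divr_ge0 ?sqr_ge0// ltW// w0.
apply: (@le_trans _ _ (\int[leb]_(s in `[s0, s1]) (defect (c1 s, c2 s) * k s)%:E)%E); last first.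
  apply: ge0_subset_integral => //.
  - exact: measurable_funTS.
  - by move=> s Is; rewrite lee_fin mulr_ge0 ?k0// defect_ge0.
apply: ge0_le_integral => //.
- move=> s /=; rewrite in_itv/= => Js; rewrite -EFinM lee_fin mulr_ge0//.
  by rewrite divr_ge0 ?sqr_ge0// ltW// w0.
- by apply: emeasurable_funM => //; exact: measurable_int Ip.
- exact: measurable_funTS.
move=> s /=; rewrite in_itv/= => Js; rewrite -EFinM lee_fin.
have gn := g0 s Js; have wn := w0 s Js; have := KK s Js.
rewrite /p' /defect; set g := gs _; set X := defx _; set Y := defy _.
set u := c1' s; set v := c2' s => h.
have -> : K * (((X * u + Y * v) / g) ^+ 2 / w s) = K * (X * u + Y * v) ^+ 2 / (g ^+ 2 * w s).
  by field; rewrite !gt_eqF.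
rewrite ler_pdivrMr ?mulr_gt0 ?exprn_gt0//.
apply: (@le_trans _ _ ((X ^+ 2 + Y ^+ 2) * (K * (u ^+ 2 + v ^+ 2)))).
  rewrite [leRHS]mulrCA ler_wpM2l// -subr_ge0 (_ : _ - _ = (X * v - Y * u) ^+ 2) ?sqr_ge0//.
  by ring.
rewrite -mulrA ler_wpM2l ?addr_ge0 ?sqr_ge0//.
by rewrite [leRHS]mulrC.
Qed.
End Curve.

Lemma measurable_weight d (T : measurableType d) (F : R * R -> R) (x y w : T -> R) :
  measurable_fun (setT : set plane) (fun p => (F p)%:E) ->
  measurable_fun setT x -> measurable_fun setT y -> measurable_fun setT w ->
  measurable_fun setT (fun z => (F (x z, y z) * w z)%:E).
Proof.
move=> mF mx my mw; apply/measurable_EFinP; apply: measurable_funM => //.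
by apply/measurable_EFinP; exact: (measurable_comp2 mF).
Qed.

Lemma measurable_polar_weight d (T : measurableType d) (F : R * R -> R) (r t : T -> R) :
  measurable_fun (setT : set plane) (fun p => (F p)%:E) ->
  measurable_fun setT r -> measurable_fun setT t ->
  measurable_fun setT (fun z => (F (polar (r z) (t z)) * r z)%:E).
Proof.
move=> mF mr mt.
have mc : measurable_fun setT (fun z : T => cos (t z)).
  exact: (measurableT_comp (@measurable_cos R)).
have ms : measurable_fun setT (fun z : T => sin (t z)).
  exact: (measurableT_comp (@measurable_sin R)).
by apply: measurable_weight => //; exact: measurable_funM.
Qed.

Lemma integral_quarter_disc_real (F : R * R -> R) :
  measurable_fun (setT : set plane) (fun p => (F p)%:E) -> (forall p, 0 <= F p) ->
  (\int[leb2]_(p in quarter_disc R2) (F p)%:E =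
   \int[leb]_(t in `]0%R, (pi / 2)%R[)
     \int[leb]_(r in `]0%R, R2[) (F (polar r t) * r)%:E)%E.
Proof.
move=> mF F0; by rewrite (integral_quarter_disc R20 mF).
Qed.

(** On some circle of radius [r1] the defect is at most its average, so that [f / gs]
    is close to a constant [T] on it; radial increments then compare [f / gs] with [T]
    everywhere.  The degeneracy of [gs] at the outer arc is harmless because [gs]
    decreases along rays: the weight of the end point is at most the weight along the
    way. *)
Lemma gap : exists2 C : R, 0 < C & forall f fx fy, has_gradient f fx fy ->
  forall E : R, (\int[leb2]_(p in quarter_disc R2) (defect R2 f fx fy p)%:E < E%:E)%E ->
  exists T : R, (\int[leb2]_(p in quarter_disc R2) ((f p - T * gs p) ^+ 2)%:E <= (C * E)%:E)%E.
Proof.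
have pi0 := pi_gt0 R.
pose w1 := gsr (R2 / 2).
have w10 : 0 < w1 by apply: gsr_gt0 => //; rewrite divr_ge0 ?ltW//= ltr_pdivrMr// ltr_pMr// ltr1n.
(* In [Kc], [4] serves the radii above [r1], which exceeds [R2 / 4], and [w1 ^- 2] those
   below, where [gsr] is at least [w1]. *)
pose Kc := 4 + (w1 ^+ 2)^-1.
have Kc0 : 0 < Kc by rewrite addr_gt0// invr_gt0 exprn_gt0.
pose C := 2 * Kc * R2 ^+ 2 + 2 * pi ^+ 2 * R2 ^+ 2 / w1 ^+ 2.
have C0 : 0 < C.
  by rewrite addr_gt0 ?mulr_gt0 ?invr_gt0 ?exprn_gt0.
exists C => // f fx fy hf E hE.
set def := defect R2 f fx fy in hE.
have md : measurable_fun (setT : set plane) (fun p => (def p)%:E) by exact: measurable_defect.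
have d0 p : 0 <= def p by exact: defect_ge0.
rewrite (integral_quarter_disc_real md d0) in hE.
have m1 : measurable_fun (setT : set plane) (fun z : plane => z.1 : R) by exact: measurable_fst.
have m2 : measurable_fun (setT : set plane) (fun z : plane => z.2 : R) by exact: measurable_snd.
have mH := measurable_polar_weight md m2 m1; have mH' := measurable_polar_weight md m1 m2.
pose A t := (\int[leb]_(r in `]0%R, R2[) (def (polar r t) * r)%:E)%E.
pose B r := (\int[leb]_(t in `]0%R, (pi / 2)%R[) (def (polar r t) * r)%:E)%E.
have H0 r t : 0 < r -> (0 <= (def (polar r t) * r)%:E)%E.
  by move=> r0; rewrite lee_fin mulr_ge0// ltW.
have mB : measurable_fun (`]0%R, R2[ : set mR) B.
  apply: (@measurable_integral_r _ `]0, R2[%classic `]0, (pi / 2)[%classic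
    (fun r t => (def (polar r t) * r)%:E)) => //.
  by move=> r t /=; rewrite in_itv/= => /andP[r0 _] _; exact: H0.
have hB : (\int[leb]_(r in `]0%R, R2[) B r < E%:E)%E.
  apply: le_lt_trans hE; rewrite le_eqVlt; apply/orP; left; apply/eqP.
  symmetry; apply: (@ge0_integral_swap _ `]0, (pi / 2)[%classic `]0, R2[%classic
    (fun t r => (def (polar r t) * r)%:E)) => //.
  by move=> t r _ /=; rewrite in_itv/= => /andP[r0 _]; exact: H0.
have Bge0 r : 0 < r -> (0 <= B r)%E by move=> r0; apply: integral_ge0 => t _; exact: H0.
have R42 : R2 / 4 < R2 / 2 by rewrite ltr_pM2l// ltf_pV2 ?posrE// ltr_nat.
have [r1 r1I hr1] : exists2 x, R2 / 4 < x < R2 / 2 & (B x <= (E / (R2 / 2 - R2 / 4))%:E)%E.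
  have sI : `]R2 / 4, R2 / 2[%classic `<=` (`]0, R2[%classic : set mR).
    move=> x /=; rewrite !in_itv/= => /andP[x1 x2]; rewrite (lt_trans _ x1) ?divr_gt0//=.
    by rewrite (lt_trans x2)// ltr_pdivrMr// ltr_pMr// ltr1n.
  apply: (@exists_le_average _ _ E B R42).
  - by apply: measurable_funS mB.
  - by move=> x /andP[x1 _]; apply: Bge0; rewrite (lt_trans _ x1)// divr_gt0.
  apply: le_lt_trans hB; apply: ge0_subset_integral => //.
  by move=> x /=; rewrite in_itv/= => /andP[x0 _]; exact: Bge0.
have {}R42 : R2 / 2 - R2 / 4 = R2 / 4 by field.
rewrite {}R42 in hr1.
have [r1l r1r] := andP r1I.
have r10 : 0 < r1 by rewrite (lt_trans _ r1l)// divr_gt0.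
have r1R : r1 < R2 by rewrite (lt_trans r1r)// ltr_pdivrMr// ltr_pMr// ltr1n.
have E0 : 0 < E.
  rewrite -lte_fin; apply: le_lt_trans hB; apply: integral_ge0 => r /=.
  by rewrite in_itv/= => /andP[r0 _]; exact: Bge0.
pose P p := f p / gs p.
exists (P (polar r1 (pi / 4))).
set T := P _.
have ang t : 0 < t < pi / 2 -> w1 ^+ 2 * (P (polar r1 t) - T) ^+ 2 <= 2 * pi * E.
  move=> tI.
  have p4I : 0 < (pi : R) / 4 < pi / 2.
    by rewrite divr_gt0//= ltr_pM2l// ltf_pV2 ?posrE// ltr_nat.
  have gsE s : gs (r1 * cos s, r1 * sin s) = gsr r1 by exact: gs_polar.
  have g1 : w1 <= gsr r1 by apply: (gsr_decr R20); rewrite ?ltW// ltr_pdivrMr// ltr_pMr// ltr1n.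
  have := @curve_increment _ _ _ hf (fun s => r1 * cos s) (fun s => r1 * sin s)
    (fun s => - (r1 * sin s)) (fun s => r1 * cos s) (fun s => s) (fun=> 1) (fun=> R2 * r1)
    `]0, (pi / 2)[%classic (w1 ^+ 2) (pi / 4) t => /=.
  have cS : continuous (fun s : R => r1 * sin s) by move=> s; apply: cvgMr; exact: continuous_sin.
  have cC : continuous (fun s : R => r1 * cos s) by move=> s; apply: cvgMr; exact: continuous_cos.
  have H1 : (`|t - pi / 4|%:E * \int[leb]_(s in `]0%R, (pi / 2)%R[)
      (def (polar r1 s) * (R2 * r1))%:E <= (2 * pi * E)%:E)%E.
    have -> : (\int[leb]_(s in `]0%R, (pi / 2)%R[) (def (polar r1 s) * (R2 * r1))%:E =
        R2%:E * B r1)%E.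
      rewrite /B -ge0_integralZl//; last 3 first.
      - by apply: measurable_funTS; apply: (measurable_polar_weight md) => //; exact: measurable_cst.
      - by move=> s _; exact: H0.
      - by rewrite lee_fin ltW.
      by apply: eq_integral => s _; rewrite -EFinM; congr EFin; ring.
    apply: (@le_trans _ _ ((pi / 2)%:E * (R2%:E * (E / (R2 / 4))%:E))%E).
      apply: lee_pmul; rewrite ?lee_fin//.
      - by apply: mule_ge0; [rewrite lee_fin ltW|exact: Bge0].
      - by move: tI p4I => /andP[? ?] /andP[? ?]; rewrite ler_norml; lra.
      - by apply: lee_wpmul2l => //; rewrite lee_fin ltW.
    rewrite -!EFinM lee_fin le_eqVlt; apply/orP; left; apply/eqP; field.
    by rewrite gt_eqF.
  move=> H; rewrite -lee_fin; apply: le_trans H1; apply: H => //.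
  - move=> s /= /andP[s1 s2]; rewrite in_itv/=; apply/andP; split.
      by apply: lt_le_trans s1; rewrite lt_min; lra.
    by apply: le_lt_trans s2 _; rewrite gt_max; lra.
  - exact: sqr_ge0.
  - by apply: continuous_measurable_fun.
  - by apply: continuous_measurable_fun.
  - by move=> s _; rewrite gsE gsr_gt0// ltW.
  - by move=> s _; apply: is_derive_eq; rewrite /GRing.scale/=; ring.
  - by move=> s _; apply: cvgN; exact: cS.
  - by move=> s _; exact: cC.
  - by move=> s _; exact: cvg_cst.
  - by move=> s _; rewrite mulr_ge0// ltW.
  - move=> s _; rewrite gsE mulr1 sqrrN addrC polar_sqnorm ler_pM ?sqr_ge0//.
      by rewrite ler_pXn2r ?nnegrE ?(ltW w10) ?(ltW (lt_le_trans w10 g1)).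
    by rewrite expr2 ler_pM2r// ltW.
have rad r t : 0 < r < R2 -> 0 < t < pi / 2 ->
    ((gsr r ^+ 2 * r * (P (polar r t) - P (polar r1 t)) ^+ 2)%:E <= (Kc * R2)%:E * A t)%E.
  move=> rI tI; have [r0 rR] := andP rI.
  have gsE s : gs (s * cos t, s * sin t) = gsr s by exact: gs_polar.
  have sI s : Num.min r1 r <= s <= Num.max r1 r -> 0 < s < R2.
    move=> /andP[s1 s2]; apply/andP; split.
      by apply: lt_le_trans s1; rewrite lt_min r10.
    by apply: le_lt_trans s2 _; rewrite gt_max r1R.
  have := @curve_increment _ _ _ hf (fun s => s * cos t) (fun s => s * sin t)
    (fun=> cos t) (fun=> sin t) (fun s => s) (fun=> 1) (fun s => Kc * s)
    `]0, R2[%classic (gsr r ^+ 2 * r) r1 r => /=.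
  have H1 : (`|r - r1|%:E * \int[leb]_(s in `]0%R, R2[)
      (def (polar s t) * (Kc * s))%:E <= (Kc * R2)%:E * A t)%E.
    have -> : (\int[leb]_(s in `]0%R, R2[) (def (polar s t) * (Kc * s))%:E =
        Kc%:E * A t)%E.
      rewrite /A -ge0_integralZl//; last 3 first.
      - by apply: measurable_funTS; apply: (measurable_polar_weight md) => //; exact: measurable_cst.
      - by move=> s /=; rewrite in_itv/= => /andP[s0 _]; exact: H0.
      - by rewrite lee_fin ltW.
      by apply: eq_integral => s _; rewrite -EFinM; congr EFin; ring.
    rewrite [(Kc * R2)%R]mulrC [in leRHS]EFinM -muleA; apply: lee_wpmul2r.
      rewrite mule_ge0 ?lee_fin ?(ltW Kc0)//; apply: integral_ge0 => s /=.
      by rewrite in_itv/= => /andP[s0 _]; exact: H0.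
    by rewrite lee_fin ler_norml; lra.
  move=> H; apply: le_trans H1; apply: H => //.
  - by rewrite mulr_ge0 ?sqr_ge0// ltW.
  - exact: mulrr_measurable.
  - exact: mulrr_measurable.
  - exact: mulrl_measurable.
  - by move=> s /sI/andP[s0 sR]; rewrite gsE gsr_gt0// sR ltW.
  - by move=> s _; apply: is_derive_eq; rewrite /GRing.scale/=; ring.
  - by move=> s _; apply: is_derive_eq; rewrite /GRing.scale/=; ring.
  - by move=> s _; exact: cvg_cst.
  - by move=> s _; exact: cvg_cst.
  - by move=> s _; exact: cvg_cst.
  - by move=> s /=; rewrite in_itv/= => /andP[s0 _]; rewrite mulr_ge0// ltW.
  - move=> s Js; have [s0 sR] := andP (sI s Js).
    have gr0 : 0 < gsr r by apply: (gsr_gt0 R20); rewrite rR ltW.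
    have gs0 : 0 < gsr s by apply: (gsr_gt0 R20); rewrite sR ltW.
    rewrite gsE cos2Dsin2 !mulr1 mulrCA [leRHS]mulrCA.
    case/orP: (le_total r r1) => rr; move: Js; rewrite ?(min_r rr) ?(max_l rr) ?(min_l rr) ?(max_r rr) => /andP[s1 s2].
      have w1s : w1 ^+ 2 <= gsr s ^+ 2.
        rewrite ler_pXn2r ?nnegrE ?(ltW w10) ?(ltW gs0)//; apply: (gsr_decr R20); rewrite ?(ltW s0)//.
          by rewrite (le_trans s2)// ltW.
        by rewrite ltW// ltr_pdivrMr// ltr_pMr// ltr1n.
      have gr1 : gsr r ^+ 2 <= 1.
        by apply: exprn_ile1; [exact: ltW|apply: (gsr_le1 R20); rewrite !ltW].
      apply: (@le_trans _ _ (1 * s)); first by rewrite ler_pM ?sqr_ge0// ltW.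
      rewrite mul1r [leRHS]mulrA ler_peMl ?(ltW s0)// /Kc mulrDr.
      apply: (@le_trans _ _ (gsr s ^+ 2 / w1 ^+ 2)); first by rewrite ler_pdivlMr ?exprn_gt0// mul1r.
      by rewrite lerDr mulr_ge0 ?sqr_ge0.
    have gg : gsr r ^+ 2 <= gsr s ^+ 2.
      by rewrite ler_pXn2r ?nnegrE ?(ltW gr0) ?(ltW gs0)//; apply: (gsr_decr R20); rewrite ?s2 ?(ltW s0) ?(ltW rR).
    rewrite ler_pM ?sqr_ge0 ?(ltW r0)// /Kc mulrDl.
    apply: (@le_trans _ _ (4 * s)); first by lra.
    by rewrite lerDl mulr_ge0 ?invr_ge0 ?sqr_ge0 ?(ltW s0).
have pt r t : 0 < r < R2 -> 0 < t < pi / 2 ->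
    ((((f (polar r t) - T * gs (polar r t)) ^+ 2) * r)%:E <=
      (2 * Kc * R2)%:E * A t + (4 * pi * R2 * E / w1 ^+ 2)%:E)%E.
  move=> rI tI; have [r0 rR] := andP rI.
  have gr0 : 0 < gsr r by apply: (gsr_gt0 R20); rewrite rR ltW.
  have gr1 : gsr r ^+ 2 <= 1.
    by apply: exprn_ile1; [exact: ltW|apply: (gsr_le1 R20); rewrite !ltW].
  have om0 : 0 <= gsr r ^+ 2 * r by rewrite mulr_ge0 ?sqr_ge0 ?ltW.
  have om1 : gsr r ^+ 2 * r <= R2.
    by rewrite -[leRHS]mul1r ler_pM ?sqr_ge0 ?(ltW r0) ?(ltW rR).
  have -> : (f (polar r t) - T * gs (polar r t)) ^+ 2 * r =
      gsr r ^+ 2 * r * (P (polar r t) - T) ^+ 2.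
    by rewrite /P gs_polar; field; rewrite gt_eqF.
  apply: (@le_trans _ _ ((2 * (gsr r ^+ 2 * r * (P (polar r t) - P (polar r1 t)) ^+ 2))%:E +
     (2 * (gsr r ^+ 2 * r * (P (polar r1 t) - T) ^+ 2))%:E)%E).
    rewrite -EFinD lee_fin.
    set x := P (polar r t); set y := P (polar r1 t).
    rewrite -subr_ge0 (_ : _ - _ = gsr r ^+ 2 * r * (x - 2 * y + T) ^+ 2); last by ring.
    by rewrite mulr_ge0 ?sqr_ge0.
  apply: leeD.
    rewrite EFinM (_ : (2 * Kc * R2)%R = 2 * (Kc * R2)); last by ring.
    rewrite [(2 * (Kc * R2))%:E]EFinM -muleA; apply: lee_wpmul2l; last exact: rad.
    by rewrite lee_fin.
  rewrite lee_fin ler_pdivlMr ?exprn_gt0//.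
  have := ang t tI; set q := (_ - _) ^+ 2 => h.
  have q0 : 0 <= q by rewrite sqr_ge0.
  have -> : 2 * (gsr r ^+ 2 * r * q) * w1 ^+ 2 = 2 * (gsr r ^+ 2 * r) * (w1 ^+ 2 * q) by ring.
  have -> : 4 * pi * R2 * E = 2 * R2 * (2 * pi * E) by ring.
  by apply: (ler_pM _ _ _ h); [rewrite mulr_ge0|rewrite mulr_ge0 ?sqr_ge0|rewrite ler_pM2l].
have cf := has_gradient_continuous hf.
have cg := has_gradient_continuous (has_gradient_gs R2).
have mfT : measurable_fun (setT : set plane) (fun p => ((f p - T * gs p) ^+ 2)%:E).
  apply/measurable_EFinP; apply: measurable_continuous2 => p.
  by apply: cvgM; (apply: cvgB; [exact: cf|apply: cvgMr; exact: cg]).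
rewrite (integral_quarter_disc_real mfT); last by move=> p; exact: sqr_ge0.
have A0 t : (0 <= A t)%E.
  by apply: integral_ge0 => r /=; rewrite in_itv/= => /andP[r0 _]; exact: H0.
have mA : measurable_fun (`]0%R, (pi / 2)%R[ : set mR) A.
  apply: (@measurable_integral_r _ `]0, (pi / 2)[%classic `]0, R2[%classic
    (fun t r => (def (polar r t) * r)%:E)) => //.
  by move=> t r _ /=; rewrite in_itv/= => /andP[r0 _]; exact: H0.
have c0 : 0 <= 4 * pi * R2 * E / w1 ^+ 2.
  by rewrite divr_ge0 ?sqr_ge0// !mulr_ge0 ?ltW.
have K0 : 0 <= 2 * Kc * R2 by rewrite !mulr_ge0 ?ltW.
have itvE (b c : R) : b < c -> leb `]b, c[%classic = (c - b)%:E.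
  by move=> bc; apply: (etrans (lebesgue_measure_itv `]b, c[)); rewrite /= lte_fin bc.
have intc (b c : R) k : b < c -> (\int[leb]_(x in `]b, c[) cst k x = k * (c - b)%:E)%E.
  by move=> bc; rewrite integral_cst//; congr (_ * _)%E; exact: itvE.
have mfp := measurable_polar_weight mfT m2 m1.
have mft t : measurable_fun (`]0%R, R2[ : set mR) (fun r => ((f (polar r t) - T * gs (polar r t)) ^+ 2 * r)%:E).
  by apply: measurable_funTS; apply: (measurable_polar_weight mfT) => //; exact: measurable_cst.
apply: (@le_trans _ _ (\int[leb]_(t in `]0%R, (pi / 2)%R[)
    (((2 * Kc * R2)%:E * A t + (4 * pi * R2 * E / w1 ^+ 2)%:E) * R2%:E))%E).
  apply: ge0_le_integral => //.
  - by move=> t _; apply: integral_ge0 => r /=; rewrite in_itv/= => /andP[r0 _]; rewrite lee_fin mulr_ge0 ?sqr_ge0 ?ltW.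
  - apply: (@measurable_integral_r _ `]0, (pi / 2)[%classic `]0, R2[%classic
      (fun t r => ((f (polar r t) - T * gs (polar r t)) ^+ 2 * r)%:E)) => //.
    by move=> t r _ /=; rewrite in_itv/= => /andP[r0 _]; rewrite lee_fin mulr_ge0 ?sqr_ge0 ?ltW.
  - by apply: emeasurable_funM => //; apply: emeasurable_funD => //; exact: emeasurable_funM.
  move=> t /=; rewrite in_itv/= => tI.
  apply: (@le_trans _ _ (\int[leb]_(r in `]0%R, R2[)
     (cst ((2 * Kc * R2)%:E * A t + (4 * pi * R2 * E / w1 ^+ 2)%:E) r))%E).
    apply: ge0_le_integral => //.
    - by move=> r /=; rewrite in_itv/= => /andP[r0 _]; rewrite lee_fin mulr_ge0 ?sqr_ge0 ?ltW.
    - by move=> r /=; rewrite in_itv/= => rI; exact: pt.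
  by rewrite intc// subr0.
rewrite ge0_integralZr//; last 3 first.
- by apply: emeasurable_funD => //; exact: emeasurable_funM.
- by move=> t _; rewrite adde_ge0 ?mule_ge0 ?lee_fin.
- by rewrite lee_fin ltW.
rewrite ge0_integralD//; last 2 first.
- by move=> t _; rewrite mule_ge0 ?lee_fin.
- exact: emeasurable_funM.
rewrite ge0_integralZl// ?lee_fin// intc ?divr_gt0// subr0.
apply: (@le_trans _ _ (((2 * Kc * R2)%:E * E%:E + (4 * pi * R2 * E / w1 ^+ 2)%:E * (pi / 2)%:E) * R2%:E)%E).
  apply: lee_wpmul2r; first by rewrite lee_fin ltW.
  by apply: leeD => //; apply: lee_wpmul2l; [rewrite lee_fin|exact: ltW].
rewrite -EFinM lee_fin /C le_eqVlt; apply/orP; left; apply/eqP; field.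
by rewrite gt_eqF.
Qed.
End Gap.

(** * The logarithmic cost of a small crack *)
Section LowerBound.
Local Set Implicit Arguments.
Local Unset Strict Implicit.
Context {R : realType}.
Local Notation mR := (measurableTypeR R).
Local Notation plane := (mR * mR)%type.
Local Notation leb := (@lebesgue_measure R).
Local Notation leb2 := (leb \x leb)%E.

Lemma sqrD_le (e x y : R) : 0 < e ->
  (x + y) ^+ 2 <= (1 + e) * x ^+ 2 + (1 + e^-1) * y ^+ 2.
Proof.
move=> e0; rewrite -subr_ge0 (_ : _ - _ = (e * x - y) ^+ 2 / e).
  by rewrite divr_ge0 ?sqr_ge0// ltW.
by field; rewrite gt_eqF.
Qed.

Lemma sin_ge_linear (x : R) : 0 <= x <= 1 -> x * cos 1 <= sin x.
Proof.
move=> /andP[]; rewrite le_eqVlt => /predU1P[<-|x0] x1; first by rewrite mul0r sin0.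
have ds (y : R) : y \in `]0, x[ -> is_derive y (1 : R) sin (cos y) by move=> _; exact: is_derive_sin.
have cs : {within `[0, x], continuous (@sin R)} by apply: continuous_subspaceT; exact: continuous_sin.
have [y] := MVT x0 ds cs; rewrite in_itv/= sin0 !subr0 => /andP[y0 yx] ->.
rewrite mulrC ler_pM2r//; have p2 := @pi_ge2 R.
have [->//|y1] := eqVneq y 1.
by apply/ltW; rewrite ltr_cos ?in_itv/= ?lt_neqAle ?y1; lra.
Qed.

Variables (R2 : R) (R20 : 0 < R2).
Local Notation gs := (gs R2).
Local Notation gsr := (gsr R2).

Lemma gsr_le_gs (p : R * R) s : 0 <= s <= R2 -> p.1 ^+ 2 + p.2 ^+ 2 <= s ^+ 2 -> gsr s <= gs p.
Proof.
move=> /andP[s0 sR] ps; set q := p.1 ^+ 2 + p.2 ^+ 2 in ps.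
have q0 : 0 <= q by rewrite addr_ge0 ?sqr_ge0.
have -> : gs p = gsr (Num.sqrt q) by rewrite /gs /gsr sqr_sqrtr// /q !expr2.
apply: (gsr_decr R20); rewrite ?sqrtr_ge0//.
by rewrite -(ger0_norm s0) -sqrtr_sqr ler_wsqrtr.
Qed.

Variables (R1 rho : R) (rho0 : 0 < rho) (rhoR1 : rho < R1) (rhoR2 : R1 + rho < R2).
Local Notation q r t := (r * cos t, R1 + r * sin t).

Lemma half_disc_bound (p : R * R) : half_disc R1 rho p ->
  0 < p.2 /\ p.1 ^+ 2 + p.2 ^+ 2 <= (R1 + rho) ^+ 2.
Proof.
have r0 := rho0; have rR := rhoR1.
case: p => x y [/= x0 xy].
have : (y - R1) ^+ 2 < rho ^+ 2 by apply: le_lt_trans xy; rewrite lerDr sqr_ge0.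
rewrite -[ltRHS]real_normK ?num_real// -[ltLHS]real_normK ?num_real//.
rewrite ltr_pXn2r ?nnegrE// (gtr0_norm rho0) ltr_norml => /andP[h1 h2].
split; first by lra.
have -> : x ^+ 2 + y ^+ 2 = (x ^+ 2 + (y - R1) ^+ 2) + 2 * R1 * (y - R1) + R1 ^+ 2 by ring.
have -> : (R1 + rho) ^+ 2 = rho ^+ 2 + 2 * R1 * rho + R1 ^+ 2 by ring.
rewrite lerD2r; apply: lerD; first exact: ltW.
rewrite ler_wpM2l ?(ltW h2)//; lra.
Qed.

Lemma half_disc_quarter : half_disc R1 rho `<=` quarter_disc R2.
Proof.
move=> p Hp; have [p2 pR] := half_disc_bound Hp; have [p1 _] := Hp; split => //.
apply: (le_lt_trans pR); rewrite ltr_pXn2r ?nnegrE ?(ltW R20)//.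
by rewrite addr_ge0 ?(ltW rho0) ?(ltW (lt_trans rho0 rhoR1)).
Qed.

Let m := gsr (R1 + rho) ^+ 2.

Lemma shifted_polar_sqnorm r t :
  (r * cos t) ^+ 2 + (R1 + r * sin t) ^+ 2 = r ^+ 2 + 2 * R1 * r * sin t + R1 ^+ 2.
Proof.
have := polar_sqnorm r t; set x := r * cos t; set y := r * sin t => h.
by rewrite -h -[2 * R1 * r * _]mulrA -/y; ring.
Qed.

Lemma gs_shifted_polar r t : 0 <= r <= rho -> m <= gs (q r t) ^+ 2 /\ 0 < gs (q r t).
Proof.
move=> /andP[r0 rr].
have g0 : 0 < gsr (R1 + rho) by apply: (gsr_gt0 R20); rewrite rhoR2 andbT addr_ge0 ?(ltW rho0) ?(ltW (lt_trans rho0 rhoR1)).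
have g1 : gsr (R1 + rho) <= gs (q r t).
  apply: gsr_le_gs; first by rewrite (ltW rhoR2) andbT addr_ge0 ?(ltW rho0) ?(ltW (lt_trans rho0 rhoR1)).
  rewrite shifted_polar_sqnorm; have R10 := lt_trans rho0 rhoR1.
  have -> : (R1 + rho) ^+ 2 = rho ^+ 2 + 2 * R1 * rho + R1 ^+ 2 by ring.
  rewrite lerD2r; apply: lerD; first by rewrite ler_pXn2r ?nnegrE ?(ltW rho0).
  apply: (@le_trans _ _ (2 * R1 * r)).
    by rewrite ler_piMr ?sin_le1// !mulr_ge0// ltW.
  by rewrite ler_wpM2l// mulr_ge0// ltW.
split; last exact: lt_le_trans g1.
by rewrite /m ler_pXn2r// nnegrE ltW// (lt_le_trans g0).
Qed.

Lemma integral_half_disc_real (F : R * R -> R) :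
  measurable_fun (setT : set plane) (fun p => (F p)%:E) -> (forall p, 0 <= F p) ->
  (\int[leb2]_(p in half_disc R1 rho) (F p)%:E =
   \int[leb]_(t in `](- (pi / 2))%R, (pi / 2)%R[)
     \int[leb]_(r in `]0%R, rho[) (F (q r t) * r)%:E)%E.
Proof. by move=> mF F0; rewrite (integral_half_disc R1 rho0 mF). Qed.

(** The point of the circle of radius [R1] at distance [r] from [(0, R1)] is seen from
    the origin under the angle [2 * asin (r / (2 * R1))], which is within the crack. *)
Lemma crack_point r d : 0 < r -> r <= R1 * cos 1 * d -> 0 < d <= 1 ->
  exists2 s, pi / 2 - d <= s <= pi / 2 &
   exists2 t, - (pi / 2) < t < pi / 2 & polar R1 s = q r t.
Proof.
move=> r0 rd /andP[d0 d1]; have R10 := lt_trans rho0 rhoR1.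
have p2 := @pi_ge2 R.
have c1 := @cos1_gt0 R.
have sd : d / 2 * cos 1 <= sin (d / 2) by apply: sin_ge_linear; lra.
pose x := r / (2 * R1).
have xE : r = 2 * R1 * x by rewrite /x; field; rewrite gt_eqF.
have x0 : 0 < x by rewrite divr_gt0// mulr_gt0.
have xs : x <= sin (d / 2).
  apply: le_trans sd; rewrite /x ler_pdivrMr ?mulr_gt0//.
  by rewrite (_ : d / 2 * _ * _ = R1 * cos 1 * d)//; field.
have x1 : x <= 1 by apply: le_trans xs _; exact: sin_le1.
have xI : -1 <= x <= 1 by rewrite x1 andbT; lra.
pose s := asin x.
have sx : sin s = x by exact: asinK.
have s1 : s <= d / 2.
  rewrite leNgt; apply/negP => h; move: xs; rewrite -sx leNgt => /negP; apply.
  by rewrite ltr_sin// in_itv/= ?asin_geNpi2 ?asin_lepi2//; lra.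
have s0 : 0 < s.
  rewrite ltNge; apply/negP => h; move: x0; rewrite -sx ltNge => /negP; apply.
  rewrite -oppr_ge0 -sinN sin_ge0_pi// oppr_ge0 h/=.
  have := @asin_geNpi2 _ x xI; rewrite -/s; lra.
exists (pi / 2 - 2 * s); first by apply/andP; split; lra.
exists (- s); first by apply/andP; split; lra.
rewrite /polar cosB sinB cos_pihalf sin_pihalf !mul0r !mul1r add0r subr0 cosN sinN xE -sx.
have := cos2Dsin2 s; rewrite mulrDl !mul1r cosD sinD => h.
congr pair; first by ring.
by apply/eqP; rewrite -subr_eq0 (_ : _ - _ = R1 * (cos s ^+ 2 + sin s ^+ 2 - 1)); [rewrite h subrr mulr0|ring].
Qed.

(** A function that vanishes at the crack point of radius [r0] around [(0, R1)] is
    small on the whole half circle of that radius; its oscillation between that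
    half circle and one of radius about [rho] costs the logarithm of the ratio of
    the radii. *)
Lemma capacity_bound : exists2 C : R, 0 < C & forall d, 0 < d <= 1 -> R1 * d <= rho / 2 ->
  forall f fx fy, has_gradient f fx fy ->
  (forall s, pi / 2 - d <= s <= pi / 2 -> f (polar R1 s) = 0) ->
  forall E M T : R, (\int[leb2]_(p in quarter_disc R2) (defect R2 f fx fy p)%:E < E%:E)%E ->
  (\int[leb2]_(p in quarter_disc R2) ((f p - T * gs p) ^+ 2)%:E < M%:E)%E ->
  forall e, 0 < e <= 1 ->
  pi * m * T ^+ 2 <= (1 + e) * E * `|ln d| + (1 + e^-1) * C * (E + M).
Proof.
have pi0 := pi_gt0 R; have c1 := @cos1_gt0 R; have R10 := lt_trans rho0 rhoR1.
have g0 : 0 < gsr (R1 + rho) by apply: (gsr_gt0 R20); rewrite rhoR2 andbT addr_ge0 ?(ltW rho0) ?(ltW R10).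
have m0 : 0 < m by rewrite exprn_gt0.
pose K := `|ln (2 * rho / (R1 * cos 1))|.
pose C := 2 * K + 4 * pi ^+ 2 + 8 / rho ^+ 2.
have C0 : 0 < C.
  have h1 : 0 < 8 / rho ^+ 2 by rewrite divr_gt0 ?exprn_gt0.
  have h2 : 0 <= K by exact: normr_ge0.
  have h3 : 0 <= pi ^+ 2 :> R by exact: sqr_ge0.
  rewrite /C; lra.
exists C => // d d01 drho f fx fy hf fcrack E M T hE hT e /andP[e0 e1].
have [d0 d1] := andP d01.
set def := defect R2 f fx fy in hE.
have md : measurable_fun (setT : set plane) (fun p => (def p)%:E) by exact: measurable_defect.
have df0 p : 0 <= def p by exact: defect_ge0.
have cf := has_gradient_continuous hf.
have cg := has_gradient_continuous (has_gradient_gs R2).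
pose P p := f p / gs p.
pose dev p := (P p - T) ^+ 2.
have mdev : measurable_fun (setT : set plane) (fun p => (dev p)%:E).
  apply/measurable_EFinP; apply: measurable_funX; apply: measurable_funB => //.
  apply: measurable_funM; first exact: measurable_continuous2.
  by apply: (measurableT_comp measurable_invr); exact: measurable_continuous2.
have dev0 p : 0 <= dev p by exact: sqr_ge0.
have hEh : (\int[leb2]_(p in half_disc R1 rho) (def p)%:E < E%:E)%E.
  apply: le_lt_trans hE; apply: ge0_subset_integral => //.
  - exact: measurable_half_disc.
  - exact: measurable_quarter_disc.
  - exact: measurable_funTS.
  - by move=> p _; rewrite lee_fin.
  - exact: half_disc_quarter.
have mfT : measurable_fun (setT : set plane) (fun p => ((f p - T * gs p) ^+ 2)%:E).
  apply/measurable_EFinP; apply: measurable_continuous2 => p.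
  by apply: cvgM; (apply: cvgB; [exact: cf|apply: cvgMr; exact: cg]).
have gsH p : half_disc R1 rho p -> m <= gs p ^+ 2 /\ 0 < gs p.
  move=> Hp; have g1 : gsr (R1 + rho) <= gs p.
    apply: gsr_le_gs; last by have [] := half_disc_bound Hp.
    by rewrite (ltW rhoR2) andbT addr_ge0 ?(ltW rho0) ?(ltW R10).
  split; last exact: lt_le_trans g1.
  by rewrite /m ler_pXn2r// nnegrE ltW// (lt_le_trans g0).
have hdev : (\int[leb2]_(p in half_disc R1 rho) (dev p)%:E < (M / m)%:E)%E.
  have -> : ((M / m)%:E = (m^-1)%:E * M%:E)%E by rewrite -EFinM mulrC.
  apply: (@le_lt_trans _ _ ((m^-1)%:E * \int[leb2]_(p in half_disc R1 rho) ((f p - T * gs p) ^+ 2)%:E)%E).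
    rewrite -ge0_integralZl//; last 4 first.
    - exact: measurable_half_disc.
    - exact: measurable_funTS.
    - by move=> p _; rewrite lee_fin sqr_ge0.
    - by rewrite lee_fin invr_ge0 ltW.
    apply: ge0_le_integral.
    - exact: measurable_half_disc.
    - by move=> p _; rewrite lee_fin.
    - exact: measurable_funTS.
    - by apply: emeasurable_funM => //; exact: measurable_funTS.
    move=> p /gsH[g1 g2]; rewrite -EFinM lee_fin mulrC ler_pdivlMr//.
    have -> : (f p - T * gs p) ^+ 2 = dev p * gs p ^+ 2.
      by rewrite /dev /P; field; rewrite gt_eqF.
    by rewrite ler_wpM2l.
  rewrite lte_pmul2l ?lte_fin ?invr_gt0//; apply: le_lt_trans hT.
  apply: ge0_subset_integral => //.
  - exact: measurable_half_disc.
  - exact: measurable_quarter_disc.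
  - exact: measurable_funTS.
  - by move=> p _; rewrite lee_fin sqr_ge0.
  - exact: half_disc_quarter.
rewrite (integral_half_disc_real md df0) in hEh.
rewrite (integral_half_disc_real mdev dev0) in hdev.
pose I := `](- (pi / 2)), (pi / 2)[%classic : set R.
pose A t := (\int[leb]_(r in `]0%R, rho[) (def (q r t) * r)%:E)%E.
pose B r := (\int[leb]_(t in I) (def (q r t) * r)%:E)%E.
pose B' r := (\int[leb]_(t in I) (dev (q r t) * r)%:E)%E.
have mq d' (T' : measurableType d') (F : R * R -> R) (r t : T' -> R) :
    measurable_fun (setT : set plane) (fun p => (F p)%:E) ->
    measurable_fun setT r -> measurable_fun setT t ->
    measurable_fun setT (fun z => (F (q (r z) (t z)) * r z)%:E).
  move=> mF mr mt; apply: measurable_weight => //.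
    by apply: measurable_funM => //; exact: (measurableT_comp (@measurable_cos R)).
  apply: measurable_funD => //; apply: measurable_funM => //.
  exact: (measurableT_comp (@measurable_sin R)).
have m1 : measurable_fun (setT : set plane) (fun z : plane => z.1 : R) by exact: measurable_fst.
have m2 : measurable_fun (setT : set plane) (fun z : plane => z.2 : R) by exact: measurable_snd.
have mI : measurable (I : set mR) by exact: measurable_itv.
(* A circle of radius between [b] and [c] on which a nonnegative function has at most average integral. *)
have circle (F : R * R -> R) (b c S : R) : 0 <= b -> b < c -> c <= rho ->
    measurable_fun (setT : set plane) (fun p => (F p)%:E) -> (forall p, 0 <= F p) ->
    (\int[leb]_(t in I) \int[leb]_(r in `]0%R, rho[) (F (q r t) * r)%:E < S%:E)%E ->
    exists2 r, b < r < c & (\int[leb]_(t in I) (F (q r t) * r)%:E <= (S / (c - b))%:E)%E.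
  move=> b0 bc cr mF F0 hM.
  have P0 r t : 0 < r -> (0 <= (F (q r t) * r)%:E)%E.
    by move=> r0; rewrite lee_fin mulr_ge0// ltW.
  have mG : measurable_fun (`]0, rho[%classic : set mR) (fun r => \int[leb]_(t in I) (F (q r t) * r)%:E)%E.
    apply: (@measurable_integral_r _ `]0, rho[%classic I
      (fun r t => (F (q r t) * r)%:E)) => //; first exact: (mq _ _ F _ _ mF m1 m2).
    by move=> r t /=; rewrite in_itv/= => /andP[r0 _] _; exact: P0.
  have sub : `]b, c[%classic `<=` (`]0, rho[%classic : set mR).
    move=> r /=; rewrite !in_itv/= => /andP[h1 h2].
    by rewrite (le_lt_trans b0 h1) (lt_le_trans h2 cr).
  have G0 r : 0 < r -> (0 <= \int[leb]_(t in I) (F (q r t) * r)%:E)%E.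
    by move=> r0; apply: integral_ge0 => t _; exact: P0.
  apply: (@exists_le_average _ _ _ S _ bc).
  - by apply: measurable_funS mG.
  - by move=> r /andP[h1 _]; apply: G0; exact: le_lt_trans h1.
  apply: (@le_lt_trans _ _ (\int[leb]_(r in `]0%R, rho[) \int[leb]_(t in I) (F (q r t) * r)%:E)%E).
    apply: ge0_subset_integral => //.
    by move=> r /=; rewrite in_itv/= => /andP[h1 _]; exact: G0.
  apply: le_lt_trans hM; rewrite le_eqVlt; apply/orP; left; apply/eqP.
  symmetry; apply: (@ge0_integral_swap _ I `]0, rho[%classic
    (fun t r => (F (q r t) * r)%:E)) => //; first exact: (mq _ _ F _ _ mF m2 m1).
  by move=> t r _ /=; rewrite in_itv/= => /andP[r0 _]; exact: P0.
pose d1' := R1 * cos 1 * d.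
have d1'0 : 0 < d1' by rewrite !mulr_gt0.
have d1'r : d1' <= rho / 2.
  apply: le_trans drho; rewrite /d1' -mulrA; apply: ler_wpM2l; first exact: ltW.
  by apply: ler_piMl; [exact: ltW|exact: cos_le1].
(* The half circle of radius [r0] meets the crack; the one of radius [r1] is of fixed size. *)
have [r0 r0I hr0] : exists2 r, d1' / 2 < r < d1' & (B r <= (E / (d1' - d1' / 2))%:E)%E.
  apply: (circle def) => //; last by rewrite (le_trans d1'r)// ler_pdivrMr// ler_peMr ?(ltW rho0)// ler1n.
    by rewrite divr_ge0// ltW.
  by rewrite ltr_pdivrMr// ltr_pMr// ltr1n.
have [r1 r1I hr1] : exists2 r, rho / 2 < r < rho & (B' r <= ((M / m) / (rho - rho / 2))%:E)%E.
  apply: (circle dev) => //.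
    by rewrite divr_ge0// ltW.
  by rewrite ltr_pdivrMr// ltr_pMr// ltr1n.
rewrite (_ : d1' - d1' / 2 = d1' / 2) in hr0; last by field.
rewrite (_ : rho - rho / 2 = rho / 2) in hr1; last by field.
have [r0l r0r] := andP r0I; have [r1l r1r] := andP r1I.
have r00 : 0 < r0 by rewrite (lt_trans _ r0l)// divr_gt0.
have r10 : 0 < r1 by rewrite (lt_trans _ r1l)// divr_gt0.
have r01 : r0 < r1 by rewrite (lt_trans r0r)// (le_lt_trans d1'r).
have r0rho : r0 < rho := lt_trans r01 r1r.
have E0 : 0 < E.
  by rewrite -lte_fin; apply: le_lt_trans hE; apply: integral_ge0 => p _; rewrite lee_fin.
have M0 : 0 < M.
  by rewrite -lte_fin; apply: le_lt_trans hT; apply: integral_ge0 => p _; rewrite lee_fin sqr_ge0.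
have Pdef0 r t : 0 < r -> (0 <= (def (q r t) * r)%:E)%E.
  by move=> rr0; rewrite lee_fin mulr_ge0// ltW.
have mdt t : measurable_fun setT (fun r : R => (def (q r t) * r)%:E).
  by apply: (mq _ _ def _ _ md) => //; exact: measurable_cst.
have mdr r : measurable_fun setT (fun t : R => (def (q r t) * r)%:E).
  by apply: (mq _ _ def _ _ md) => //; exact: measurable_cst.
(* Angular increments from the crack. *)
have small t : - (pi / 2) < t < pi / 2 -> m * P (q r0 t) ^+ 2 <= 2 * pi * E.
  move=> tI; have [s0 s0I [t0 t0I st]] := crack_point r00 (ltW r0r) d01.
  have Pt0 : P (q r0 t0) = 0 by rewrite /P -st fcrack// mul0r.
  have := @curve_increment _ R2 _ _ _ hf (fun s => r0 * cos s) (fun s => R1 + r0 * sin s)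
    (fun s => - (r0 * sin s)) (fun s => r0 * cos s) (fun s => s) (fun=> 1) (fun=> r0 ^+ 2)
    I m t0 t => /=.
  rewrite -/(P _) -/(P (q r0 t0)) Pt0 subr0.
  have cS : continuous (fun s : R => r0 * sin s) by move=> s; apply: cvgMr; exact: continuous_sin.
  have cC : continuous (fun s : R => r0 * cos s) by move=> s; apply: cvgMr; exact: continuous_cos.
  have H1 : (`|t - t0|%:E * \int[leb]_(s in I) (def (q r0 s) * r0 ^+ 2)%:E <= (2 * pi * E)%:E)%E.
    have -> : (\int[leb]_(s in I) (def (q r0 s) * r0 ^+ 2)%:E = r0%:E * B r0)%E.
      rewrite /B -ge0_integralZl//; last 3 first.
      - by apply: measurable_funTS; exact: mdr.
      - by move=> s _; exact: Pdef0.
      - by rewrite lee_fin ltW.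
      by apply: eq_integral => s _; rewrite -EFinM; congr EFin; ring.
    apply: (@le_trans _ _ (pi%:E * (d1'%:E * (E / (d1' / 2))%:E))%E).
      apply: lee_pmul; rewrite ?lee_fin//.
      - apply: mule_ge0; first by rewrite lee_fin ltW.
        by apply: integral_ge0 => s _; exact: Pdef0.
      - by rewrite ler_norml; clear -R20 rho0 rhoR1 rhoR2 m tI t0I; move: tI t0I => /andP[? ?] /andP[? ?]; lra.
      apply: lee_pmul => //; rewrite ?lee_fin ?(ltW r00) ?(ltW r0r)//.
      by apply: integral_ge0 => s _; exact: Pdef0.
    rewrite -!EFinM lee_fin le_eqVlt; apply/orP; left; apply/eqP; field.
    by rewrite gt_eqF.
  move=> H; rewrite -lee_fin; apply: le_trans H1; apply: H => //.
  - move=> s /= /andP[s1 s2]; rewrite /I/= in_itv/=; move: tI t0I => /andP[t1 t2] /andP[t3 t4].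
    apply/andP; split.
      by apply: lt_le_trans s1; rewrite lt_min t3.
    by apply: le_lt_trans s2 _; rewrite gt_max t4.
  - exact: ltW.
  - exact: continuous_measurable_fun.
  - by apply: measurable_funD => //; exact: continuous_measurable_fun.
  - by move=> s _; have [] := @gs_shifted_polar r0 s; rewrite ?(ltW r00) ?(ltW r0rho).
  - by move=> s _; apply: is_derive_eq; rewrite /GRing.scale/=; ring.
  - by move=> s _; apply: is_derive_eq; rewrite /GRing.scale/=; ring.
  - by move=> s _; apply: cvgN; exact: cS.
  - by move=> s _; exact: cC.
  - by move=> s _; exact: cvg_cst.
  - by move=> s _; rewrite sqr_ge0.
  - move=> s _; rewrite mulr1 sqrrN addrC polar_sqnorm ler_wpM2r ?sqr_ge0//.
    by have [] := @gs_shifted_polar r0 s; rewrite ?(ltW r00) ?(ltW r0rho).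
pose Lam := K + `|ln d|.
have Lam0 : 0 <= Lam by apply: addr_ge0; exact: normr_ge0.
have lnr : `|ln r1 - ln r0| <= Lam.
  rewrite ger0_norm; last by rewrite subr_ge0 ler_ln ?posrE// ltW.
  have l1 : ln r1 <= ln rho by rewrite ler_ln ?posrE// ltW.
  have l0 : ln (d1' / 2) <= ln r0 by rewrite ler_ln ?posrE ?divr_gt0// ltW.
  have l2 : ln rho - ln (d1' / 2) = ln (2 * rho / (R1 * cos 1)) - ln d.
    rewrite -!ln_div ?posrE ?divr_gt0 ?mulr_gt0//; congr ln; rewrite /d1'; field.
    by rewrite !gt_eqF.
  have l3 : ln (2 * rho / (R1 * cos 1)) <= K by exact: ler_norm.
  have l4 : - ln d <= `|ln d| by rewrite -normrN ler_norm.
  by rewrite /Lam; clear -R20 rho0 rhoR1 rhoR2 m l0 l1 l2 l3 l4; lra.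
(* Radial increments, with the weight [1 / s], whose primitive is the logarithm. *)
have radial t : - (pi / 2) < t < pi / 2 ->
    ((m * (P (q r1 t) - P (q r0 t)) ^+ 2)%:E <= Lam%:E * A t)%E.
  move=> tI.
  have sI s : Num.min r0 r1 <= s <= Num.max r0 r1 -> 0 < s < rho.
    rewrite (min_l (ltW r01)) (max_r (ltW r01)) => /andP[s1 s2].
    by rewrite (lt_le_trans r00 s1) (le_lt_trans s2 r1r).
  have A0 : (0 <= A t)%E.
    by apply: integral_ge0 => s /=; rewrite in_itv/= => /andP[s0 _]; exact: Pdef0.
  have := @curve_increment _ R2 _ _ _ hf (fun s => s * cos t) (fun s => R1 + s * sin t)
    (fun=> cos t) (fun=> sin t) (@ln R) (fun s => s^-1) (fun s => s)
    `]0, rho[%classic m r0 r1 => /=.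
  rewrite -/(P _) -/(P (q r0 t)).
  have H1 : (`|ln r1 - ln r0|%:E * A t <= Lam%:E * A t)%E by rewrite lee_wpmul2r ?lee_fin.
  move=> H; apply: le_trans H1; apply: H => //.
  - exact: ltW.
  - exact: mulrr_measurable.
  - by apply: measurable_funD => //; exact: mulrr_measurable.
  - by move=> s /sI/andP[s0 sR]; have [] := @gs_shifted_polar s t; rewrite ?(ltW s0) ?(ltW sR).
  - by move=> s _; apply: is_derive_eq; rewrite /GRing.scale/=; ring.
  - by move=> s _; apply: is_derive_eq; rewrite /GRing.scale/=; ring.
  - by move=> s _; exact: cvg_cst.
  - by move=> s _; exact: cvg_cst.
  - by move=> s /sI/andP[s0 _]; exact: is_derive1_ln.
  - by move=> s /sI/andP[s0 _]; apply: cvgV; [rewrite gt_eqF|exact: cvg_id].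
  - by move=> s /sI/andP[s0 _]; rewrite invr_gt0.
  - by move=> s /=; rewrite in_itv/= => /andP[s0 _]; rewrite ltW.
  - move=> s /sI/andP[s0 sR]; rewrite cos2Dsin2 mulr1 -mulrA mulVf ?gt_eqF// mulr1.
    by have [] := @gs_shifted_polar s t; rewrite ?(ltW s0) ?(ltW sR).
have point t : - (pi / 2) < t < pi / 2 ->
    ((m * T ^+ 2)%:E <= ((1 + e) * Lam)%:E * A t + ((4 * (1 + e^-1) * pi * E)%:E +
      (2 * (1 + e^-1) * m / r1)%:E * (dev (q r1 t) * r1)%:E))%E.
  move=> tI.
  set F1 := P (q r1 t); set F0 := P (q r0 t).
  have e0' : 0 < 1 + e^-1 by rewrite addr_gt0 ?invr_gt0.
  apply: (@le_trans _ _ (((1 + e) * (m * (F1 - F0) ^+ 2))%:E +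
    ((2 * (1 + e^-1) * (m * F0 ^+ 2))%:E + (2 * (1 + e^-1) * (m * (F1 - T) ^+ 2))%:E))%E).
    rewrite -!EFinD lee_fin.
    have h1 := sqrD_le (F1 - F0) (F0 - (F1 - T)) e0.
    have h2 : (F0 - (F1 - T)) ^+ 2 <= 2 * F0 ^+ 2 + 2 * (F1 - T) ^+ 2.
      by rewrite -subr_ge0 (_ : _ - _ = (F0 + (F1 - T)) ^+ 2) ?sqr_ge0//; ring.
    rewrite (_ : T = (F1 - F0) + (F0 - (F1 - T))); last by ring.
    rewrite (_ : F1 - (F1 - F0 + (F0 - (F1 - T))) = F1 - T); last by ring.
    apply: (@le_trans _ _ (m * ((1 + e) * (F1 - F0) ^+ 2 +
      (1 + e^-1) * (2 * F0 ^+ 2 + 2 * (F1 - T) ^+ 2)))); last first.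
      by rewrite le_eqVlt; apply/orP; left; apply/eqP; ring.
    rewrite ler_wpM2l ?(ltW m0)//; apply: (le_trans h1).
    by rewrite lerD2l ler_wpM2l ?(ltW e0').
  apply: leeD.
    rewrite EFinM [in leRHS]EFinM -muleA lee_wpmul2l ?lee_fin ?addr_ge0 ?(ltW e0)//.
    exact: radial.
  apply: leeD.
    rewrite lee_fin (_ : 4 * (1 + e^-1) * pi * E = 2 * (1 + e^-1) * (2 * pi * E)); last by ring.
    by rewrite ler_wpM2l ?small// mulr_ge0 ?(ltW e0').
  rewrite -EFinM lee_fin le_eqVlt; apply/orP; left; apply/eqP; rewrite /dev -/F1; field.
  by rewrite !gt_eqF.
have Ameas : measurable_fun I A.
  apply: (@measurable_integral_r _ I `]0, rho[%classic
    (fun t r => (def (q r t) * r)%:E)) => //; first exact: (mq _ _ def _ _ md m2 m1).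
  by move=> t r _ /=; rewrite in_itv/= => /andP[? _]; exact: Pdef0.
have A0 t : (0 <= A t)%E.
  by apply: integral_ge0 => s /=; rewrite in_itv/= => /andP[s0 _]; exact: Pdef0.
have mdevr : measurable_fun I (fun t => (dev (q r1 t) * r1)%:E).
  by apply: measurable_funTS; apply: (mq _ _ dev _ _ mdev) => //; exact: measurable_cst.
have pdev t : (0 <= (dev (q r1 t) * r1)%:E)%E by rewrite lee_fin mulr_ge0// ltW.
have cI (k : R) : (\int[leb]_(t in I) cst k%:E t = (k * pi)%:E)%E.
  rewrite integral_cst// EFinM; congr (_ * _)%E.
  apply: (etrans (lebesgue_measure_itv `](- (pi / 2)), (pi / 2)[)); rewrite /= lte_fin.
  by rewrite (lt_trans (_ : _ < 0)) ?oppr_lt0 ?divr_gt0// -EFinB; congr EFin; field.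
have eV0 : 0 < 1 + e^-1 by rewrite addr_gt0 ?invr_gt0.
have k1 : 0 <= (1 + e) * Lam by rewrite mulr_ge0// addr_ge0// ltW.
have k2 : 0 <= 4 * (1 + e^-1) * pi * E.
  by rewrite mulr_ge0 ?(ltW E0)// mulr_ge0 ?(ltW pi0)// mulr_ge0 ?(ltW eV0).
have k3 : 0 <= 2 * (1 + e^-1) * m / r1.
  by rewrite divr_ge0 ?(ltW r10)// mulr_ge0 ?(ltW m0)// mulr_ge0 ?(ltW eV0).
have total : (\int[leb]_(t in I) cst (m * T ^+ 2)%:E t <=
    ((1 + e) * Lam)%:E * E%:E + ((4 * (1 + e^-1) * pi * E * pi)%:E +
      (2 * (1 + e^-1) * m / r1)%:E * (M / m / (rho / 2))%:E))%E.
  apply: (@le_trans _ _ (\int[leb]_(t in I) (((1 + e) * Lam)%:E * A t + ((4 * (1 + e^-1) * pi * E)%:E +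
      (2 * (1 + e^-1) * m / r1)%:E * (dev (q r1 t) * r1)%:E)))%E).
    apply: ge0_le_integral => //.
    - by move=> t _; rewrite lee_fin mulr_ge0 ?sqr_ge0 ?(ltW m0).
    - apply: emeasurable_funD; first exact: emeasurable_funM.
      by apply: emeasurable_funD => //; exact: emeasurable_funM.
  rewrite ge0_integralD//; last 4 first.
  - by move=> t _; rewrite mule_ge0 ?lee_fin.
  - exact: emeasurable_funM.
  - by move=> t _; apply: adde_ge0; [rewrite lee_fin|apply: mule_ge0; [rewrite lee_fin|exact: pdev]].
  - by apply: emeasurable_funD => //; exact: emeasurable_funM.
  rewrite ge0_integralD//; last 2 first.
  - by move=> t _; apply: mule_ge0; [rewrite lee_fin|exact: pdev].
  - exact: emeasurable_funM.
  rewrite ge0_integralZl// ?lee_fin// ge0_integralZl// ?lee_fin// cI.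
  apply: leeD; first by rewrite lee_wpmul2l ?lee_fin// ltW.
  by apply: leeD => //; rewrite lee_wpmul2l ?lee_fin.
move: total; rewrite cI -!EFinM lee_fin => total.
have r1V : r1^-1 <= 2 / rho.
  by rewrite -[leRHS]invf_div lef_pV2 ?posrE ?divr_gt0// ltW.
have e0' : 0 < 1 + e^-1 by rewrite addr_gt0 ?invr_gt0.
have h1 : 2 * (1 + e^-1) * m / r1 * (M / m / (rho / 2)) <= (1 + e^-1) * M * (8 / rho ^+ 2).
  rewrite (_ : _ * (M / m / (rho / 2)) = (1 + e^-1) * M * (4 / rho) * r1^-1); last first.
    by field; rewrite !gt_eqF.
  rewrite (_ : _ * (8 / rho ^+ 2) = (1 + e^-1) * M * (4 / rho) * (2 / rho)); last first.
    by field; rewrite !gt_eqF.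
  by rewrite ler_wpM2l// !mulr_ge0 ?(ltW e0') ?(ltW M0)// invr_ge0 ltW.
have h2 : (1 + e) * K <= (1 + e^-1) * (2 * K).
  rewrite [leRHS]mulrA ler_wpM2r ?normr_ge0//.
  have eV : 0 < e^-1 by rewrite invr_gt0.
  by clear -R20 rho0 rhoR1 rhoR2 m e1 eV; lra.
have h3 := ler_wpM2l (ltW E0) h2.
rewrite (_ : pi * m * T ^+ 2 = m * T ^+ 2 * pi); last by ring.
apply: (le_trans total); rewrite /C /Lam; move: h1 h3 e0'; set u := (1 + e^-1).
set v := (1 + e); set l := `|ln d|; set X := _ * (M / m / (rho / 2)) => h1 h3 u0.
rewrite (_ : v * (K + l) * E = v * E * l + E * (v * K)); last by ring.
rewrite (_ : 4 * u * pi * E * pi = u * (4 * pi ^+ 2) * E); last by ring.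
rewrite (_ : u * _ * (E + M) = E * (u * (2 * K)) + u * (4 * pi ^+ 2) * E + u * M * (8 / rho ^+ 2) +
  (u * (2 * K) * M + u * (4 * pi ^+ 2) * M + u * (8 / rho ^+ 2) * E)); last by ring.
have p1 : 0 <= u * (2 * K) * M by rewrite !mulr_ge0 ?normr_ge0 ?(ltW u0) ?(ltW M0).
have p2 : 0 <= u * (4 * pi ^+ 2) * M by rewrite !mulr_ge0 ?exprn_ge0 ?(ltW pi0) ?(ltW u0) ?(ltW M0).
have p3 : 0 <= u * (8 / rho ^+ 2) * E by rewrite !mulr_ge0 ?invr_ge0 ?sqr_ge0 ?(ltW u0) ?(ltW E0).
by clear -R20 rho0 rhoR1 rhoR2 m h1 h3 p1 p2 p3; lra.
Qed.
End LowerBound.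

(** * The norm of the ground state and the lower bound for the defect *)

Ltac positivity :=
  lazymatch goal with
  | |- is_true (0 <= _) =>
    first [ done | assumption | by apply: ltW | exact: sqr_ge0 | exact: normr_ge0
      | exact: defect_ge0 | rewrite lee_fin; positivity
      | apply: addr_ge0; positivity | rewrite invr_ge0; positivity
      | apply: mulr_ge0; positivity | apply: exprn_ge0; positivity
      | apply: ltW; positivity ]
  | |- is_true (0 < _) =>
    first [ done | assumption | exact: pi_gt0 | rewrite invr_gt0; positivity
      | apply: addr_gt0; positivity
      | apply: mulr_gt0; positivity | apply: exprn_gt0; positivity ]
  | |- is_true (_ != 0) => rewrite gt_eqF//; positivity
  end.

Section GroundStateNorm.
Local Set Implicit Arguments.
Local Unset Strict Implicit.
Context {R : realType}.
Local Notation mR := (measurableTypeR R).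
Local Notation plane := (mR * mR)%type.
Local Notation leb := (@lebesgue_measure R).
Local Notation leb2 := (leb \x leb)%E.
Variables (R2 : R) (R20 : 0 < R2).
Local Notation a := (gs_scale R2).
Local Notation gs := (gs R2).
Local Notation gsr := (gsr R2).

(** The integral of [gs ^ 2] over the quarter disc ([integral_gs2]), that is
    [pi / 4 * R2 ^ 2 * J_0' (j01) ^ 2]. *)
Definition gs_norm : R := pi / 4 * R2 ^+ 2 * (bes_zero * bes' bes_zero ^+ 2).

Lemma gs_norm_gt0 : 0 < gs_norm.
Proof.
have z0 := @bes_zero_gt0 R; have h : bes' (bes_zero : R) < 0.
  by apply: bes'_lt0; rewrite lexx andbT.
have h2 : 0 < bes' (bes_zero : R) ^+ 2 by rewrite -sqrrN exprn_gt0// oppr_gt0.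
rewrite /gs_norm; positivity.
Qed.

Lemma integral_gs2 : (\int[leb2]_(p in quarter_disc R2) ((gs p) ^+ 2)%:E = gs_norm%:E)%E.
Proof.
have pi0 := pi_gt0 R; have a0 := gs_scale_gt0 R20.
have cg := has_gradient_continuous (has_gradient_gs R2).
rewrite (integral_quarter_disc_real R20); last 2 first.
- by apply/measurable_EFinP; apply: measurable_continuous2 => p; apply: cvgM; exact: cg.
- by move=> p; exact: sqr_ge0.
pose H (z : R) := z * bes z ^+ 2 + (z * bes' z) ^+ 2.
pose G r := H (a * r ^+ 2) / (2 * a).
have dG (r : R) : is_derive r (1 : R) G (gsr r ^+ 2 * r).
  have ds : is_derive r (1 : R) (fun r : R => a * r ^+ 2) (2 * a * r).
    by apply: is_derive_eq; rewrite /GRing.scale/=; ring.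
  have := is_derive1_comp (is_derive_bes2 _) ds => d.
  have -> : G = (fun r => (H \o (fun r : R => a * r ^+ 2)) r * (2 * a)^-1) by [].
  apply: is_derive_eq; rewrite /GRing.scale/= /gsr; field.
  by rewrite gt_eqF.
have IG : (\int[leb]_(r in `]0%R, R2[) (gsr r ^+ 2 * r)%:E = (G R2 - G 0)%:E)%E.
  have mg : measurable_fun setT (fun r => (gsr r ^+ 2 * r)%:E).
    apply/measurable_EFinP; apply: continuous_measurable_fun => r.
    by apply: cvgM; [apply: cvgM; exact: continuous_gsr|exact: cvg_id].
  rewrite integral_itv_obnd_cbnd; last exact: measurable_funTS.
  rewrite integral_itv_bndo_bndc; last exact: measurable_funTS.
  apply: integral_derivative => // [|r _]; first exact: ltW.
  by apply: cvgM; [apply: cvgM; exact: continuous_gsr|exact: cvg_id].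
transitivity (\int[leb]_(t in `]0%R, (pi / 2)%R[) cst (G R2 - G 0)%:E t)%E.
  by apply: eq_integral => t _; rewrite -IG; apply: eq_integral => r _; rewrite gs_polar.
rewrite integral_cst//.
transitivity ((G R2 - G 0)%:E * (pi / 2)%:E)%E.
  congr (_ * _)%E; apply: (etrans (lebesgue_measure_itv `]0, (pi / 2)[)).
  by rewrite /= lte_fin divr_gt0// -EFinB subr0.
rewrite -EFinM; congr EFin.
have G0 : G 0 = 0 by rewrite /G /H expr0n/= mulr0 !mul0r expr0n/= addr0 mul0r.
have GR : G R2 = (bes_zero * bes' bes_zero) ^+ 2 / (2 * a).
  by rewrite /G /H scale_R2// bes_zeroP expr0n/= mulr0 add0r.
rewrite G0 GR /gs_norm /gs_scale; move: (pi : R) => q; field.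
by rewrite !gt_eqF ?bes_zero_gt0.
Qed.

End GroundStateNorm.

Section DefectLowerBound.
Local Set Implicit Arguments.
Local Unset Strict Implicit.
Context {R : realType}.
Local Notation mR := (measurableTypeR R).
Local Notation plane := (mR * mR)%type.
Local Notation leb := (@lebesgue_measure R).
Local Notation leb2 := (leb \x leb)%E.
Variables (R1 R2 : R) (R10 : 0 < R1) (R12 : R1 < R2).
Local Notation gs := (gs R2).
Local Notation gsr := (gsr R2).
Local Notation N0 := (gs_norm R2).

(** The coefficient of [1 / |ln d|] in the expansion of the eigenvalue. *)
Definition shift_coef : R := pi * gsr R1 ^+ 2 / N0.

(** [gap] bounds [f - T * gs], and [capacity_bound] bounds [T]; the margin between [k]
    and [shift_coef] pays for the choice of [rho], at which [gsr] differs from [gsr R1],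
    and for the cross terms, weighted by [e]. *)
Lemma defect_lower_bound k : 0 < k < shift_coef ->
  exists C d0 : R, [/\ 0 <= C, 0 < d0 & forall d, 0 < d <= d0 ->
  forall f fx fy, has_gradient f fx fy ->
  (forall s, pi / 2 - d <= s <= pi / 2 -> f (polar R1 s) = 0) ->
  forall E : R, (\int[leb2]_(p in quarter_disc R2) (defect R2 f fx fy p)%:E < E%:E)%E ->
  (\int[leb2]_(p in quarter_disc R2) (f p ^+ 2)%:E <= (E * (`|ln d| / k + C))%:E)%E].
Proof.
move=> /andP[k0 kk]; have R20 := lt_trans R10 R12.
have pi0 := pi_gt0 R; have N00 : 0 < N0 := gs_norm_gt0 R20.
have kN : k * N0 < pi * gsr R1 ^+ 2 by rewrite -ltr_pdivlMr.
have kN0 : 0 < k * N0 by rewrite mulr_gt0.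
have [rho [r0 r1 r2 hr]] : exists rho, [/\ 0 < rho, rho < R1, R1 + rho < R2 &
    k * N0 < pi * gsr (R1 + rho) ^+ 2].
  have cont : {for R1, continuous (fun r => pi * gsr r ^+ 2)}.
    by apply: cvgMr; apply: cvgM; exact: continuous_gsr.
  have := cont _ (lt_nbhsr kN) => /nbhs_ballP[e /= e0 he].
  pose rho := Num.min (e / 2) (Num.min (R1 / 2) ((R2 - R1) / 2)).
  have rho0 : 0 < rho by rewrite !lt_min !divr_gt0// subr_gt0.
  have h1 : rho <= e / 2 by rewrite ge_min lexx.
  have h2 : rho <= R1 / 2 by rewrite /rho !ge_min lexx !orbT.
  have h3 : rho <= (R2 - R1) / 2 by rewrite /rho !ge_min lexx !orbT.
  exists rho; split => //; try lra.
  by apply: he; rewrite /ball/= opprD addNKr normrN gtr0_norm//; lra.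
set m := gsr (R1 + rho) ^+ 2 in hr.
have m0 : 0 < m by rewrite -(pmulr_rgt0 _ pi0) (lt_trans kN0).
have [e /andP[e0 e1] he] : exists2 e : R, 0 < e <= 1 & (1 + e) ^+ 2 * (k * N0) <= pi * m.
  pose y := pi * m / (k * N0) - 1.
  have y0 : 0 < y by rewrite subr_gt0 ltr_pdivlMr ?mul1r.
  exists (Num.min 1 (y / 3)).
    by rewrite lt_min ltr01 divr_gt0//= ge_min lexx.
  set e := Num.min _ _.
  have e1 : e <= 1 by rewrite ge_min lexx.
  have e2 : e <= y / 3 by rewrite ge_min lexx orbT.
  have e0 : 0 < e by rewrite lt_min ltr01 divr_gt0.
  rewrite -ler_pdivlMr//; rewrite (_ : pi * m / (k * N0) = 1 + y); last by rewrite /y; ring.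
  nra.
have [Cg Cg0 hg] := gap R20.
have [C1 C10 hC1] := capacity_bound R20 r0 r1 r2.
pose C := (1 + e) * N0 / (pi * m) * (1 + e^-1) * C1 * (2 + Cg) + (1 + e^-1) * (Cg + 1).
have eV0 : 0 < 1 + e^-1 by rewrite addr_gt0 ?invr_gt0.
exists C, (Num.min 1 (rho / (2 * R1))).
split.
- have q0 : 0 <= (1 + e) * N0 / (pi * m).
    positivity.
  rewrite /C; positivity.
- by rewrite lt_min ltr01 divr_gt0 ?mulr_gt0.
move=> d /andP[d0]; rewrite le_min => /andP[d1 dr] f fx fy hf fcr E hE.
have E0 : 0 < E.
  by rewrite -lte_fin; apply: le_lt_trans hE; apply: integral_ge0 => p _; rewrite lee_fin defect_ge0.
have [T hT] := hg _ _ _ hf _ hE.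
have hT' : (\int[leb2]_(p in quarter_disc R2) ((f p - T * gs p) ^+ 2)%:E < ((Cg + 1) * E)%:E)%E.
  by apply: (le_lt_trans hT); rewrite lte_fin ltr_pM2r// ltrDl.
have d01 : 0 < d <= 1 by rewrite d0.
have dr' : R1 * d <= rho / 2.
  by move: dr; rewrite ler_pdivlMr ?mulr_gt0// => dr; lra.
have e01 : 0 < e <= 1 by rewrite e0.
have := hC1 _ d01 dr' _ _ _ hf fcr _ _ _ hE hT' _ e01; rewrite -/m => hTT.
have cf := has_gradient_continuous hf.
have cg := has_gradient_continuous (has_gradient_gs R2).
have mg2 : measurable_fun (setT : set plane) (fun p => (gs p ^+ 2)%:E).
  by apply/measurable_EFinP; apply: measurable_continuous2 => p; apply: cvgM; exact: cg.
have mfT : measurable_fun (setT : set plane) (fun p => ((f p - T * gs p) ^+ 2)%:E).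
  apply/measurable_EFinP; apply: measurable_continuous2 => p.
  by apply: cvgM; (apply: cvgB; [exact: cf|apply: cvgMr; exact: cg]).
have mf2 : measurable_fun (setT : set plane) (fun p => (f p ^+ 2)%:E).
  by apply/measurable_EFinP; apply: measurable_continuous2 => p; apply: cvgM; exact: cf.
have mQ := measurable_quarter_disc R2.
apply: (@le_trans _ _ (\int[leb2]_(p in quarter_disc R2)
   (((1 + e) * T ^+ 2)%:E * (gs p ^+ 2)%:E + (1 + e^-1)%:E * ((f p - T * gs p) ^+ 2)%:E))%E).
  apply: ge0_le_integral => //.
  - by move=> p _; rewrite lee_fin sqr_ge0.
  - exact: measurable_funTS.
  - by apply: emeasurable_funD; apply: emeasurable_funM => //; exact: measurable_funTS.
  move=> p _; rewrite -!EFinM -EFinD lee_fin.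
  have := sqrD_le (T * gs p) (f p - T * gs p) e0.
  by rewrite addrC subrK exprMn mulrA.
rewrite ge0_integralD//; last 4 first.
- by move=> p _; rewrite -EFinM lee_fin; positivity.
- by apply: emeasurable_funM => //; exact: measurable_funTS.
- by move=> p _; rewrite -EFinM lee_fin; positivity.
- by apply: emeasurable_funM => //; exact: measurable_funTS.
rewrite ge0_integralZl//; last 3 first.
- exact: measurable_funTS.
- by move=> p _; rewrite lee_fin sqr_ge0.
- by rewrite lee_fin; positivity.
rewrite ge0_integralZl//; last 3 first.
- exact: measurable_funTS.
- by move=> p _; rewrite lee_fin sqr_ge0.
- by rewrite lee_fin ltW.
rewrite (integral_gs2 R20).
apply: (@le_trans _ _ (((1 + e) * T ^+ 2)%:E * N0%:E + (1 + e^-1)%:E * ((Cg + 1) * E)%:E)%E).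
  by rewrite leeD2l// lee_wpmul2l ?lee_fin ?(ltW eV0)// ltW.
rewrite -!EFinM -EFinD lee_fin.
set l := `|ln d| in hTT *.
have l0 : 0 <= l by exact: normr_ge0.
have pm0 : 0 < pi * m by rewrite mulr_gt0.
have T2 : T ^+ 2 <= ((1 + e) * E * l + (1 + e^-1) * C1 * (E + (Cg + 1) * E)) / (pi * m).
  by rewrite ler_pdivlMr// [leLHS]mulrC.
have c0 : 0 <= (1 + e) * N0 by positivity.
have h1 := ler_wpM2l c0 T2.
have h2 : (1 + e) ^+ 2 * N0 / (pi * m) <= k^-1.
  by rewrite ler_pdivrMr// [leRHS]mulrC ler_pdivlMr// -mulrA [N0 * k]mulrC.
have h3 : E * l * ((1 + e) ^+ 2 * N0 / (pi * m)) <= E * l * k^-1.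
  by apply: ler_wpM2l => //; positivity.
rewrite (_ : (1 + e) * T ^+ 2 * N0 = (1 + e) * N0 * T ^+ 2); last by ring.
apply: (le_trans (lerD h1 (lexx _))); rewrite /C.
rewrite (_ : E * (l / k + _) = E * l * k^-1 + E * C); last by rewrite /C; ring.
apply: (@le_trans _ _ (E * l * ((1 + e) ^+ 2 * N0 / (pi * m)) + E * C)); last by rewrite lerD2r.
rewrite le_eqVlt; apply/orP; left; apply/eqP; rewrite /C.
move: (pi * m) pm0 => pm pm0; field.
by rewrite !gt_eqF.
Qed.

End DefectLowerBound.

(** * Smoothed one-sided functions of one variable *)
Section Truncation.
Local Set Implicit Arguments.
Local Unset Strict Implicit.
Context {R : realType}.

Lemma continuous_max0 : continuous (fun x : R => Num.max 0 x).
Proof.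
have -> : (fun x : R => Num.max 0 x) = (fun x => (x + `|x|) / 2).
  apply/funext => x; case: (leP 0 x) => x0; first by rewrite ger0_norm//; field.
  by rewrite ltr0_norm// subrr mul0r.
by move=> x; apply: cvgMl; apply: cvgD; [exact: cvg_id|exact: norm_continuous].
Qed.

(** A function with a double zero at [0] may be continued by [0] to the left. *)
Section Glue.
Variables (g g' : R -> R).
Hypotheses (dg : forall x : R, 0 <= x -> is_derive x (1 : R) g (g' x)) (g0 : g 0 = 0) (g'0 : g' 0 = 0).

Lemma is_derive_glue (x : R) :
  is_derive x (1 : R) (fun x => g (Num.max 0 x)) (g' (Num.max 0 x)).
Proof.
set f := fun x => g (Num.max 0 x).
have f0 y : y <= 0 -> f y = 0 by move=> y0; rewrite /f max_l.
have [x0|x0|x0] := ltgtP x 0.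
- rewrite g'0.
  apply: (near_eq_is_derive _ (is_derive_cst (0 : R) x (1 : R))).
  by apply: filterS (lt_nbhsl x0) => y y0; rewrite f0// ltW.
- apply: (near_eq_is_derive _ (dg (ltW x0))).
  by apply: filterS (lt_nbhsr x0) => y y0; rewrite /f max_r// ltW.
rewrite x0 ?maxxx g'0.
have [dg0 dg0'] := dg (lexx 0); rewrite g'0 in dg0'.
have cg : (fun h => h^-1 *: (g (h *: (1 : R) + 0) - g 0)) @ (0 : R)^' --> 'D_(1 : R) g 0.
  exact: dg0.
rewrite dg0' in cg.
have cf : (fun h => h^-1 *: (f (h *: (1 : R) + 0) - f 0)) @ (0 : R)^' --> (0 : R).
  apply/cvgr0Pnorm_lt => e e0; move/cvgr0Pnorm_lt : cg => /(_ e e0).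
  apply: filterS => h; rewrite (f0 0)// g0.
  have -> : h *: (1 : R) + 0 = h by rewrite addr0 /GRing.scale/= mulr1.
  have [h0|h0] := leP h 0; first by move=> _; rewrite f0// subrr scaler0 normr0.
  by rewrite /f max_r// ltW.
apply: DeriveDef; first by apply/cvg_ex; exists 0; exact: cf.
exact: cvg_lim cf.
Qed.
End Glue.

Lemma continuous_glue (g' : R -> R) : (forall x : R, 0 <= x -> {for x, continuous g'}) ->
  continuous (fun x : R => g' (Num.max 0 x)).
Proof.
move=> cg x; apply: (@continuous_comp R R R (fun x : R => Num.max 0 x) g' x).
  exact: continuous_max0.
by apply: cg; rewrite le_max lexx.
Qed.

(** [ln s + 1 / s - 1] continued by [0] below [1]: a logarithm that starts
    smoothly. *)
Definition logstep (s : R) : R := ln (1 + Num.max 0 (s - 1)) + (1 + Num.max 0 (s - 1))^-1 - 1.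
Definition logstep' (s : R) : R := Num.max 0 (s - 1) / (1 + Num.max 0 (s - 1)) ^+ 2.

Let is_derive_shift1 (s : R) : is_derive s (1 : R) (fun s : R => s - 1) 1.
Proof. by apply: is_derive_eq; rewrite subr0. Qed.

Lemma is_derive_logstep (s : R) : is_derive s (1 : R) logstep (logstep' s).
Proof.
pose g (x : R) := ln (1 + x) + (1 + x)^-1 - 1.
pose g' (x : R) := x / (1 + x) ^+ 2.
have dg (x : R) : 0 <= x -> is_derive x (1 : R) g (g' x).
  move=> x0; have x1 : 0 < 1 + x by rewrite ltr_wpDr.
  have d1 : is_derive x (1 : R) (fun x => 1 + x) 1.
    by have := is_deriveD (is_derive_cst (1 : R) x (1 : R)) (is_derive_id x (1 : R)); rewrite add0r.
  have d2 := is_derive1_comp (is_derive1_ln x1) d1.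
  have xn : 1 + x != 0 by rewrite gt_eqF.
  have d3 := @is_deriveV R (fun x => 1 + x) x _ 1 xn d1.
  have -> : g = (fun x => (@ln R \o (fun x => 1 + x)) x + (fun x => (1 + x)^-1) x - 1) by [].
  by apply: is_derive_eq; rewrite /g' /GRing.scale/=; field.
have g0 : g 0 = 0 by rewrite /g addr0 ln1 invr1 add0r subrr.
have g'0 : g' 0 = 0 by rewrite /g' mul0r.
have := @is_derive1_comp R (fun x : R => g (Num.max 0 x)) (fun s : R => s - 1) s _ _
  (is_derive_glue dg g0 g'0 (s - 1)) (is_derive_shift1 s).
by rewrite mulr1.
Qed.

Lemma continuous_logstep' : continuous logstep'.
Proof.
move=> s; apply: (@continuous_comp R R R (fun s : R => s - 1) (fun x : R => Num.max 0 x / (1 + Num.max 0 x) ^+ 2) s).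
  by apply: cvgB; [exact: cvg_id|exact: cvg_cst].
apply: (@continuous_glue (fun x => x / (1 + x) ^+ 2)) => x x0.
apply: cvgM; first exact: cvg_id.
have c1 : (fun x : R => 1 + x) @ x --> 1 + x by apply: cvgD; [exact: cvg_cst|exact: cvg_id].
by apply: cvgV; [rewrite expf_neq0// gt_eqF// ltr_wpDr|apply: cvgM].
Qed.

Lemma logstep_eq0 s : s <= 1 -> logstep s = 0.
Proof. by move=> s1; rewrite /logstep max_l ?subr_le0// addr0 ln1 invr1 add0r subrr. Qed.

Lemma logstepE s : 1 <= s -> logstep s = ln s + s^-1 - 1.
Proof. by move=> s1; rewrite /logstep max_r ?subr_ge0// addrCA subrr addr0. Qed.

Lemma logstep_le s : 1 <= s -> logstep s <= ln s.
Proof.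
move=> s1; rewrite logstepE// -addrA gerDl subr_le0 invf_le1//.
exact: lt_le_trans s1.
Qed.

Lemma logstep_ge s : 1 <= s -> ln s - 1 <= logstep s.
Proof.
by move=> s1; rewrite logstepE// lerD2r lerDl invr_ge0 (le_trans _ s1).
Qed.

Lemma logstep_ge0 s : 0 <= logstep s.
Proof.
have [s1|s1] := leP s 1; first by rewrite logstep_eq0.
have s0 : 0 < s by rewrite (lt_trans _ s1).
rewrite (logstepE (ltW s1)) -addrA.
have := @le_ln1Dx R (s^-1 - 1); rewrite (addrC 1) subrK lnV ?posrE//.
have : -1 < s^-1 - 1 by rewrite ltrBrDr addNr invr_gt0.
by move=> h /(_ h); lra.
Qed.

Lemma logstep'_ge0 s : 0 <= logstep' s.
Proof. by rewrite divr_ge0 ?sqr_ge0// le_max lexx. Qed.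

Lemma logstep'_le s : s * logstep' s <= 1.
Proof.
have [s1|s1] := leP s 1; rewrite /logstep'; first by rewrite max_l ?subr_le0// mul0r mulr0.
have s0 : 0 < s by rewrite (lt_trans _ s1).
have s10 : 0 <= s - 1 by rewrite subr_ge0 ltW.
rewrite (max_r s10) (addrC 1) subrK mulrA ler_pdivrMr ?exprn_gt0// mul1r.
by rewrite expr2 ler_wpM2l ?(ltW s0)// gerDl lerN10.
Qed.

(** [s ^ 2 / (1 + s ^ 2)] continued by [0] below [0].  It rises to [1] fast enough for
    [cutoff'] and [1 - cutoff ^ 2] to compensate the factor [(s + 1) ^ 2] that comes from
    the square of the ground state. *)
Definition cutoff (s : R) : R := Num.max 0 s ^+ 2 / (1 + Num.max 0 s ^+ 2).
Definition cutoff' (s : R) : R := 2 * Num.max 0 s / (1 + Num.max 0 s ^+ 2) ^+ 2.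

Let cutoff_den (x : R) : 0 < 1 + x ^+ 2.
Proof. by rewrite ltr_wpDr ?sqr_ge0. Qed.

Lemma is_derive_cutoff (s : R) : is_derive s (1 : R) cutoff (cutoff' s).
Proof.
apply: (@is_derive_glue (fun x => x ^+ 2 / (1 + x ^+ 2)) (fun x => 2 * x / (1 + x ^+ 2) ^+ 2)).
- move=> x _.
  have d1 : is_derive x (1 : R) (fun x => 1 + x ^+ 2) (2 * x).
    by apply: is_derive_eq; rewrite /GRing.scale/=; ring.
  have d2 : is_derive x (1 : R) (fun x => x ^+ 2) (2 * x).
    by apply: is_derive_eq; rewrite /GRing.scale/=; ring.
  have xn : 1 + x ^+ 2 != 0 by rewrite gt_eqF.
  have d3 := @is_deriveV R (fun x => 1 + x ^+ 2) x _ 1 xn d1.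
  have := is_deriveM d2 d3 => d4.
  have -> : (fun x : R => x ^+ 2 / (1 + x ^+ 2)) = (fun x => x ^+ 2) * (fun x => (1 + x ^+ 2)^-1) by [].
  by apply: is_derive_eq; rewrite /GRing.scale/=; field.
- by rewrite expr0n/= mul0r.
- by rewrite mulr0 mul0r.
Qed.

Lemma continuous_cutoff' : continuous cutoff'.
Proof.
apply: (@continuous_glue (fun x => 2 * x / (1 + x ^+ 2) ^+ 2)) => x _.
apply: cvgM; first by apply: cvgMr; exact: cvg_id.
have c1 : (fun x : R => 1 + x ^+ 2) @ x --> 1 + x ^+ 2.
  by apply: cvgD; [exact: cvg_cst|apply: cvgM; exact: cvg_id].
by apply: cvgV; [rewrite expf_neq0// gt_eqF|apply: cvgM].
Qed.

Lemma cutoff_eq0 s : s <= 0 -> cutoff s = 0.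
Proof. by move=> s0; rewrite /cutoff max_l// expr0n/= mul0r. Qed.

Lemma cutoff_ge0 s : 0 <= cutoff s.
Proof. by rewrite divr_ge0 ?sqr_ge0// ltW. Qed.

Lemma cutoff_le1 s : cutoff s <= 1.
Proof. by rewrite /cutoff ler_pdivrMr// mul1r lerDr. Qed.

Lemma cutoff'_ge0 s : 0 <= cutoff' s.
Proof. by rewrite divr_ge0 ?sqr_ge0// mulr_ge0// le_max lexx. Qed.

Lemma cutoff'_le s : (s + 1) ^+ 2 * cutoff' s <= 2.
Proof.
have [s0|s0] := leP s 0; rewrite /cutoff'; first by rewrite max_l// mulr0 mul0r mulr0.
rewrite (max_r (ltW s0)) mulrA ler_pdivrMr ?exprn_gt0//.
have h1 : (s + 1) ^+ 2 <= 2 * (1 + s ^+ 2).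
  by rewrite -subr_ge0 (_ : _ - _ = (s - 1) ^+ 2) ?sqr_ge0//; ring.
have h2 : 2 * s <= 1 + s ^+ 2.
  by rewrite -subr_ge0 (_ : _ - _ = (s - 1) ^+ 2) ?sqr_ge0//; ring.
rewrite [(1 + _) ^+ 2]expr2 [leRHS]mulrA; apply: ler_pM => //; first exact: sqr_ge0.
by rewrite mulr_ge0// ltW.
Qed.

Lemma cutoff_compl s : -1 <= s -> (s + 1) ^+ 2 * (1 - cutoff s ^+ 2) <= 4.
Proof.
move=> s1; have [s0|s0] := leP s 0.
  rewrite cutoff_eq0// expr0n/= subr0 mulr1.
  have : (s + 1) ^+ 2 <= 1 ^+ 2 by rewrite ler_pXn2r ?nnegrE//; lra.
  by lra.
have h : 1 - cutoff s ^+ 2 <= 2 / (1 + s ^+ 2).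
  have -> : 1 - cutoff s ^+ 2 = (1 - cutoff s) * (1 + cutoff s) by ring.
  have -> : 2 / (1 + s ^+ 2) = (1 + s ^+ 2)^-1 * 2 by rewrite mulrC.
  have -> : 1 - cutoff s = (1 + s ^+ 2)^-1.
    by rewrite /cutoff (max_r (ltW s0)); field; rewrite gt_eqF.
  by rewrite ler_wpM2l ?invr_ge0 ?(ltW (cutoff_den s))//; have := cutoff_le1 s; lra.
apply: (@le_trans _ _ ((s + 1) ^+ 2 * (2 / (1 + s ^+ 2)))); first by rewrite ler_wpM2l ?sqr_ge0.
rewrite mulrA ler_pdivrMr// -subr_ge0 (_ : _ - _ = 2 * (s - 1) ^+ 2); last by ring.
by rewrite mulr_ge0 ?sqr_ge0.
Qed.

End Truncation.

(** * The trial function *)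
Section TrialFunction.
Local Set Implicit Arguments.
Local Unset Strict Implicit.
Context {R : realType}.
Local Notation mR := (measurableTypeR R).
Local Notation plane := (mR * mR)%type.
Local Notation leb := (@lebesgue_measure R).
Local Notation leb2 := (leb \x leb)%E.

Lemma integral_derivative_oo (F f : R -> R) (b : R) : 0 <= b ->
  (forall x : R, is_derive x (1 : R) F (f x)) -> continuous f ->
  (\int[leb]_(x in `]0%R, b[) (f x)%:E = (F b - F 0)%:E)%E.
Proof.
move=> b0 dF cf.
have mf : measurable_fun setT (fun x => (f x)%:E).
  by apply/measurable_EFinP; exact: continuous_measurable_fun.
rewrite integral_itv_obnd_cbnd; last exact: measurable_funTS.
rewrite integral_itv_bndo_bndc; last exact: measurable_funTS.
by apply: integral_derivative => // x _; exact: cf.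
Qed.

Lemma measurable_fun_continuous2 (F : R * R -> R) : continuous F ->
  measurable_fun (setT : set plane) (fun p => (F p)%:E).
Proof. by move=> cF; apply/measurable_EFinP; exact: measurable_continuous2. Qed.

Variables (R1 R2 : R) (R10 : 0 < R1) (R12 : R1 < R2).
Let R20 : 0 < R2 := lt_trans R10 R12.
Local Notation gs := (gs R2).
Local Notation gsr := (gsr R2).
Local Notation a := (gs_scale R2).
Local Notation N0 := (gs_norm R2).

Lemma integral_quarter_disc_le (F : R * R -> R) (c : R) : continuous F -> (forall p, 0 <= F p) ->
  (forall t, (\int[leb]_(r in `]0%R, R2[) (F (polar r t) * r)%:E <= c%:E)%E) ->
  (\int[leb2]_(p in quarter_disc R2) (F p)%:E <= (c * (pi / 2))%:E)%E.
Proof.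
move=> cF F0 h; have pi0 := pi_gt0 R; have mF := measurable_fun_continuous2 cF.
rewrite (integral_quarter_disc_real R20 mF F0).
have c0 : 0 <= c.
  rewrite -lee_fin; apply: le_trans (h 0); apply: integral_ge0 => r /=.
  by rewrite in_itv/= => /andP[r0 _]; rewrite lee_fin mulr_ge0// ltW.
apply: (@le_trans _ _ (\int[leb]_(t in `]0%R, (pi / 2)%R[) cst c%:E t)%E).
  have m1 : measurable_fun (setT : set plane) (fun z : plane => z.1 : R) by exact: measurable_fst.
  have m2 : measurable_fun (setT : set plane) (fun z : plane => z.2 : R) by exact: measurable_snd.
  apply: ge0_le_integral => //.
  - move=> t _; apply: integral_ge0 => r /=.
    by rewrite in_itv/= => /andP[r0 _]; rewrite lee_fin mulr_ge0// ltW.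
  - apply: (@measurable_integral_r _ `]0, (pi / 2)[%classic `]0, R2[%classic
      (fun t r => (F (polar r t) * r)%:E)) => //.
      exact: measurable_polar_weight mF m2 m1.
    by move=> t r _ /=; rewrite in_itv/= => /andP[r0 _]; rewrite lee_fin mulr_ge0// ltW.
rewrite integral_cst// [(c * _)%:E]EFinM le_eqVlt; apply/orP; left; apply/eqP; congr (_ * _)%E.
apply: (etrans (lebesgue_measure_itv `]0, (pi / 2)[)).
by rewrite /= lte_fin divr_gt0// -EFinB subr0.
Qed.

Variables (rho : R) (rho0 : 0 < rho) (rhoR1 : rho < R1).

Lemma integral_half_disc_le (F : R * R -> R) (c : R) : continuous F -> (forall p, 0 <= F p) ->
  (forall t, (\int[leb]_(r in `]0%R, rho[) (F (r * cos t, R1 + r * sin t) * r)%:E <= c%:E)%E) ->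
  (\int[leb2]_(p in half_disc R1 rho) (F p)%:E <= (c * pi)%:E)%E.
Proof.
move=> cF F0 h; have pi0 := pi_gt0 R; have mF := measurable_fun_continuous2 cF.
rewrite (integral_half_disc_real R1 rho0 mF F0).
have c0 : 0 <= c.
  rewrite -lee_fin; apply: le_trans (h 0); apply: integral_ge0 => r /=.
  by rewrite in_itv/= => /andP[r0 _]; rewrite lee_fin mulr_ge0// ltW.
have m1 : measurable_fun (setT : set plane) (fun z : plane => z.1 : R) by exact: measurable_fst.
have m2 : measurable_fun (setT : set plane) (fun z : plane => z.2 : R) by exact: measurable_snd.
have mI : measurable (`](- (pi / 2)), (pi / 2)[%classic : set mR) by exact: measurable_itv.
apply: (@le_trans _ _ (\int[leb]_(t in `](- (pi / 2))%R, (pi / 2)%R[) cst c%:E t)%E).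
  apply: ge0_le_integral => //.
  - move=> t _; apply: integral_ge0 => r /=.
    by rewrite in_itv/= => /andP[r0 _]; rewrite lee_fin mulr_ge0// ltW.
  - apply: (@measurable_integral_r _ `](- (pi / 2)), (pi / 2)[%classic `]0, rho[%classic
      (fun t r => (F (r * cos t, R1 + r * sin t) * r)%:E)) => //.
      apply: measurable_weight => //.
        by apply: measurable_funM => //; exact: (measurableT_comp (@measurable_cos R)).
      apply: measurable_funD => //; apply: measurable_funM => //.
      exact: (measurableT_comp (@measurable_sin R)).
    by move=> t r _ /=; rewrite in_itv/= => /andP[r0 _]; rewrite lee_fin mulr_ge0// ltW.
rewrite integral_cst// [(c * _)%:E]EFinM le_eqVlt; apply/orP; left; apply/eqP; congr (_ * _)%E.
apply: (etrans (lebesgue_measure_itv `](- (pi / 2)), (pi / 2)[)); rewrite /= lte_fin.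
by rewrite (lt_trans (_ : _ < 0)) ?oppr_lt0 ?divr_gt0// -EFinB; congr EFin; field.
Qed.

Let is_derive_half_sqr (x : R) : is_derive x (1 : R) (fun x : R => x ^+ 2 / 2) x.
Proof. by apply: is_derive_eq; rewrite /GRing.scale/=; field. Qed.

Lemma area_quarter_disc (c : R) : 0 <= c ->
  (\int[leb2]_(p in quarter_disc R2) c%:E <= (c * (R2 ^+ 2 / 2) * (pi / 2))%:E)%E.
Proof.
move=> c0; apply: (@integral_quarter_disc_le (cst c)) => //; first by move=> p; exact: cst_continuous.
have d (x : R) : is_derive x (1 : R) (fun r => c * (r ^+ 2 / 2)) (c * x).
  by have h := is_derive_half_sqr x; apply: is_derive_eq; rewrite /GRing.scale/=; field.
have cd : continuous (fun r => c * r) by move=> x; apply: cvgMr; exact: cvg_id.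
have E := integral_derivative_oo (ltW R20) d cd.
by move=> t; rewrite [leLHS]E lee_fin expr0n/= mul0r mulr0 subr0.
Qed.

Lemma area_half_disc :
  (\int[leb2]_(p in half_disc R1 rho) 1%:E <= (rho ^+ 2 / 2 * pi)%:E)%E.
Proof.
apply: (@integral_half_disc_le (cst 1)) => //; first by move=> p; exact: cst_continuous.
have d (x : R) : is_derive x (1 : R) (fun r => r ^+ 2 / 2) (1 * x).
  by rewrite mul1r; exact: is_derive_half_sqr.
have cd : continuous (fun r : R => 1 * r) by move=> x; apply: cvgMr; exact: cvg_id.
have E := integral_derivative_oo (ltW rho0) d cd.
by move=> t; rewrite [leLHS]E lee_fin expr0n/= mul0r subr0.
Qed.

Variables (rhoR2 : R1 + rho < R2) (n M : R) (n0 : 0 < n) (M0 : 0 < M).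

(** The trial function is [gs * cutoff level * logstep dist2]: [level] is
    negative near the outer arc and, if [M] is not too small, [dist2] is less than [1]
    near the crack. *)
Definition level (p : R * R) : R := n * (R2 ^+ 2 - (p.1 ^+ 2 + p.2 ^+ 2)) - 1.
Definition dist2 (p : R * R) : R := (p.1 ^+ 2 + (p.2 - R1) ^+ 2) / M.

Lemma has_gradient_level :
  has_gradient level (fun p => - (2 * n * p.1)) (fun p => - (2 * n * p.2)).
Proof.
have h1 := has_gradientM (@has_gradient_fst R) (@has_gradient_fst R).
have h2 := has_gradientM (@has_gradient_snd R) (@has_gradient_snd R).
have h := has_gradientD (has_gradientZ (- n) (has_gradientD h1 h2)) (has_gradient_cst (n * R2 ^+ 2 - 1)).
by move: h; congr has_gradient; apply/funext => p; rewrite /level; ring.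
Qed.

Lemma has_gradient_dist2 :
  has_gradient dist2 (fun p => 2 * p.1 / M) (fun p => 2 * (p.2 - R1) / M).
Proof.
have h1 := has_gradientM (@has_gradient_fst R) (@has_gradient_fst R).
have h3 := has_gradientD (@has_gradient_snd R) (has_gradient_cst (- R1)).
have h2 := has_gradientM h3 h3.
have h := has_gradientZ M^-1 (has_gradientD h1 h2).
by move: h; congr has_gradient; apply/funext => p; rewrite /dist2; ring.
Qed.

Definition chi (p : R * R) : R := cutoff (level p).
Definition psi (p : R * R) : R := logstep (dist2 p).
Definition chix (p : R * R) : R := cutoff' (level p) * - (2 * n * p.1).
Definition chiy (p : R * R) : R := cutoff' (level p) * - (2 * n * p.2).
Definition psix (p : R * R) : R := logstep' (dist2 p) * (2 * p.1 / M).
Definition psiy (p : R * R) : R := logstep' (dist2 p) * (2 * (p.2 - R1) / M).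

Lemma has_gradient_chi : has_gradient chi chix chiy.
Proof. exact: has_gradient_comp is_derive_cutoff (@continuous_cutoff' R) has_gradient_level. Qed.

Lemma has_gradient_psi : has_gradient psi psix psiy.
Proof. exact: has_gradient_comp is_derive_logstep (@continuous_logstep' R) has_gradient_dist2. Qed.

Definition trial (p : R * R) : R := gs p * (chi p * psi p).
Definition trialx (p : R * R) : R :=
  gs p * (chi p * psix p + psi p * chix p) + chi p * psi p * gsx R2 p.
Definition trialy (p : R * R) : R :=
  gs p * (chi p * psiy p + psi p * chiy p) + chi p * psi p * gsy R2 p.

Lemma has_gradient_trial : has_gradient trial trialx trialy.
Proof.
exact: has_gradientM (has_gradient_gs R2) (has_gradientM has_gradient_chi has_gradient_psi).
Qed.

Lemma gs_quarter_disc p : quarter_disc R2 p -> 0 < gs p /\ gs p <= a * (R2 ^+ 2 - (p.1 ^+ 2 + p.2 ^+ 2)).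
Proof.
move=> [p1 p2 pR]; set s := p.1 ^+ 2 + p.2 ^+ 2 in pR *.
have s0 : 0 <= s by rewrite addr_ge0 ?sqr_ge0.
have a0 := gs_scale_gt0 R20.
have gE : gs p = bes (a * s) by rewrite /gs /s !expr2.
have h1 : a * s < bes_zero by rewrite -(scale_R2 R20) ltr_pM2l.
have h0 : 0 <= a * s by rewrite mulr_ge0// ltW.
split; first by rewrite gE bes_gt0// h0.
by rewrite gE mulrBr (scale_R2 R20) bes_le_dist// h0 ltW.
Qed.

Lemma gs_le_gsr p s : 0 <= s -> s ^+ 2 <= p.1 ^+ 2 + p.2 ^+ 2 ->
  p.1 ^+ 2 + p.2 ^+ 2 <= R2 ^+ 2 -> gs p <= gsr s.
Proof.
move=> s0 sp pR; set q := p.1 ^+ 2 + p.2 ^+ 2 in sp pR.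
have q0 : 0 <= q by rewrite addr_ge0 ?sqr_ge0.
have -> : gs p = gsr (Num.sqrt q) by rewrite /gs /gsr sqr_sqrtr// /q !expr2.
apply: (gsr_decr R20) => //.
  by rewrite -(ger0_norm s0) -sqrtr_sqr ler_wsqrtr.
by rewrite -(ger0_norm (ltW R20)) -sqrtr_sqr ler_wsqrtr.
Qed.

Lemma gs_le1 p : quarter_disc R2 p -> gs p <= 1.
Proof.
move=> [p1 p2 pR]; set s := p.1 ^+ 2 + p.2 ^+ 2 in pR *.
have s0 : 0 <= s by rewrite addr_ge0 ?sqr_ge0.
have a0 := gs_scale_gt0 R20.
have gE : gs p = bes (a * s) by rewrite /gs /s !expr2.
have h1 : a * s < bes_zero by rewrite -(scale_R2 R20) ltr_pM2l.
have h0 : 0 <= a * s by rewrite mulr_ge0// ltW.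
by rewrite gE bes_le1// h0 ltW.
Qed.

Lemma chi_bound p : 0 <= chi p <= 1.
Proof. by rewrite cutoff_ge0 cutoff_le1. Qed.

(** The defect of [gs * phi] is [gs ^ 2 * |grad phi| ^ 2]. *)
Lemma defect_trial_le (e P : R) p : 0 < e -> quarter_disc R2 p -> psi p <= P ->
  defect R2 trial trialx trialy p <=
  (1 + e) * (gs p ^+ 2 * (psix p ^+ 2 + psiy p ^+ 2)) +
  (1 + e^-1) * P ^+ 2 * (gs p ^+ 2 * (chix p ^+ 2 + chiy p ^+ 2)).
Proof.
move=> e0 Qp pP; have [g0 _] := gs_quarter_disc Qp.
have e10 : 0 < 1 + e by rewrite addr_gt0.
have eV0 : 0 < 1 + e^-1 by rewrite addr_gt0 ?invr_gt0.
have /andP[c0 c1] := chi_bound p; have p0 : 0 <= psi p by exact: logstep_ge0.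
have c2 : chi p ^+ 2 <= 1 by exact: exprn_ile1.
have p2 : psi p ^+ 2 <= P ^+ 2 by rewrite ler_pXn2r ?nnegrE// (le_trans p0).
have X : defx R2 trial trialx p = gs p * (chi p * psix p + psi p * chix p).
  by rewrite /defx /trial /trialx; field; rewrite gt_eqF.
have Y : defy R2 trial trialy p = gs p * (chi p * psiy p + psi p * chiy p).
  by rewrite /defy /trial /trialy; field; rewrite gt_eqF.
rewrite /defect X Y; have g2 := sqr_ge0 (gs p); rewrite !(exprMn 2 (gs p) _) -mulrDr.
rewrite [X in _ <= X + _]mulrCA [X in _ <= _ + X]mulrCA -mulrDr ler_wpM2l//.
have hx := sqrD_le (chi p * psix p) (psi p * chix p) e0.
have hy := sqrD_le (chi p * psiy p) (psi p * chiy p) e0.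
apply: (le_trans (lerD hx hy)).
have k1 : (1 + e) * (chi p ^+ 2 * (psix p ^+ 2 + psiy p ^+ 2)) <= (1 + e) * (psix p ^+ 2 + psiy p ^+ 2).
  by rewrite ler_wpM2l ?(ltW e10)// ler_piMl// addr_ge0 ?sqr_ge0.
have k2 : (1 + e^-1) * (psi p ^+ 2 * (chix p ^+ 2 + chiy p ^+ 2)) <=
    (1 + e^-1) * (P ^+ 2 * (chix p ^+ 2 + chiy p ^+ 2)).
  by rewrite ler_wpM2l ?(ltW eV0)// ler_wpM2r// addr_ge0 ?sqr_ge0.
apply: (@le_trans _ _ ((1 + e) * (chi p ^+ 2 * (psix p ^+ 2 + psiy p ^+ 2)) +
    (1 + e^-1) * (psi p ^+ 2 * (chix p ^+ 2 + chiy p ^+ 2)))).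
  by rewrite le_eqVlt; apply/orP; left; apply/eqP; ring.
by rewrite -[(1 + e^-1) * _ * _]mulrA; exact: lerD k1 k2.
Qed.

(** In terms of [level], [gs] is at most [a * (level + 1) / n], so that [cutoff'_le]
    bounds the integrand by a multiple of [cutoff'], whose radial integral is
    explicit. *)
Lemma chi_energy :
  (\int[leb2]_(p in quarter_disc R2) (gs p ^+ 2 * (chix p ^+ 2 + chiy p ^+ 2))%:E <=
   (2 * pi * a ^+ 2 * R2 ^+ 2 / n)%:E)%E.
Proof.
have a0 := gs_scale_gt0 R20; have pi0 := pi_gt0 R.
have mQ := measurable_quarter_disc R2.
have cl := has_gradient_continuous has_gradient_level.
have [_ _ _ cchix cchiy] := has_gradient_chi.
have cg := has_gradient_continuous (has_gradient_gs R2).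
pose F p := 8 * a ^+ 2 * R2 ^+ 2 * cutoff' (level p).
have cF : continuous F.
  move=> p; apply: cvgMr; apply: (@continuous_comp _ _ _ level cutoff'); first exact: cl.
  exact: continuous_cutoff'.
have F0 p : 0 <= F p by have := cutoff'_ge0 (level p) => h; rewrite /F; positivity.
apply: (@le_trans _ _ (\int[leb2]_(p in quarter_disc R2) (F p)%:E)%E).
  apply: ge0_le_integral => //.
  - by move=> p _; rewrite lee_fin mulr_ge0 ?addr_ge0 ?sqr_ge0.
  - apply: measurable_funTS; apply: measurable_fun_continuous2 => p.
    apply: cvgM; first by apply: cvgM; exact: cg.
    by apply: cvgD; apply: cvgM; (exact: cchix || exact: cchiy).
  - by apply: measurable_funTS; exact: measurable_fun_continuous2.
  move=> p Qp; rewrite lee_fin; have [g0 g1] := gs_quarter_disc Qp; have [p1 p2 pR] := Qp.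
  set s := p.1 ^+ 2 + p.2 ^+ 2 in g1 pR.
  have lE : R2 ^+ 2 - s = (level p + 1) / n by rewrite /level subrK mulrC mulKf// gt_eqF.
  rewrite lE in g1; have c0 := cutoff'_ge0 (level p); have c2 := cutoff'_le (level p).
  have -> : chix p ^+ 2 + chiy p ^+ 2 = cutoff' (level p) ^+ 2 * (4 * n ^+ 2 * s).
    by rewrite /chix /chiy /s; ring.
  have g2 : gs p ^+ 2 <= (a * ((level p + 1) / n)) ^+ 2.
    by rewrite ler_pXn2r ?nnegrE ?(ltW g0)// (le_trans (ltW g0)).
  apply: (@le_trans _ _ ((a * ((level p + 1) / n)) ^+ 2 * (cutoff' (level p) ^+ 2 * (4 * n ^+ 2 * R2 ^+ 2)))).
    have s0 : 0 <= s by rewrite addr_ge0 ?sqr_ge0.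
    apply: ler_pM => //; first exact: sqr_ge0; first by positivity.
    by rewrite ler_wpM2l ?sqr_ge0// ler_wpM2l ?mulr_ge0 ?sqr_ge0// ltW.
  have -> : (a * ((level p + 1) / n)) ^+ 2 * (cutoff' (level p) ^+ 2 * (4 * n ^+ 2 * R2 ^+ 2)) =
      4 * a ^+ 2 * R2 ^+ 2 * cutoff' (level p) * ((level p + 1) ^+ 2 * cutoff' (level p)).
    by field; rewrite gt_eqF.
  have -> : F p = 4 * a ^+ 2 * R2 ^+ 2 * cutoff' (level p) * 2 by rewrite /F; ring.
  by rewrite ler_wpM2l//; positivity.
have -> : 2 * pi * a ^+ 2 * R2 ^+ 2 / n = (4 * a ^+ 2 * R2 ^+ 2 / n) * (pi / 2).
  by move: (pi : R) => q; field; rewrite gt_eqF.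
apply: (integral_quarter_disc_le cF F0) => t.
pose lr r := n * (R2 ^+ 2 - r ^+ 2) - 1.
have lrE r : level (polar r t) = lr r by rewrite /level /lr polar_sqnorm.
pose G r := - (4 * a ^+ 2 * R2 ^+ 2 / n * cutoff (lr r)).
have dG (r : R) : is_derive r (1 : R) G (F (polar r t) * r).
  have dl : is_derive r (1 : R) lr (- (2 * n * r)).
    by apply: is_derive_eq; rewrite /GRing.scale/=; ring.
  have := is_derive1_comp (is_derive_cutoff (lr r)) dl => d.
  have -> : G = (fun r => - (4 * a ^+ 2 * R2 ^+ 2 / n) * (cutoff \o lr) r).
    by apply/funext => x; rewrite /G mulNr.
  apply: is_derive_eq; rewrite /F lrE /GRing.scale/=; field.
  by rewrite gt_eqF.
have cG : continuous (fun r => F (polar r t) * r).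
  have cr : continuous (fun r => F (polar r t)) by exact: continuous_ray.
  by move=> r; apply: cvgM; [exact: cr|exact: cvg_id].
rewrite (integral_derivative_oo (ltW R20) dG cG) lee_fin /G opprK addrC -mulrBr.
rewrite -[leRHS]mulr1 ler_wpM2l//; first by positivity.
have := cutoff_ge0 (lr R2); have := cutoff_le1 (lr 0); lra.
Qed.

(** With [s = r ^ 2 / M], the bound [s * logstep' s <= 1] turns the radial density into
    the derivative of [2 * logstep s]. *)
Lemma psi_energy_half_disc :
  (\int[leb2]_(p in half_disc R1 rho) (psix p ^+ 2 + psiy p ^+ 2)%:E <=
   (2 * logstep (rho ^+ 2 / M) * pi)%:E)%E.
Proof.
have [_ _ _ cpx cpy] := has_gradient_psi.
have cF : continuous (fun p => psix p ^+ 2 + psiy p ^+ 2).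
  by move=> p; apply: cvgD; apply: cvgM; (exact: cpx || exact: cpy).
apply: (integral_half_disc_le cF) => [p|t]; first by rewrite addr_ge0 ?sqr_ge0.
pose G r := 2 * logstep (r ^+ 2 / M).
pose g r := 2 * (logstep' (r ^+ 2 / M) * (2 * r / M)).
have ds (r : R) : is_derive r (1 : R) (fun r : R => r ^+ 2 / M) (2 * r / M).
  by apply: is_derive_eq; rewrite /GRing.scale/=; ring.
have dG (r : R) : is_derive r (1 : R) G (g r).
  have := @is_derive1_comp R logstep (fun r : R => r ^+ 2 / M) r _ _ (is_derive_logstep _) (ds r) => d.
  have -> : G = (fun r => 2 * (logstep \o (fun r : R => r ^+ 2 / M)) r) by [].
  by apply: is_derive_eq; rewrite /g /GRing.scale/=; ring.
have cg : continuous g.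
  move=> r; apply: cvgMr; apply: cvgM.
    apply: (@continuous_comp R R R (fun r : R => r ^+ 2 / M) logstep' r).
      by apply: cvgMl; apply: cvgM; exact: cvg_id.
    exact: continuous_logstep'.
  by apply: cvgMl; apply: cvgMr; exact: cvg_id.
have E := integral_derivative_oo (ltW rho0) dG cg.
apply: (@le_trans _ _ (\int[leb]_(r in `]0%R, rho[) (g r)%:E)%E); last first.
  rewrite E lee_fin /G expr0n/= mul0r (@logstep_eq0 _ 0)// mulr0 subr0.
  by [].
have mp : measurable_fun (setT : set plane) (fun p => (psix p ^+ 2 + psiy p ^+ 2)%:E).
  exact: measurable_fun_continuous2.
apply: ge0_le_integral => //.
- by move=> r /=; rewrite in_itv/= => /andP[r0 _]; rewrite lee_fin mulr_ge0 ?addr_ge0 ?sqr_ge0 ?(ltW r0).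
- apply: measurable_funTS; apply: (measurable_weight mp) => //.
    by apply: measurable_funM.
  by apply: measurable_funD => //; apply: measurable_funM.
- by apply: measurable_funTS; apply/measurable_EFinP; exact: continuous_measurable_fun.
move=> r /=; rewrite in_itv/= => /andP[r0 _]; rewrite lee_fin.
have qE : dist2 (r * cos t, R1 + r * sin t) = r ^+ 2 / M.
  by rewrite /dist2/= [R1 + _]addrC addrK polar_sqnorm.
have -> : psix (r * cos t, R1 + r * sin t) ^+ 2 + psiy (r * cos t, R1 + r * sin t) ^+ 2 =
    logstep' (r ^+ 2 / M) ^+ 2 * (4 * r ^+ 2 / M ^+ 2).
  rewrite /psix /psiy qE/= [R1 + _]addrC addrK -(polar_sqnorm r t); move: (logstep' _) => l.
  by field; rewrite gt_eqF.
have l0 := logstep'_ge0 (r ^+ 2 / M); have l1 := logstep'_le (r ^+ 2 / M).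
have -> : logstep' (r ^+ 2 / M) ^+ 2 * (4 * r ^+ 2 / M ^+ 2) * r =
    g r * (r ^+ 2 / M * logstep' (r ^+ 2 / M)).
  by rewrite /g; move: (logstep' _) => l; field; rewrite gt_eqF.
rewrite ler_piMr// /g; positivity.
Qed.

(** In the half disc [gs] is at most [gsr (R1 - rho)]; elsewhere the gradient of [psi]
    is at most [2 / rho]. *)
Lemma psi_energy :
  (\int[leb2]_(p in quarter_disc R2) (gs p ^+ 2 * (psix p ^+ 2 + psiy p ^+ 2))%:E <=
   (gsr (R1 - rho) ^+ 2 * (2 * logstep (rho ^+ 2 / M) * pi) +
    4 / rho ^+ 2 * (R2 ^+ 2 / 2) * (pi / 2))%:E)%E.
Proof.
have mQ := measurable_quarter_disc R2; have mH := measurable_half_disc R1 rho.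
have [_ _ _ cpx cpy] := has_gradient_psi.
have cg := has_gradient_continuous (has_gradient_gs R2).
pose D p := psix p ^+ 2 + psiy p ^+ 2.
have cD : continuous D.
  by move=> p; apply: cvgD; apply: cvgM; (exact: cpx || exact: cpy).
have D0 p : 0 <= D p by rewrite addr_ge0 ?sqr_ge0.
have mD := measurable_fun_continuous2 cD.
pose m := gsr (R1 - rho) ^+ 2.
have m0 : 0 <= m by exact: sqr_ge0.
pose F p := ((fun p => (m * D p)%:E) \_ (half_disc R1 rho)) p.
have mF : measurable_fun (setT : set plane) F.
  apply/(measurable_restrict _ mH) => //; apply: measurable_funTS.
  by apply: measurable_fun_continuous2 => p; apply: cvgMr; exact: cD.
have F0 p : (0 <= F p)%E.
  by rewrite /F patchE; case: ifP => // _; rewrite lee_fin mulr_ge0.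
have r40 : 0 <= 4 / rho ^+ 2 by positivity.
apply: (@le_trans _ _ (\int[leb2]_(p in quarter_disc R2) (F p + (4 / rho ^+ 2)%:E))%E).
  apply: ge0_le_integral => //.
  - by move=> p _; rewrite lee_fin; apply: mulr_ge0; [exact: sqr_ge0|exact: D0].
  - apply: measurable_funTS; apply: measurable_fun_continuous2 => p.
    by apply: cvgM; [apply: cvgM; exact: cg|exact: cD].
  - by apply: emeasurable_funD => //; exact: measurable_funTS.
  move=> p Qp; have [g0 _] := gs_quarter_disc Qp; have g1 := gs_le1 Qp.
  have [p1 p2 pR] := Qp.
  rewrite /F patchE; case: ifPn => [|].
    rewrite inE => -[_ pH]; apply: (@le_trans _ _ (m * D p)%:E); last by rewrite leeDl// lee_fin.
    have gm : gs p <= gsr (R1 - rho).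
      apply: gs_le_gsr; rewrite ?(ltW pR) ?subr_ge0 ?(ltW rhoR1)//.
      have : (p.2 - R1) ^+ 2 < rho ^+ 2 by apply: le_lt_trans pH; rewrite lerDr sqr_ge0.
      rewrite -[ltRHS]real_normK ?num_real// -[ltLHS]real_normK ?num_real//.
      rewrite ltr_pXn2r ?nnegrE// (gtr0_norm rho0) ltr_norml => /andP[h1 h2].
      apply: (@le_trans _ _ (p.2 ^+ 2)); last by rewrite lerDr sqr_ge0.
      rewrite ler_pXn2r ?nnegrE ?(ltW p2) ?subr_ge0 ?(ltW rhoR1)//; lra.
    rewrite lee_fin; apply: ler_wpM2r; first exact: D0.
    by rewrite /m ler_pXn2r ?nnegrE ?(ltW g0)// (le_trans (ltW g0)).
  rewrite notin_setE => nH; rewrite add0e lee_fin.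
  have far : rho ^+ 2 <= p.1 ^+ 2 + (p.2 - R1) ^+ 2.
    by rewrite leNgt; apply/negP => h; apply: nH; split.
  have DE : D p = 4 * (logstep' (dist2 p) * dist2 p) ^+ 2 / (p.1 ^+ 2 + (p.2 - R1) ^+ 2).
    rewrite /D /psix /psiy /dist2; set s := p.1 ^+ 2 + (p.2 - R1) ^+ 2 in far *.
    have s0 : 0 < s by apply: lt_le_trans far; rewrite exprn_gt0.
    rewrite [in LHS](_ : (logstep' (s / M) * (2 * p.1 / M)) ^+ 2 + (logstep' (s / M) * (2 * (p.2 - R1) / M)) ^+ 2 =
      logstep' (s / M) ^+ 2 * (4 * s) / M ^+ 2).
      by move: (logstep' _) => l; field; rewrite !gt_eqF.
    by rewrite /s; move: (logstep' _) => l; field; rewrite !gt_eqF.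
  have s0 : 0 < p.1 ^+ 2 + (p.2 - R1) ^+ 2 by apply: lt_le_trans far; rewrite exprn_gt0.
  have d0 : 0 <= dist2 p by rewrite divr_ge0 ?(ltW s0) ?(ltW M0).
  have := logstep'_le (dist2 p); rewrite mulrC => l1.
  have l0 : 0 <= logstep' (dist2 p) * dist2 p by rewrite mulr_ge0 ?logstep'_ge0.
  apply: (@le_trans _ _ (1 * (4 * 1 / rho ^+ 2))); last by rewrite mulr1 mul1r.
  apply: ler_pM; [exact: sqr_ge0|exact: D0|by apply: exprn_ile1; rewrite ?(ltW g0)|].
  rewrite -/(D p) DE; apply: ler_pM; [by rewrite mulr_ge0 ?sqr_ge0|by rewrite invr_ge0 ltW| |].
    by rewrite ler_wpM2l// exprn_ile1.
  by rewrite lef_pV2 ?posrE// exprn_gt0.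
rewrite ge0_integralD//; last exact: measurable_funTS.
rewrite EFinD; apply: leeD; last exact: area_quarter_disc.
rewrite /F -integral_mkcondr.
rewrite (_ : quarter_disc R2 `&` half_disc R1 rho = half_disc R1 rho); last first.
  by apply: setIidr; exact: half_disc_quarter rho0 rhoR1 rhoR2.
under eq_integral do rewrite EFinM.
rewrite ge0_integralZl//; last 2 first.
- exact: measurable_funTS.
- by move=> p _; rewrite lee_fin.
by rewrite [in leRHS]EFinM lee_wpmul2l ?lee_fin//; exact: psi_energy_half_disc.
Qed.

(** Outside the half disc [psi] is at least [Y].  What the norm of [Y * gs] loses is at
    most the area of the half disc and the integral of [gs ^ 2 * (1 - chi ^ 2)], which
    is small since [gs] is small where [chi] differs from [1]. *)
Lemma trial_norm (Y : R) : 0 <= Y -> 1 <= rho ^+ 2 / M -> Y <= ln (rho ^+ 2 / M) - 1 ->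
  ((Y ^+ 2 * (gs_norm R2 - rho ^+ 2 / 2 * pi - 4 * a ^+ 2 / n ^+ 2 * (R2 ^+ 2 / 2) * (pi / 2)))%:E <=
   \int[leb2]_(p in quarter_disc R2) (trial p ^+ 2)%:E)%E.
Proof.
move=> Y0 q1 Yq; have a0 := gs_scale_gt0 R20.
have mQ := measurable_quarter_disc R2; have mH := measurable_half_disc R1 rho.
have cg := has_gradient_continuous (has_gradient_gs R2).
have ct := has_gradient_continuous has_gradient_trial.
pose w := 4 * a ^+ 2 / n ^+ 2.
have w0 : 0 <= w by rewrite /w; positivity.
have mt : measurable_fun (setT : set plane) (fun p => (trial p ^+ 2)%:E).
  by apply: measurable_fun_continuous2 => p; apply: cvgM; exact: ct.
pose F p := ((cst (1%:E : \bar R)) \_ (half_disc R1 rho)) p.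
have mF : measurable_fun (setT : set plane) F.
  by apply/(measurable_restrict _ mH) => //; exact: measurable_cst.
have F0 p : (0 <= F p)%E by rewrite /F patchE; case: ifP => // _; rewrite lee_fin.
have IF : (\int[leb2]_(p in quarter_disc R2) F p <= (rho ^+ 2 / 2 * pi)%:E)%E.
  rewrite /F -integral_mkcondr (_ : quarter_disc R2 `&` half_disc R1 rho = half_disc R1 rho).
    exact: area_half_disc.
  by apply: setIidr; exact: half_disc_quarter rho0 rhoR1 rhoR2.
have IW := area_quarter_disc w0.
have Y20 : 0 <= Y ^+ 2 by exact: sqr_ge0.
have key : ((Y ^+ 2 * N0)%:E <= \int[leb2]_(p in quarter_disc R2) (trial p ^+ 2)%:E +
    (Y ^+ 2)%:E * (\int[leb2]_(p in quarter_disc R2) F p + \int[leb2]_(p in quarter_disc R2) w%:E))%E.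
  rewrite EFinM -(integral_gs2 R20) -ge0_integralD//; last exact: measurable_funTS.
  have mgs : measurable_fun (setT : set plane) (fun p => (gs p ^+ 2)%:E).
    by apply: measurable_fun_continuous2 => p; apply: cvgM; exact: cg.
  have mFw : measurable_fun (quarter_disc R2 : set plane) (fun p => F p + w%:E)%E.
    by apply: emeasurable_funD => //; exact: measurable_funTS.
  rewrite -ge0_integralZl//; last by move=> p _; rewrite adde_ge0// lee_fin.
  rewrite -ge0_integralZl//; last 2 first.
  - exact: measurable_funTS.
  - by move=> p _; rewrite lee_fin sqr_ge0.
  rewrite -ge0_integralD//; last 4 first.
  - by move=> p _; rewrite lee_fin sqr_ge0.
  - exact: measurable_funTS.
  - by move=> p _; rewrite mule_ge0 ?lee_fin// adde_ge0// lee_fin.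
  - exact: emeasurable_funM.
  apply: ge0_le_integral => //.
  - by move=> p _; rewrite -EFinM lee_fin mulr_ge0 ?sqr_ge0.
  - by apply: emeasurable_funM => //; exact: measurable_funTS.
  - by apply: emeasurable_funD; [exact: measurable_funTS|exact: emeasurable_funM].
  move=> p Qp; have [g0 ga] := gs_quarter_disc Qp; have g1 := gs_le1 Qp.
  have [p1 p2 pR] := Qp.
  have g2 : gs p ^+ 2 <= 1 by apply: exprn_ile1; rewrite ?(ltW g0).
  rewrite /F patchE; case: ifPn => [|].
    move=> _; rewrite (_ : (_ + _)%E = (trial p ^+ 2 + Y ^+ 2 * (1 + w))%:E)//.
    rewrite -EFinM lee_fin.
    have h1 : Y ^+ 2 * gs p ^+ 2 <= Y ^+ 2 * (1 + w).
      by rewrite ler_wpM2l// (le_trans g2)// lerDl.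
    by apply: (le_trans h1); rewrite lerDr sqr_ge0.
  rewrite notin_setE => nH; rewrite add0e (_ : (_ + _)%E = (trial p ^+ 2 + Y ^+ 2 * w)%:E)//.
  rewrite -EFinM lee_fin.
  have far : rho ^+ 2 <= p.1 ^+ 2 + (p.2 - R1) ^+ 2.
    by rewrite leNgt; apply/negP => h; apply: nH; split.
  have qd : rho ^+ 2 / M <= dist2 p by rewrite /dist2 ler_wpM2r// invr_ge0 ltW.
  have psiY : Y <= psi p.
    apply: le_trans Yq _; apply: (@le_trans _ _ (ln (dist2 p) - 1)); last first.
      by apply: logstep_ge; exact: le_trans q1 qd.
    rewrite lerD2r ler_ln ?posrE//; first by rewrite (lt_le_trans _ q1).
    by rewrite (lt_le_trans _ qd)// (lt_le_trans _ q1).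
  have psi2 : Y ^+ 2 <= psi p ^+ 2 by rewrite ler_pXn2r ?nnegrE// (le_trans Y0).
  set s := p.1 ^+ 2 + p.2 ^+ 2 in ga pR.
  have lE : R2 ^+ 2 - s = (level p + 1) / n by rewrite /level subrK mulrC mulKf// gt_eqF.
  have l1 : 0 <= level p + 1.
    by have : 0 < (level p + 1) / n; [rewrite -lE subr_gt0|rewrite pmulr_lgt0 ?invr_gt0// => /ltW].
  rewrite lE in ga.
  have gg : gs p ^+ 2 <= a ^+ 2 / n ^+ 2 * (level p + 1) ^+ 2.
    rewrite (_ : _ * _ = (a * ((level p + 1) / n)) ^+ 2).
      by rewrite ler_pXn2r ?nnegrE ?(ltW g0)// (le_trans (ltW g0)).
    by field; rewrite gt_eqF.
  have /andP[c0 c1] := chi_bound p.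
  have cc : 0 <= 1 - chi p ^+ 2 by rewrite subr_ge0; exact: exprn_ile1.
  have gw : gs p ^+ 2 * (1 - chi p ^+ 2) <= w.
    apply: (@le_trans _ _ (a ^+ 2 / n ^+ 2 * ((level p + 1) ^+ 2 * (1 - chi p ^+ 2)))).
      by rewrite mulrA ler_wpM2r.
    rewrite /w (_ : 4 * a ^+ 2 / n ^+ 2 = a ^+ 2 / n ^+ 2 * 4); last by ring.
    rewrite ler_wpM2l//; first by positivity.
    by apply: cutoff_compl; rewrite -subr_ge0 opprK.
  have h1 : Y ^+ 2 * (gs p ^+ 2 * chi p ^+ 2) <= trial p ^+ 2.
    rewrite /trial (_ : (gs p * (chi p * psi p)) ^+ 2 = psi p ^+ 2 * (gs p ^+ 2 * chi p ^+ 2)); last first.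
      by move: (gs p) (chi p) (psi p) => x y z; ring.
    by rewrite ler_wpM2r// mulr_ge0 ?sqr_ge0.
  have h2 : Y ^+ 2 * (gs p ^+ 2 * (1 - chi p ^+ 2)) <= Y ^+ 2 * w by rewrite ler_wpM2l.
  apply: le_trans (lerD h1 h2); rewrite -mulrDr -mulrDr.
  by rewrite (_ : chi p ^+ 2 + (1 - chi p ^+ 2) = 1) ?mulr1// addrCA subrr addr0.
have key2 : ((Y ^+ 2 * N0)%:E <= \int[leb2]_(p in quarter_disc R2) (trial p ^+ 2)%:E +
    (Y ^+ 2)%:E * ((rho ^+ 2 / 2 * pi)%:E + (w * (R2 ^+ 2 / 2) * (pi / 2))%:E))%E.
  apply: (le_trans key); rewrite leeD2l// lee_wpmul2l ?lee_fin//.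
  exact: leeD.
move: key2; rewrite -EFinD -EFinM -leeBlDr// -EFinB => key2; apply: le_trans key2.
by rewrite lee_fin le_eqVlt; apply/orP; left; apply/eqP; rewrite /w; ring.
Qed.

Lemma sin_sqr_le (x : R) : 0 <= x -> sin x ^+ 2 <= x ^+ 2.
Proof.
rewrite le_eqVlt => /predU1P[<-|x0]; first by rewrite sin0.
have ds (y : R) : y \in `]0, x[ -> is_derive y (1 : R) sin (cos y) by move=> _; exact: is_derive_sin.
have cs : {within `[0, x], continuous (@sin R)} by apply: continuous_subspaceT; exact: continuous_sin.
have [y _] := MVT x0 ds cs; rewrite sin0 !subr0 => ->.
rewrite exprMn ler_piMl ?sqr_ge0//; have := cos2Dsin2 y; have := sqr_ge0 (sin y); lra.
Qed.

(** The chord from [(0, R1)] to a crack point at angle [pi / 2 - x] has length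
    [2 * R1 * sin (x / 2)], at most [R1 * d]. *)
Lemma trial_vanishes (d : R) : 0 <= d -> R1 ^+ 2 * d ^+ 2 < M ->
  forall p, dirichlet_part R1 R2 (pi / 2 - d) p -> \forall q \near p, trial q = 0.
Proof.
move=> d0 dM p Gp.
have cl := has_gradient_continuous has_gradient_level.
have cd := has_gradient_continuous has_gradient_dist2.
have near_lt (F : R * R -> R) c : continuous F -> F p < c -> \forall q \near p, F q < c.
  by move=> cF Fc; have := cF p _ (lt_nbhsl Fc).
case: Gp => [[t tI pE]|[t /andP[t0 t1] pE]].
  have : level p < 0 by rewrite -pE /level polar_sqnorm subrr mulr0 sub0r oppr_lt0.
  move/(near_lt _ _ cl); apply: filterS => q q0.
  by rewrite /trial /chi cutoff_eq0 ?mul0r ?mulr0// ltW.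
have : dist2 p < 1.
  rewrite /dist2 ltr_pdivrMr// mul1r; apply: le_lt_trans dM.
  have -> : p.1 ^+ 2 + (p.2 - R1) ^+ 2 = R1 ^+ 2 * (2 * sin ((pi / 2 - t) / 2)) ^+ 2.
    have cE : sin t = 1 - 2 * sin ((pi / 2 - t) / 2) ^+ 2.
      rewrite (_ : sin t = cos ((pi / 2 - t) / 2 + (pi / 2 - t) / 2)); last first.
        by rewrite -splitr cosB cos_pihalf sin_pihalf mul0r mul1r add0r.
      have := cos2Dsin2 ((pi / 2 - t) / 2); rewrite cosD -!expr2.
      move: (cos _) (sin _) => x y c2; apply/eqP.
      by rewrite -subr_eq0 (_ : _ - _ = x ^+ 2 + y ^+ 2 - 1); [rewrite c2 subrr|ring].
    have h := cos2Dsin2 t; rewrite -pE /polar/=.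
    have -> : (R1 * cos t) ^+ 2 + (R1 * sin t - R1) ^+ 2 =
        R1 ^+ 2 * ((cos t ^+ 2 + sin t ^+ 2) + 1 - 2 * sin t) by ring.
    by rewrite h cE; ring.
  rewrite ler_wpM2l ?sqr_ge0//; have x0 : 0 <= (pi / 2 - t) / 2 by lra.
  have := sin_sqr_le x0; move: (sin _) => y h.
  apply: (@le_trans _ _ ((pi / 2 - t) ^+ 2)).
    rewrite exprMn (_ : (pi / 2 - t) ^+ 2 = 2 ^+ 2 * ((pi / 2 - t) / 2) ^+ 2).
      by rewrite ler_wpM2l.
    by move: (pi / 2 - t) => q; field.
  by rewrite ler_pXn2r ?nnegrE//; lra.
move/(near_lt _ _ cd); apply: filterS => q q0.
by rewrite /trial /psi logstep_eq0 ?mulr0// ltW.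
Qed.

End TrialFunction.

(** * The upper bound for the defect *)
Section UpperBound.
Local Set Implicit Arguments.
Local Unset Strict Implicit.
Context {R : realType}.
Local Notation mR := (measurableTypeR R).
Local Notation plane := (mR * mR)%type.
Local Notation leb := (@lebesgue_measure R).
Local Notation leb2 := (leb \x leb)%E.
Variables (R1 R2 : R) (R10 : 0 < R1) (R12 : R1 < R2).
Let R20 : 0 < R2 := lt_trans R10 R12.
Local Notation gs := (gs R2).
Local Notation gsr := (gsr R2).
Local Notation a := (gs_scale R2).
Local Notation N0 := (gs_norm R2).

(** The trial function with [M] comparable to [d ^ 2] has defect about
    [4 * pi * gsr R1 ^ 2 * |ln d|] and square norm about [4 * |ln d| ^ 2 * gs_norm R2].
    The parameter [n], of the order of [|ln d| ^ 2], makes the cost of [chi] at most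
    [1]. *)
Lemma defect_upper_bound k : shift_coef R1 R2 < k ->
  exists2 d0 : R, 0 < d0 & forall d, 0 < d <= d0 ->
  exists f fx fy : R * R -> R, [/\ has_gradient f fx fy,
    forall p, dirichlet_part R1 R2 (pi / 2 - d) p -> \forall q \near p, f q = 0 &
    exists E N : R, [/\ 0 < N, E * `|ln d| <= k * N,
      (\int[leb2]_(p in quarter_disc R2) (defect R2 f fx fy p)%:E <= E%:E)%E &
      (N%:E <= \int[leb2]_(p in quarter_disc R2) (f p ^+ 2)%:E)%E]].
Proof.
move=> kk; have pi0 := pi_gt0 R; have N00 : 0 < N0 := gs_norm_gt0 R20; have a0 := gs_scale_gt0 R20.
have g10 : 0 < gsr R1 by apply: (gsr_gt0 R20); rewrite (ltW R10).
have kN : pi * gsr R1 ^+ 2 < k * N0 by rewrite -ltr_pdivrMr.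
have k0 : 0 < k.
  by rewrite -(pmulr_lgt0 _ N00) (lt_trans _ kN)// mulr_gt0// exprn_gt0.
have [rho [r0 r1 r2 hr]] : exists rho, [/\ 0 < rho, rho < R1, R1 + rho < R2 &
    pi * gsr (R1 - rho) ^+ 2 < k * (N0 - rho ^+ 2 / 2 * pi)].
  pose h (r : R) := k * (N0 - r ^+ 2 / 2 * pi) - pi * gsr (R1 - r) ^+ 2.
  have ch : {for 0, continuous h}.
    have c1 : (fun r : R => gsr (R1 - r)) @ (0 : R) --> gsr (R1 - 0).
      apply: (@continuous_comp R R R (fun r : R => R1 - r) gsr 0); last exact: continuous_gsr.
      by apply: cvgB; [exact: cvg_cst|exact: cvg_id].
    apply: cvgB.
      apply: cvgMr; apply: cvgB; first exact: cvg_cst.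
      by apply: cvgMl; apply: cvgMl; apply: cvgM; exact: cvg_id.
    by apply: cvgMr; apply: cvgM; exact: c1.
  have h0 : 0 < h 0 by rewrite /h expr0n/= !mul0r !subr0 subr_gt0.
  have := ch _ (lt_nbhsr h0) => /nbhs_ballP[e /= e0 he].
  pose rho := Num.min (e / 2) (Num.min (R1 / 2) ((R2 - R1) / 2)).
  have rho0 : 0 < rho by rewrite !lt_min !divr_gt0// subr_gt0.
  have h1 : rho <= e / 2 by rewrite ge_min lexx.
  have h2 : rho <= R1 / 2 by rewrite /rho !ge_min lexx !orbT.
  have h3 : rho <= (R2 - R1) / 2 by rewrite /rho !ge_min lexx !orbT.
  have R1' := R10; have R12' := R12.
  exists rho; split => //; try lra.
  rewrite -subr_gt0; apply: he.
  by rewrite /ball/= sub0r normrN gtr0_norm//; lra.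
pose m := gsr (R1 - rho) ^+ 2.
have m0 : 0 < m.
  rewrite exprn_gt0//; apply: (gsr_gt0 R20); rewrite subr_ge0 (ltW r1)/=.
  by rewrite (lt_trans _ R12)// gtrBl.
pose y := k * (N0 - rho ^+ 2 / 2 * pi) - pi * m.
have y0 : 0 < y by rewrite subr_gt0.
(* [e] and [w] each use up a quarter of the slack [y]. *)
pose e := y / (4 * (pi * m)).
have pm0 : 0 < pi * m by rewrite mulr_gt0.
have e0 : 0 < e by rewrite divr_gt0// mulr_gt0.
pose w := y / (4 * k).
have w0 : 0 < w by rewrite divr_gt0// mulr_gt0.
pose N1 := N0 - rho ^+ 2 / 2 * pi - w.
pose al := (1 + e) * (pi * m).
have alN : al + y / 2 = k * N1.
  rewrite /al /N1 /e /w.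
  have -> : k * (N0 - rho ^+ 2 / 2 * pi - y / (4 * k)) = y + pi * m - y / 4.
    have -> : y + pi * m = k * (N0 - rho ^+ 2 / 2 * pi) by rewrite /y; ring.
    by move: (N0 - rho ^+ 2 / 2 * pi) => z; field; rewrite gt_eqF.
  by move: (pi * m) pm0 => z z0; field; rewrite gt_eqF.
have al0 : 0 < al by rewrite mulr_gt0// addr_gt0.
have N10 : 0 < N1.
  by rewrite -(pmulr_rgt0 _ k0) -alN addr_gt0// divr_gt0.
pose K := R1 ^+ 2 + 1.
have K0 : 0 < K by rewrite addr_gt0// exprn_gt0.
pose c := ln (rho ^+ 2 / K).
pose c3 := ln (4 * R2 ^+ 2 / K).
pose A := 2 * pi * a ^+ 2 * R2 ^+ 2.
have A0 : 0 < A by rewrite /A; positivity.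
pose B := 4 / rho ^+ 2 * (R2 ^+ 2 / 2) * (pi / 2).
pose be := (1 + e) * (m * (2 * c * pi) + B) + 1.
(* Once [|ln d|] exceeds [L0], the rest of the slack absorbs the bounded terms [be], [c]
   and [c3]. *)
pose L0 := 2 * (`|be| + 4 * (k * N1) * `|c - 1|) / y + `|c| + 2 + `|c3|.
exists (expR (- (L0 + 1))); first exact: expR_gt0.
move=> d /andP[d0 dd].
have lnd : ln d <= - (L0 + 1) by rewrite -[leRHS]expRK ler_ln ?posrE ?expR_gt0.
set l := `|ln d|.
have kN10 : 0 < k * N1 by rewrite mulr_gt0.
have q0 : 0 <= 2 * (`|be| + 4 * (k * N1) * `|c - 1|) / y.
  by have := normr_ge0 be; have := normr_ge0 (c - 1) => u1 u2; positivity.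
have cn := normr_ge0 c; have c3n := normr_ge0 c3.
have lE : l = - ln d by rewrite /l ler0_norm// (le_trans lnd)// /L0; clear -R10 R12 R20 q0 cn c3n; lra.
have lL : L0 + 1 <= l by rewrite lE; clear -R10 R12 R20 lnd; lra.
have l1 : 2 * (`|be| + 4 * (k * N1) * `|c - 1|) / y <= l.
  by move: lL; rewrite /L0; clear -R10 R12 R20 cn c3n; lra.
have l2 : `|c| + 2 <= l by move: lL; rewrite /L0; clear -R10 R12 R20 q0 c3n; lra.
have l0 : 0 < l by clear -R10 R12 R20 l2 cn; lra.
have cge : - `|c| <= c by rewrite lerNl -normrN ler_norm.
pose M := K * d ^+ 2.
have M0 : 0 < M by rewrite mulr_gt0// exprn_gt0.
have lnM x : 0 < x -> ln (x / M) = ln (x / K) + 2 * l.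
  move=> x0; rewrite /M invfM mulrA lnM ?posrE ?divr_gt0 ?invr_gt0 ?exprn_gt0//.
  by rewrite lnV ?posrE ?exprn_gt0// lnXn// lE; ring.
have lr : ln (rho ^+ 2 / M) = c + 2 * l by rewrite lnM// exprn_gt0.
have rM0 : 0 < rho ^+ 2 / M by rewrite divr_gt0// exprn_gt0.
have rM1 : 1 <= rho ^+ 2 / M by rewrite -ler_ln ?posrE// ln1 lr; clear -R10 R12 R20 cge l2 cn; lra.
pose P := 2 * l + `|c3|.
have P0 : 0 < P by rewrite /P; clear -R10 R12 R20 l0 c3n; lra.
have eV0 : 0 < 1 + e^-1 by rewrite addr_gt0// invr_gt0.
pose n := (1 + e^-1) * P ^+ 2 * A + (a ^+ 2 * R2 ^+ 2 * pi / w + 1).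
have n1 : 1 <= n.
  rewrite /n addrA lerDr addr_ge0//; by positivity.
have n0 : 0 < n by clear -R10 R12 R20 n1; lra.
have nA : (1 + e^-1) * P ^+ 2 * (A / n) <= 1.
  rewrite mulrA ler_pdivrMr// mul1r /n lerDl; by positivity.
have nw : 4 * a ^+ 2 / n ^+ 2 * (R2 ^+ 2 / 2) * (pi / 2) <= w.
  rewrite (_ : _ * (pi / 2) = a ^+ 2 * R2 ^+ 2 * pi / n ^+ 2); last first.
    by move: (pi : R) => q; field; rewrite gt_eqF.
  rewrite ler_pdivrMr ?exprn_gt0//.
  have h1 : a ^+ 2 * R2 ^+ 2 * pi / w <= n.
    rewrite /n; set z := _ / w; have zz : 0 <= (1 + e^-1) * P ^+ 2 * A by positivity.
    by clear -R10 R12 R20 zz; lra.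
  rewrite ler_pdivrMr// in h1; rewrite (le_trans h1)// mulrC ler_wpM2l ?(ltW w0)//.
  by rewrite expr2 ler_peMr// ltW.
exists (trial R1 R2 n M), (trialx R1 R2 n M), (trialy R1 R2 n M); split.
- exact: has_gradient_trial.
- have dM : R1 ^+ 2 * d ^+ 2 < M by rewrite /M ltr_pM2r ?exprn_gt0// ltrDl.
  by apply: trial_vanishes => //; exact: ltW.
have ll : logstep (rho ^+ 2 / M) <= c + 2 * l by rewrite -lr; exact: logstep_le.
exists ((1 + e) * (m * (2 * (c + 2 * l) * pi) + B) + 1), ((c + 2 * l - 1) ^+ 2 * N1).
have Y0 : 0 < c + 2 * l - 1 by clear -R10 R12 R20 cge l2 cn; lra.
split.
- by rewrite mulr_gt0// exprn_gt0.
- rewrite -/l (_ : (1 + e) * _ + 1 = be + 4 * al * l); last by rewrite /be /al; ring.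
  have h1 : `|be| + 4 * (k * N1) * `|c - 1| <= y * l / 2.
    by move: l1; rewrite ler_pdivrMr//; clear -R10 R12 R20 y0; lra.
  have h2 : be <= `|be| by exact: ler_norm.
  have h3 : - `|c - 1| <= c - 1 by rewrite lerNl -normrN ler_norm.
  have h4 : 4 * al = 4 * (k * N1) - 2 * y by rewrite -alN; field.
  have h5 : - (4 * (k * N1) * `|c - 1|) <= 4 * (k * N1) * (c - 1).
    by rewrite -mulrN ler_wpM2l// mulr_ge0// ltW.
  have h6 : (be + 4 * al * l) * l <= (4 * (k * N1) * l + 4 * (k * N1) * (c - 1)) * l.
    rewrite ler_pM2r// h4; have yl : 0 < y * l by rewrite mulr_gt0.
    by rewrite mulrBl; clear -R10 R12 R20 h1 h2 h5 yl; lra.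
  apply: (le_trans h6).
  rewrite -subr_ge0 (_ : _ - _ = k * N1 * (c - 1) ^+ 2); last by ring.
  by rewrite mulr_ge0 ?sqr_ge0// ltW.
- have mQ := measurable_quarter_disc R2.
  have ht := has_gradient_trial R1 R2 n M.
  have [_ _ _ cpx cpy] := has_gradient_psi R1 M.
  have [_ _ _ cchix cchiy] := has_gradient_chi R2 n.
  have cg := has_gradient_continuous (has_gradient_gs R2).
  have mpsi : measurable_fun (setT : set plane)
      (fun p => (gs p ^+ 2 * (psix R1 M p ^+ 2 + psiy R1 M p ^+ 2))%:E).
    apply: measurable_fun_continuous2 => p; apply: cvgM; first by apply: cvgM; exact: cg.
    by apply: cvgD; apply: cvgM; (exact: cpx || exact: cpy).
  have mchi : measurable_fun (setT : set plane)
      (fun p => (gs p ^+ 2 * (chix R2 n p ^+ 2 + chiy R2 n p ^+ 2))%:E).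
    apply: measurable_fun_continuous2 => p; apply: cvgM; first by apply: cvgM; exact: cg.
    by apply: cvgD; apply: cvgM; (exact: cchix || exact: cchiy).
  have p1' (p : R * R) : 0 <= gs p ^+ 2 * (psix R1 M p ^+ 2 + psiy R1 M p ^+ 2).
    by apply: mulr_ge0; [exact: sqr_ge0|apply: addr_ge0; exact: sqr_ge0].
  have p2' (p : R * R) : 0 <= gs p ^+ 2 * (chix R2 n p ^+ 2 + chiy R2 n p ^+ 2).
    by apply: mulr_ge0; [exact: sqr_ge0|apply: addr_ge0; exact: sqr_ge0].
  have k1 : 0 <= 1 + e by rewrite addr_ge0// ltW.
  have k2 : 0 <= (1 + e^-1) * P ^+ 2 by positivity.
  apply: (@le_trans _ _ (\int[leb2]_(p in quarter_disc R2)
     ((1 + e)%:E * (gs p ^+ 2 * (psix R1 M p ^+ 2 + psiy R1 M p ^+ 2))%:E +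
      ((1 + e^-1) * P ^+ 2)%:E * (gs p ^+ 2 * (chix R2 n p ^+ 2 + chiy R2 n p ^+ 2))%:E))%E).
    apply: ge0_le_integral => //.
    + by move=> p _; rewrite lee_fin defect_ge0.
    + by apply: measurable_funTS; exact: measurable_defect.
    + by apply: emeasurable_funD; apply: emeasurable_funM => //; exact: measurable_funTS.
    move=> p Qp; rewrite -!EFinM -EFinD lee_fin; apply: (defect_trial_le R10 R12) => //.
    rewrite /psi; have [q1|q1] := leP (dist2 R1 M p) 1; first by rewrite logstep_eq0// ltW.
    apply: (le_trans (logstep_le (ltW q1))).
    have qd : dist2 R1 M p <= 4 * R2 ^+ 2 / M.
      rewrite /dist2 ler_wpM2r ?invr_ge0 ?(ltW M0)//; have [p1 p2 pR] := Qp.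
      have R1R : R1 ^+ 2 <= R2 ^+ 2 by rewrite ler_pXn2r ?nnegrE ?(ltW R10) ?(ltW R20) ?(ltW R12).
      have p2R : 0 <= p.2 * R1 by rewrite mulr_ge0 ?(ltW p2) ?(ltW R10).
      rewrite (_ : _ + _ = p.1 ^+ 2 + p.2 ^+ 2 - 2 * (p.2 * R1) + R1 ^+ 2); last by ring.
      by have := sqr_ge0 R2; clear -R10 R12 R20 pR R1R p2R; lra.
    have q0' : 0 < dist2 R1 M p by rewrite (lt_trans _ q1).
    apply: (@le_trans _ _ (ln (4 * R2 ^+ 2 / M))).
      by rewrite ler_ln ?posrE// (lt_le_trans q0').
    rewrite lnM ?mulr_gt0 ?exprn_gt0// /P -/c3 addrC lerD2l.
    exact: ler_norm.
  rewrite ge0_integralD//; last 4 first.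
  + by move=> p _; rewrite -EFinM lee_fin mulr_ge0.
  + by apply: emeasurable_funM => //; exact: measurable_funTS.
  + by move=> p _; rewrite -EFinM lee_fin mulr_ge0.
  + by apply: emeasurable_funM => //; exact: measurable_funTS.
  rewrite ge0_integralZl//; last 2 first.
  + exact: measurable_funTS.
  + by move=> p _; rewrite lee_fin.
  rewrite ge0_integralZl//; last 2 first.
  + exact: measurable_funTS.
  + by move=> p _; rewrite lee_fin.
  rewrite [leRHS]EFinD; apply: leeD.
    rewrite [leRHS]EFinM; apply: lee_wpmul2l; first by rewrite lee_fin.
    apply: (le_trans (psi_energy R10 R12 r0 r1 r2 M0)); rewrite lee_fin lerD2r.
    by rewrite ler_wpM2l ?(ltW m0)// ler_wpM2r ?(ltW pi0)// ler_wpM2l.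
  apply: (@le_trans _ _ (((1 + e^-1) * P ^+ 2)%:E * (A / n)%:E)%E).
    by apply: lee_wpmul2l; [rewrite lee_fin|exact: (chi_energy R10 R12 n0)].
  by rewrite -EFinM lee_fin.
- apply: (le_trans _ (trial_norm R10 R12 r0 r1 r2 n0 M0 (ltW Y0) rM1 _)); last by rewrite lr.
  rewrite lee_fin ler_wpM2l ?sqr_ge0// /N1; clear -R10 R12 R20 nw; lra.
Qed.

End UpperBound.

(** * The lowest eigenvalue of the cracked quarter disc *)
Section EigenvalueBounds.
Local Set Implicit Arguments.
Local Unset Strict Implicit.
Context {R : realType}.
Local Notation mR := (measurableTypeR R).
Local Notation plane := (mR * mR)%type.
Local Notation leb := (@lebesgue_measure R).
Local Notation leb2 := (leb \x leb)%E.
Variables (R1 R2 : R) (R10 : 0 < R1) (R12 : R1 < R2).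
Let R20 : 0 < R2 := lt_trans R10 R12.
Local Notation gs := (gs R2).
Local Notation a := (gs_scale R2).
Local Notation N0 := (gs_norm R2).
Variable d : R.
Local Notation D := (cracked_quarter_disc R1 R2 (pi / 2 - d)).
Local Notation G := (dirichlet_part R1 R2 (pi / 2 - d)).
Local Notation ip := (ip leb2 (D : set plane)).
Local Notation nrm f := (ip f f).
Local Notation dirichlet := (energy leb2 (D : set plane)).

Let mD : measurable (D : set plane).
Proof. exact: measurable_cracked_quarter_disc. Qed.

Let bD : exists M : R, forall p, D p -> `|p.1| <= M /\ `|p.2| <= M.
Proof.
exists R2 => p; rewrite cracked_quarter_discE// => -[[p1 p2 pR] _].
have h x y : 0 < x -> x ^+ 2 + y ^+ 2 < R2 ^+ 2 -> `|x| <= R2.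
  move=> x0 xy; rewrite gtr0_norm// -(ler_pXn2r (_ : 0 < 2)%N) ?nnegrE ?(ltW x0) ?(ltW R20)//.
  by apply: ltW; apply: le_lt_trans xy; rewrite lerDl sqr_ge0.
by split; [exact: h p1 pR|apply: h p2 _; rewrite addrC; exact: pR].
Qed.

Lemma nrmE (f : R * R -> R) : continuous f ->
  (\int[leb2]_(p in quarter_disc R2) (f p ^+ 2)%:E = (nrm f)%:E)%E.
Proof.
move=> cf; rewrite -(ipE mD (continuous_sq_integrable mD bD cf)).
rewrite integral_cracked_quarter_disc//.
  by apply: measurable_fun_continuous2 => p; apply: cvgM; exact: cf.
by move=> p; rewrite lee_fin sqr_ge0.
Qed.

Lemma continuous_gs : continuous gs.
Proof. exact: has_gradient_continuous (has_gradient_gs R2). Qed.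

Lemma nrm_gs : nrm gs = N0.
Proof.
by apply: EFin_inj; rewrite -(nrmE continuous_gs) (integral_gs2 R20).
Qed.

(** All the terms of [energy_identity] but the defect are known to be finite. *)
Lemma test_energy f : test_function G f -> exists def : R, [/\ 0 <= def,
  (\int[leb2]_(p in quarter_disc R2) (defect R2 f (dx f) (dy f) p)%:E = def%:E)%E &
  dirichlet (dx f) (dy f) = 4 * a * nrm f + def].
Proof.
move=> [Cf f0]; have hf := C1_gradient Cf; have [_ _ _ cx cy] := hf.
have cf := has_gradient_continuous hf; have mQ := measurable_quarter_disc R2.
have f00 t : 0 < t < pi / 2 -> \forall q \near polar R2 t, f q = 0.
  by move=> /andP[t0 t1]; apply: f0; left; exists t => //=; rewrite !ltW.
have := energy_identity R20 hf f00; rewrite (nrmE cf).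
have -> : (\int[leb2]_(p in quarter_disc R2) (dx f p ^+ 2 + dy f p ^+ 2)%:E =
    (dirichlet (dx f) (dy f))%:E)%E.
  have mx : measurable_fun (setT : set plane) (fun p => (dx f p ^+ 2)%:E).
    by apply: measurable_fun_continuous2 => p; apply: cvgM; exact: cx.
  have my : measurable_fun (setT : set plane) (fun p => (dy f p ^+ 2)%:E).
    by apply: measurable_fun_continuous2 => p; apply: cvgM; exact: cy.
  have Ex := nrmE cx; have Ey := nrmE cy.
  transitivity (\int[leb2]_(p in quarter_disc R2) (dx f p ^+ 2)%:E +
      \int[leb2]_(p in quarter_disc R2) (dy f p ^+ 2)%:E)%E.
    under eq_integral do rewrite EFinD.
    apply: ge0_integralD => //.
    - by move=> p _; rewrite lee_fin sqr_ge0.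
    - exact: (measurable_funTS mx).
    - by move=> p _; rewrite lee_fin sqr_ge0.
    - exact: (measurable_funTS my).
  exact: (f_equal2 (fun x y => x + y)%E Ex Ey).
move=> E.
set I := (\int[leb2]_(p in quarter_disc R2) (defect R2 f (dx f) (dy f) p)%:E)%E in E *.
have I0 : (0 <= I)%E by apply: integral_ge0 => p _; rewrite lee_fin defect_ge0.
case: I I0 E => [r| |]//= r0.
  move=> E2; exists r; split => //; exact: EFin_inj E2.
Qed.

Lemma test_vanishes f : test_function G f ->
  forall s, pi / 2 - d <= s <= pi / 2 -> f (polar R1 s) = 0.
Proof.
by move=> [_ f0] s sI; apply: (nbhs_singleton (f0 _ _)); right; exists s.
Qed.

(** Among the [T], the distance from [f] to [T * gs] is least for the orthogonal
    projection. *)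
Lemma spectral_gap C : 0 < C ->
  (forall f fx fy, has_gradient f fx fy -> forall E : R,
    (\int[leb2]_(p in quarter_disc R2) (defect R2 f fx fy p)%:E < E%:E)%E ->
    exists T : R, (\int[leb2]_(p in quarter_disc R2) ((f p - T * gs p) ^+ 2)%:E <= (C * E)%:E)%E) ->
  forall f, test_function G f ->
  (4 * a + C^-1) * nrm f - C^-1 * (ip f gs ^+ 2 / nrm gs) <= dirichlet (dx f) (dy f).
Proof.
move=> C0 hC f tf; have [def [def0 hdef ->]] := test_energy tf.
have hf := C1_gradient (proj1 tf); have cf := has_gradient_continuous hf.
have N00 : 0 < N0 := gs_norm_gt0 R20; rewrite nrm_gs.
suff h : nrm f - ip f gs ^+ 2 / N0 <= C * def.
  by rewrite mulrDl -addrA lerD2l -mulrBr ler_pdivrMl.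
apply/ler_addgt0Pl => e e0.
have e1 : 0 < e / C by rewrite divr_gt0.
have hdef' : (\int[leb2]_(p in quarter_disc R2) (defect R2 f (dx f) (dy f) p)%:E < (def + e / C)%:E)%E.
  by rewrite hdef lte_fin ltrDl.
have [T hT] := hC _ _ _ hf _ hdef'.
have cfT : continuous (fun p => 1 * f p + (- T) * gs p).
  move=> p; apply: cvgD; apply: cvgMr; [exact: cf|exact: continuous_gs].
have sf := continuous_sq_integrable mD bD cf.
have sg := continuous_sq_integrable mD bD continuous_gs.
have : nrm (fun p => 1 * f p + (- T) * gs p) <= C * (def + e / C).
  rewrite -lee_fin -(nrmE cfT); apply: le_trans hT; rewrite le_eqVlt; apply/orP; left; apply/eqP.
  by apply: eq_integral => p _; rewrite mul1r mulNr.
rewrite (ip_lin2 mD 1 (- T) sf sg) nrm_gs => h.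
rewrite addrC; apply: le_trans (_ : C * (def + e / C) <= _); last first.
  by rewrite mulrDr (_ : C * (e / C) = e) 1?addrC//; field; rewrite gt_eqF.
apply: le_trans h; rewrite -subr_ge0.
rewrite (_ : _ - _ = (T * N0 - ip f gs) ^+ 2 / N0); first by rewrite divr_ge0 ?sqr_ge0// ltW.
by field; rewrite gt_eqF.
Qed.

(** A function [f0] with a defect quotient below [C^-1] is below the spectral gap; hence
    the lowest eigenvalue is the infimum of the Rayleigh quotients, which are
    [4 * a] plus the defect quotients. *)
Lemma eigenvalue_variational C f0 (def0 N : R) : 0 < C ->
  (forall f fx fy, has_gradient f fx fy -> forall E : R,
    (\int[leb2]_(p in quarter_disc R2) (defect R2 f fx fy p)%:E < E%:E)%E ->
    exists T : R, (\int[leb2]_(p in quarter_disc R2) ((f p - T * gs p) ^+ 2)%:E <= (C * E)%:E)%E) ->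
  test_function G f0 -> 0 < N -> C * def0 < N ->
  (\int[leb2]_(p in quarter_disc R2) (defect R2 f0 (dx f0) (dy f0) p)%:E <= def0%:E)%E ->
  (N%:E <= \int[leb2]_(p in quarter_disc R2) (f0 p ^+ 2)%:E)%E ->
  lambda1_NND R1 R2 (pi / 2 - d) <= 4 * a + def0 / N /\
  forall c, (forall f (def : R), test_function G f ->
    (\int[leb2]_(p in quarter_disc R2) (defect R2 f (dx f) (dy f) p)%:E = def%:E)%E ->
    (((c - 4 * a))%:E * \int[leb2]_(p in quarter_disc R2) (f p ^+ 2)%:E <= def%:E)%E) ->
    c <= lambda1_NND R1 R2 (pi / 2 - d).
Proof.
move=> C0 hC tf0 N0' CN hdef hN.
have cf f : test_function G f -> continuous f.
  by move=> [/C1_gradient hf _]; exact: has_gradient_continuous hf.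
have sg := continuous_sq_integrable mD bD continuous_gs.
have g0 : 0 < nrm gs by rewrite nrm_gs; exact: gs_norm_gt0.
have CV : 0 < C^-1 by rewrite invr_gt0.
have [e0 [e00 he0 E0]] := test_energy tf0.
rewrite he0 lee_fin in hdef; rewrite (nrmE (cf _ tf0)) lee_fin in hN.
have n0 : 0 < nrm f0 by exact: lt_le_trans hN.
have f0lt : dirichlet (dx f0) (dy f0) < (4 * a + C^-1) * nrm f0.
  rewrite E0 [X in _ < X]mulrDl ltrD2l -ltr_pdivrMl// invrK (le_lt_trans _ (lt_le_trans CN hN))//.
  by rewrite ler_pM2l.
have [h1 h2] := lowest_eigenvalue_rayleigh mD bD CV sg g0 (spectral_gap C0 hC) tf0 f0lt.
split.
  have := h1 _ tf0; rewrite E0 -ler_pdivlMr// => h; apply: (le_trans h).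
  rewrite mulrDl mulfK ?gt_eqF// lerD2l.
  apply: ler_pM => //; first by rewrite invr_ge0 ltW.
  by rewrite lef_pV2 ?posrE.
move=> c hc; apply: h2 => f tf; have [e [_ he ->]] := test_energy tf.
by have := hc _ _ tf he; rewrite (nrmE (cf _ tf)) -EFinM lee_fin mulrBl lerBlDl.
Qed.

End EigenvalueBounds.

Section Asymptotics.
Local Set Implicit Arguments.
Local Unset Strict Implicit.
Context {R : realType}.
Local Notation leb := (@lebesgue_measure R).
Local Notation leb2 := (leb \x leb)%E.
Variables (R1 R2 : R) (R10 : 0 < R1) (R12 : R1 < R2).
Let R20 : 0 < R2 := lt_trans R10 R12.
Local Notation a := (gs_scale R2).
Local Notation lam d := (lambda1_NND R1 R2 (pi / 2 - d)).

(** The second conclusion, the converse bound, is stated here because it also rests on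
    the trial function, which places the infimum below the gap. *)
Lemma eigenvalue_upper_bound k : shift_coef R1 R2 < k ->
  exists2 d0 : R, 0 < d0 & forall d, 0 < d <= d0 -> lam d <= 4 * a + k / `|ln d| /\
  forall c, (forall f (def : R), test_function (dirichlet_part R1 R2 (pi / 2 - d)) f ->
    (\int[leb2]_(p in quarter_disc R2) (defect R2 f (dx f) (dy f) p)%:E = def%:E)%E ->
    (((c - 4 * a))%:E * \int[leb2]_(p in quarter_disc R2) (f p ^+ 2)%:E <= def%:E)%E) ->
    c <= lam d.
Proof.
move=> kk; have [C C0 hC] := gap R20; have [d1 d10 hd1] := defect_upper_bound R10 R12 kk.
exists (Num.min d1 (expR (- (`|k| * C + 1)))).
  by rewrite lt_min d10 expR_gt0.
move=> d /andP[d0]; rewrite le_min => /andP[dd1 dd2].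
have lnd : ln d <= - (`|k| * C + 1) by rewrite -[leRHS]expRK ler_ln ?posrE ?expR_gt0.
have kC : 0 <= `|k| * C by rewrite mulr_ge0// ltW.
have lE : `|ln d| = - ln d by rewrite ler0_norm// (le_trans lnd)//; lra.
have l1 : `|k| * C + 1 <= `|ln d| by rewrite lE; lra.
have l0 : 0 < `|ln d| by lra.
have d0d1 : 0 < d <= d1 by rewrite d0.
have [f [fx [fy [hf f0 [E [N [N0 EN hE hN]]]]]]] := hd1 d d0d1.
have [_ fxE fyE _ _] := hf.
have tf : test_function (dirichlet_part R1 R2 (pi / 2 - d)) f.
  by split => //; exact: has_gradientP hf.
rewrite -fxE -fyE in hE.
have EkN : E <= k * N / `|ln d| by rewrite ler_pdivlMr.
have CE : C * E < N.
  apply: (@le_lt_trans _ _ (C * (k * N / `|ln d|))); first by rewrite ler_pM2l.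
  rewrite !mulrA ltr_pdivrMr// -mulrA mulrCA mulrA [N * _]mulrC ltr_pM2r//.
  apply: (@le_lt_trans _ _ (`|k| * C)); last by lra.
  by rewrite ler_wpM2r ?(ltW C0)// ler_norm.
have [h1 h2] := eigenvalue_variational R10 R12 C0 hC tf N0 CE hE hN.
split => //; apply: (le_trans h1); rewrite lerD2l ler_pdivrMr//.
by rewrite (_ : k / _ * N = k * N / `|ln d|)// mulrAC.
Qed.

Lemma eigenvalue_lower_bound k : 0 < k < shift_coef R1 R2 ->
  exists C d0 : R, [/\ 0 <= C, 0 < d0 & forall d, 0 < d <= d0 ->
    4 * a + (`|ln d| / k + C)^-1 <= lam d].
Proof.
move=> kk; have [k0 _] := andP kk.
have [C [d1 [C0 d10 hd1]]] := defect_lower_bound R10 R12 kk.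
have kk1 : shift_coef R1 R2 < shift_coef R1 R2 + 1 by rewrite ltrDl.
have [d2 d20 hd2] := eigenvalue_upper_bound kk1.
exists C, (Num.min (Num.min d1 d2) 2^-1); split => //.
  by rewrite !lt_min d10 d20 invr_gt0 ltr0n.
move=> d /andP[d0]; rewrite !le_min => /andP[/andP[dd1 dd2] dd3].
have d0d1 : 0 < d <= d1 by rewrite d0.
have d0d2 : 0 < d <= d2 by rewrite d0.
have l0 : 0 < `|ln d|.
  by rewrite normr_gt0 lt_eqF// ln_lt0// d0/= (le_lt_trans dd3)// invf_lt1// ltr1n.
have K0 : 0 < `|ln d| / k + C by rewrite ltr_wpDr// divr_gt0.
have [_ h] := hd2 d d0d2; apply: h => f def tf hdef.
rewrite addrC addKr; have hf := C1_gradient (proj1 tf).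
set I := (\int[leb2]_(p in quarter_disc R2) (f p ^+ 2)%:E)%E.
have hI e : 0 < e -> (I <= ((def + e) * (`|ln d| / k + C))%:E)%E.
  move=> e0; apply: (hd1 d d0d1 _ _ _ hf (test_vanishes tf)).
  by rewrite hdef lte_fin ltrDl.
have I0 : (0 <= I)%E by apply: integral_ge0 => p _; rewrite lee_fin sqr_ge0.
have : I \is a fin_num by rewrite ge0_fin_numE//; apply: le_lt_trans (hI 1 ltr01) (ltry _).
move: I hI {I0} => [r| |]// hI _; rewrite -EFinM lee_fin mulrC ler_pdivrMr//.
apply/ler_addgt0Pl => e e0; have e1 : 0 < e / (`|ln d| / k + C) by rewrite divr_gt0.
have := hI _ e1; rewrite lee_fin mulrDl divfK ?gt_eqF//.
by rewrite addrC.
Qed.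

Lemma eigenvalue_asymptotics e : 0 < e ->
  exists2 d0 : R, 0 < d0 & forall d, 0 < d <= d0 ->
  `|lam d - (4 * a + shift_coef R1 R2 * (1 / `|ln d|))| <= e * `|1 / `|ln d| |.
Proof.
move=> e0; set ka := shift_coef R1 R2.
have ka0 : 0 < ka.
  rewrite /ka /shift_coef divr_gt0 ?gs_norm_gt0// mulr_gt0 ?pi_gt0// exprn_gt0//.
  by apply: (gsr_gt0 R20); rewrite (ltW R10).
have kk1 : ka < ka + e by rewrite ltrDl.
have [d1 d10 hd1] := eigenvalue_upper_bound kk1.
pose k := Num.max (ka - e / 2) (ka / 2).
have k0 : 0 < k by rewrite lt_max divr_gt0 ?orbT.
have kk : 0 < k < shift_coef R1 R2.
  by rewrite k0/= gt_max; apply/andP; split; rewrite -/ka; lra.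
have kge : ka - e / 2 <= k by rewrite le_max lexx.
have [C [d2 [C0 d20 hd2]]] := eigenvalue_lower_bound kk.
pose L0 := k * (ka * C) / (e / 2) + 1.
exists (Num.min (Num.min d1 d2) (expR (- L0))).
  by rewrite !lt_min d10 d20 expR_gt0.
move=> d /andP[d0]; rewrite !le_min => /andP[/andP[dd1 dd2] dd3].
have d0d1 : 0 < d <= d1 by rewrite d0.
have d0d2 : 0 < d <= d2 by rewrite d0.
have [hu _] := hd1 d d0d1; have hl := hd2 d d0d2.
have lnd : ln d <= - L0 by rewrite -[leRHS]expRK ler_ln ?posrE ?expR_gt0.
have q0 : 0 <= k * (ka * C) / (e / 2).
  by rewrite divr_ge0 ?divr_ge0 ?(ltW e0)// mulr_ge0 ?(ltW k0)// mulr_ge0 ?(ltW ka0).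
have lE : `|ln d| = - ln d by rewrite ler0_norm// (le_trans lnd)// /L0; lra.
have lL : L0 <= `|ln d| by rewrite lE; lra.
set l := `|ln d| in hu hl lL *.
have l1 : k * (ka * C) / (e / 2) <= l by move: lL; rewrite /L0; lra.
have l0 : 0 < l by move: lL; rewrite /L0; lra.
have K0 : 0 < l / k + C by rewrite ltr_wpDr// divr_gt0.
have key : (ka - e) * (l / k + C) <= l.
  have h1 : (ka - e) * (l / k) <= (k - e / 2) * (l / k).
    by apply: ler_wpM2r; [rewrite divr_ge0 ?(ltW l0) ?(ltW k0)|lra].
  have h2 : (ka - e) * C <= ka * C by apply: ler_wpM2r => //; lra.
  have h3 : (k - e / 2) * (l / k) = l - e / 2 * l / k by field; rewrite gt_eqF.
  have h4 : ka * C <= e / 2 * l / k.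
    move: l1; rewrite ler_pdivrMr ?divr_gt0// ler_pdivlMr// => l1.
    by rewrite mulrC (le_trans l1)// mulrC.
  by rewrite mulrDr; lra.
have key2 : ka / l - e / l <= (l / k + C)^-1.
  by rewrite -mulrBl ler_pdivrMr// mulrC ler_pdivlMr.
rewrite !mul1r [X in _ <= _ * X]ger0_norm ?invr_ge0 ?(ltW l0)//.
have hu' : (ka + e) / l = ka / l + e / l by rewrite mulrDl.
rewrite hu' in hu; move: hu hl; set x := lam d => hu hl.
by rewrite ler_norml; apply/andP; split; lra.
Qed.

End Asymptotics.

Theorem mainTheorem9 (R : realType) (R1 R2 : R) (hR1 : 0 < R1) (hR12 : R1 < R2) :
  let j01 : R := bessel_zero R 0 1 in
  let F : set_system R := (pi / 2)^'- in
  (fun eps : R => lambda1_NND R1 R2 eps) =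
  (fun eps : R =>
     j01 ^+ 2 / R2 ^+ 2
     + 4 / R2 ^+ 2
       * (besselJ 0 (j01 * R1 / R2) / derive1 (besselJ 0) j01) ^+ 2
       * (1 / `|ln (pi / 2 - eps)|))
  +o_F (fun eps : R => 1 / `|ln (pi / 2 - eps)|).
Proof.
cbv zeta; rewrite bessel_zero01.
have R20 := lt_trans hR1 hR12.
have z0 := @bes_zero_gt0 R; have sz0 : 0 < Num.sqrt (bes_zero : R) by rewrite sqrtr_gt0.
have z2 : Num.sqrt (bes_zero : R) ^+ 2 = bes_zero by rewrite sqr_sqrtr// ltW.
have c1 : j01 ^+ 2 / R2 ^+ 2 = 4 * gs_scale R2 by rewrite j01_sqr /gs_scale mulrA.
(* [derive1 (besselJ 0) j01 ^+ 2] is [bes_zero * bes' bes_zero ^+ 2]. *)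
have c2 : 4 / R2 ^+ 2 * (besselJ 0 (j01 * R1 / R2) / derive1 (besselJ 0) j01) ^+ 2 =
    shift_coef R1 R2.
  rewrite besselJ0E derive_besselJ0 (_ : j01 ^+ 2 / 4 = bes_zero); last first.
    by rewrite j01_sqr; field.
  rewrite (_ : (j01 * R1 / R2) ^+ 2 / 4 = gs_scale R2 * R1 ^+ 2); last first.
    rewrite /gs_scale (_ : bes_zero = j01 ^+ 2 / 4); last by rewrite j01_sqr; field.
    by move: j01 => j; field; rewrite gt_eqF.
  have b0 : bes' (bes_zero : R) != 0.
    by rewrite lt_eqF// bes'_lt0// z0 lexx.
  rewrite /shift_coef /gs_norm /gsr /j01.
  have pi0 : (pi : R) != 0 by rewrite gt_eqF// pi_gt0.
  move: (pi : R) pi0 (bes _) (bes' _) b0 => q q0 x y y0.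
  move: (Num.sqrt _) sz0 z2 => s s0 <-; field.
  by rewrite q0 y0 !gt_eqF.
apply/eqaddoP => e e0; rewrite c1 c2.
have [d0 d00 hd] := eigenvalue_asymptotics hR1 hR12 e0.
near=> eps.
have epslt : eps < pi / 2 by near: eps; exact: nbhs_left_lt.
have epsgt : pi / 2 - d0 < eps by near: eps; apply: nbhs_left_gt; rewrite gtrBl.
have dI : 0 < pi / 2 - eps <= d0 by apply/andP; split; lra.
have := hd _ dI; rewrite (_ : pi / 2 - (pi / 2 - eps) = eps) ?subKr//.
Unshelve. all: by end_near.
Qed.
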